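(* Let $N=2$. Then the success probability of dual-branch MRC is $$\mathtt{P}_{\mathrm{MRC}}=\sum_{k=0}^{m_{\mathrm D}-1}\frac{(-1)^{k+m_{\mathrm D}}}{k!\,\Gamma(m_{\mathrm D})}\int_0^\infty \frac{1}{z}\,\frac{\partial^{k}\partial^{m_{\mathrm D}}}{\partial s^{k}\partial t^{m_{\mathrm D}}}\left[\exp\!\left(-\frac{(T-z)^{+}s\,m_{\mathrm D}}{\mathtt{SNR}}-\frac{z t\, m_{\mathrm D}}{\mathtt{SNR}}-\pi\lambda\,\mathcal A(z,s,t)\right)\right]_{s=1,\,t=1}\mathrm dz,$$ where, for $s,t>0$, $$\mathcal A(z,s,t)=\begin{cases} s^{2/\alpha}(T-z)^{2/\alpha}d^{2}\,\Gamma(1-\tfrac{2}{\alpha})\left(\tfrac{m_{\mathrm D}}{m_{\mathrm I}}\right)^{2/\alpha}\Gamma(\tfrac{2}{\alpha}+2m_{\mathrm I})\;{}_2\mathbf F_1\!\left(-\tfrac{2}{\alpha},m_{\mathrm I};2m_{\mathrm I};1-\tfrac{zt}{(T-z)s}\right), & 0\le z<T,\\[4pt] (zt)^{2/\alpha}d^{2}\,\Gamma(1-\tfrac{2}{\alpha})\left(\tfrac{m_{\mathrm D}}{m_{\mathrm I}}\right)^{2/\alpha}\dfrac{\Gamma(\tfrac{2}{\alpha}+m_{\mathrm I})}{\Gamma(m_{\mathrm I})}, & z\ge T.\end{cases}$$ (When $\mathtt{SNR}=\infty$ the terms with $\mathtt{SNR}^{-1}$ are absent.)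
   Context: Let $\Phi=\{\mathsf x_i\}_{i\ge0}$ be a homogeneous Poisson point process on $\mathbb R^2$ of intensity $\lambda>0$ (interferer locations). A receiver with $N$ antennas is at the origin; the desired transmitter is at distance $d>0$. Fix a path loss exponent $\alpha>2$, an average signal-to-noise ratio $\mathtt{SNR}\in(0,\infty]$, and a threshold $T>0$. Fading gains: $\mathsf g_1,\dots,\mathsf g_N$ are Gamma distributed with shape $m_{\mathrm D}$ and scale $1/m_{\mathrm D}$ (density $\frac{m^m y^{m-1}}{\Gamma(m)}e^{-my}$, $y\ge0$, with $m=m_{\mathrm D}$), where $m_{\mathrm D}$ is a positive integer; for each branch $n$ and each interferer $i$, $\mathsf h_{n,i}$ is Gamma distributed with shape $m_{\mathrm I}>0$ and scale $1/m_{\mathrm I}$; all $\mathsf g_n$ and $\mathsf h_{n,i}$ are mutually independent and independent of $\Phi$. The normalized interference at branch $n$ is $\mathsf I_n=d^{\alpha}\sum_{i}\mathsf h_{n,i}\|\mathsf x_i\|^{-\alpha}$. The post-combiner SINR of (interference-aware) MRC is $\mathsf{SINR}_{\mathrm{MRC}}=\sum_{n=1}^N \frac{\mathsf g_n}{\mathsf I_n+\mathtt{SNR}^{-1}}$ and the success probability is $\mathtt P_{\mathrm{MRC}}=\mathbb P(\mathsf{SINR}_{\mathrm{MRC}}\ge T)$. $(x)^+=\max\{0,x\}$. ${}_2\mathbf F_1(a,b;c;x)={}_2F_1(a,b;c;x)/\Gamma(c)$ denotes the regularized Gauss hypergeometric function (analytically continued to $x<1$). *)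

(* Defs.v *)
From HB Require Import structures.
From mathcomp Require Import all_boot all_order all_algebra.
From mathcomp Require Import all_classical all_reals all_analysis.

Set Implicit Arguments.
Unset Strict Implicit.
Unset Printing Implicit Defensive.

Import Order.TTheory GRing.Theory Num.Theory.
Import numFieldNormedType.Exports.
Local Open Scope classical_set_scope.
Local Open Scope ring_scope.

Section defs.
Context {R : realType}.

Definition Gammaf (x : R) : R :=
  Rintegral lebesgue_measure `]0%R, +oo[ (fun u : R => u `^ (x - 1) * expR (- u)).

Definition pochhammer (a : R) (n : nat) : R := \prod_(i < n) (a + i%:R).

Definition hyp2F1_series (a b c x : R) : R :=
  limn (fun N : nat => \sum_(n < N)
     (pochhammer a n * pochhammer b n / (pochhammer c n * n`!%:R)) * x ^+ n).

(* 2F1(a,b;c;x) analytically continued to x < 1: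
   the power series on (-1,1), and on (-oo,-1] the analytic continuation given
   by the Pfaff transformation 2F1(a,b;c;x) = (1-x)^(-a) 2F1(a,c-b;c;x/(x-1)),
   where x/(x-1) lies in [1/2,1). *)
Definition hyp2F1 (a b c x : R) : R :=
  if -1 < x then hyp2F1_series a b c x
  else (1 - x) `^ (- a) * hyp2F1_series a (c - b) c (x / (x - 1)).

Definition hyp2F1reg (a b c x : R) : R := hyp2F1 a b c x / Gammaf c.

Definition norm2 (p : R * R) : R := Num.sqrt (p.1 ^+ 2 + p.2 ^+ 2).

Definition leb2 := (@lebesgue_measure R \x @lebesgue_measure R)%E.

Definition bounded2 (A : set (R * R)) : Prop :=
  exists r : R, forall p, A p -> `|p.1| <= r /\ `|p.2| <= r.

Definition poisson_mass (mu : R) (k : nat) : R := expR (- mu) * mu ^+ k / k`!%:R.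

Definition gamma_pdf (m : R) (y : R) : R :=
  m `^ m * y `^ (m - 1) * expR (- (m * y)) / Gammaf m.

Context {d : measure_display} {Omega : measurableType d}.

Definition gamma_law (P : probability Omega R) (m : R) (X : Omega -> R) : Prop :=
  measurable_fun setT X /\
  forall B : set R, measurable B ->
    P (X @^-1` B) =
    (\int[lebesgue_measure]_(y in B `&` `[0%R, +oo[) (gamma_pdf m y)%:E)%E.

Definition count_pts (x : nat -> Omega -> R * R) (A : set (R * R)) (w : Omega)
  : \bar R := (\sum_(i <oo) (\1_A (x i w))%:E)%E.

Definition is_PPP (P : probability Omega R) (lam : R) (x : nat -> Omega -> R * R)
  : Prop :=
  (forall i, measurable_fun setT (x i)) /\
  forall (k : nat) (A : 'I_k -> set (R * R)) (n : 'I_k -> nat),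
    (forall j, measurable (A j)) -> (forall j, bounded2 (A j)) ->
    (forall j j', j != j' -> A j `&` A j' = set0) ->
    P (\big[setI/setT]_(j < k) [set w | count_pts x (A j) w = (n j)%:R%:E]) =
    (\prod_(j < k) (poisson_mass (lam * fine (leb2 (A j))) (n j))%:E)%E.

Definition sigma_rv {d'} {T : measurableType d'} (X : Omega -> T) : set (set Omega) :=
  <<s [set E | exists B, measurable B /\ E = X @^-1` B] >>.

Definition sigma_pp (x : nat -> Omega -> R * R) : set (set Omega) :=
  <<s [set E | exists i B, measurable B /\ E = x i @^-1` B] >>.

Definition mutually_indep (P : probability Omega R) {I : eqType}
  (F : I -> set (set Omega)) : Prop :=
  forall (J : seq I) (E : I -> set Omega), uniq J ->
    (forall j, j \in J -> F j (E j)) ->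
    P (\big[setI/setT]_(j <- J) E j) = (\prod_(j <- J) P (E j))%E.

Definition inv_snr (snr : \bar R) : R :=
  match snr with r%:E => r^-1 | _ => 0 end.

Definition interf (dist alpha : R) (x : nat -> Omega -> R * R)
  (hn : nat -> Omega -> R) (w : Omega) : \bar R :=
  ((dist `^ alpha)%:E * \sum_(i <oo) (hn i w * norm2 (x i w) `^ (- alpha))%:E)%E.

(* post-combiner SINR of MRC with N = 2 branches
   (a branch with infinite interference contributes 0) *)
Definition sinr_mrc2 (dist alpha : R) (snr : \bar R) (x : nat -> Omega -> R * R)
  (g : 'I_2 -> Omega -> R) (h : 'I_2 -> nat -> Omega -> R) (w : Omega) : R :=
  \sum_(n < 2) g n w / fine (interf dist alpha x (h n) w + (inv_snr snr)%:E)%E.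

End defs.

Section formula.
Context {R : realType}.

Definition Afun (T dist alpha mI : R) (mD : nat) (z s t : R) : R :=
  if z < T then
    s `^ (2 / alpha) * (T - z) `^ (2 / alpha) * dist ^+ 2 * Gammaf (1 - 2 / alpha)
    * (mD%:R / mI) `^ (2 / alpha) * Gammaf (2 / alpha + 2 * mI)
    * hyp2F1reg (- (2 / alpha)) mI (2 * mI) (1 - z * t / ((T - z) * s))
  else
    (z * t) `^ (2 / alpha) * dist ^+ 2 * Gammaf (1 - 2 / alpha)
    * (mD%:R / mI) `^ (2 / alpha) * (Gammaf (2 / alpha + mI) / Gammaf mI).

Definition expo_fun (lam T dist alpha mI : R) (mD : nat) (snr : \bar R) (z s t : R)
  : R :=
  expR (- (Num.max (T - z) 0 * s * mD%:R * inv_snr snr)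
        - z * t * mD%:R * inv_snr snr
        - pi * lam * Afun T dist alpha mI mD z s t).

Definition mixed_deriv (lam T dist alpha mI : R) (mD : nat) (snr : \bar R)
  (k : nat) (z : R) : R :=
  derive1n k (fun s => derive1n mD
     (fun t => expo_fun lam T dist alpha mI mD snr z s t) 1) 1.

Definition P_mrc2_formula (lam T dist alpha mI : R) (mD : nat) (snr : \bar R) : R :=
  \sum_(k < mD) ((-1) ^+ (k + mD) / (k`!%:R * Gammaf mD%:R))
     * Rintegral lebesgue_measure `]0%R, +oo[
         (fun z => z^-1 * mixed_deriv lam T dist alpha mI mD snr k z).

End formula.

(* Main.v *)
Require Import Defs.
From HB Require Import structures.
From mathcomp Require Import all_boot all_order all_algebra.
From mathcomp Require Import all_classical all_reals all_analysis measurable_realfun.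
From mathcomp Require Import ring lra.
Set Implicit Arguments.
Unset Strict Implicit.
Unset Printing Implicit Defensive.
Import Order.TTheory GRing.Theory Num.Theory.
Import numFieldNormedType.Exports.
Local Open Scope classical_set_scope.
Local Open Scope ring_scope.

(* Conditionally on the interference, the signal gains can be integrated out: the
   survival function of one Gamma variable is a finite Poisson sum, and the
   substitution y = I_2 z in the other one gives P = E int z^-1 sum_k X^k/k!
   Y^mD/Gamma(mD) e^(-X-Y) dz, with X and Y linear in the two interferences. By
   Tonelli the expectation moves inside, and E[X^k Y^mD e^(-X-Y)] is, up to sign, a
   mixed derivative at (1, 1) of the joint Laplace transform E e^(-sX-tY).

   That transform is exp(-lam C) with C = int (1 - E e^(-W |p|^-alpha)) dp and
   W = dist^alpha (u h_1 + v h_2): average over the independent marks, then use the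
   Laplace functional of the Poisson process (counts of finitely many disjoint sets,
   then monotone limits). A layer-cake computation gives
   C = pi Gamma(1 - 2/alpha) E W^(2/alpha), and expanding (1 - w)^(2/alpha) in a
   binomial series turns this Gamma moment into the hypergeometric function. *)

(** * Gamma and beta integrals *)

(** The difficulty lies in what the hypotheses leave open. [is_PPP] only fixes the joint law of
    counts in disjoint bounded sets; it says nothing about a single [x i]. A priori the interference
    may be [+oo] or [0] or involve negative gains, and [fine], [limn] and inversion then return
    default values. Hence every Laplace transform is computed for the first N points, as a limit of
    integrals, and only then read as information on the interference: small arguments show that it
    is almost surely finite, large ones that it is almost surely positive. The two branches see the
    same points, so the transform does not factor; what remains is a fractional moment of a weighted
    sum of two independent Gamma gains. The two halves of [hyp2F1], power series and Pfaff's
    formula, correspond to factoring out one weight or the other. No product space is built: Omega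
    with the sigma-algebra of all other variables serves as the second factor. Integrability of the
    final integrals needs no estimate: up to sign their terms are nonnegative and add up to a
    probability. *)

Lemma tonelli_in (R : realType) (d1 d2 : measure_display)
  (T1 : measurableType d1) (T2 : measurableType d2)
  (m1 : {sigma_finite_measure set T1 -> \bar R})
  (m2 : {sigma_finite_measure set T2 -> \bar R})
  (D1 : set T1) (D2 : set T2) (f : T1 -> T2 -> \bar R) :
  measurable D1 -> measurable D2 ->
  measurable_fun setT (fun p : T1 * T2 => f p.1 p.2) ->
  (forall x y, D1 x -> D2 y -> (0 <= f x y)%E) ->
  (\int[m1]_(x in D1) \int[m2]_(y in D2) f x y =
   \int[m2]_(y in D2) \int[m1]_(x in D1) f x y)%E.
Proof.
move=> mD1 mD2 mf f0.
pose F := (fun p : T1 * T2 => f p.1 p.2) \_ (D1 `*` D2).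
have mF : measurable_fun setT F.
  apply/(measurable_restrictT _ _).1; first exact: measurableX.
  exact: measurable_funTS.
have F0 p : (0 <= F p)%E.
  rewrite /F patchE; case: ifPn => //; rewrite inE => -[? ?]; exact: f0.
have := fubini_tonelli (m1 := m1) (m2 := m2) F mF F0.
have -> : (\int[m1]_x \int[m2]_y F (x, y) =
   \int[m1]_(x in D1) \int[m2]_(y in D2) f x y)%E.
  rewrite [RHS]integral_mkcond; apply: eq_integral => x _.
  rewrite patchE; case: ifPn => xD.
    rewrite [RHS]integral_mkcond; apply: eq_integral => y _.
    by rewrite /F !patchE in_setX /= xD.
  apply: integral0_eq => y _; by rewrite /F patchE in_setX /= (negbTE xD).
move=> ->.
rewrite [RHS]integral_mkcond; apply: eq_integral => y _.
rewrite patchE; case: ifPn => yD.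
  rewrite [RHS]integral_mkcond; apply: eq_integral => x _.
  by rewrite /F !patchE in_setX /= yD andbT.
apply: integral0_eq => x _; by rewrite /F patchE in_setX /= (negbTE yD) andbF.
Qed.

Definition image_measure (d1 d2 : measure_display) (T1 : measurableType d1)
  (T2 : measurableType d2) (R : realType) (m : {measure set T1 -> \bar R})
  (f : T1 -> T2) (mf : measurable_fun setT f) : {measure set T2 -> \bar R} :=
  measure_function_pushforward__canonical__measure_function_Measure m mf.

(** * Change of scale for Lebesgue measure on the line *)

Section scale.
Context {R : realType}.
Local Notation mu := (@lebesgue_measure R).

Lemma measurable_mulrl (c : R) : measurable_fun setT (fun x : measurableTypeR R => (c * x) : measurableTypeR R).
Proof. exact: mulrl_measurable. Qed.

(** [c] times the image measure gives []a, b]] the mass b - a, hence it is Lebesgue measure by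
    uniqueness. *)
Lemma lebesgue_measure_preimage_mulrl (c : R) (A : set R) : 0 < c -> measurable A ->
  mu ((fun x => c * x) @^-1` A) = ((c^-1)%:E * mu A)%E.
Proof.
move=> c0 mA.
have cp : 0 <= c by exact: ltW.
pose nu := mscale (NngNum cp) (image_measure mu (measurable_mulrl c)).
have H : forall X, ocitv X -> mu X = nu X.
  move=> X [[a b] _ <-] /=.
  rewrite /nu /mscale /= /pushforward.
  have -> : (fun x => c * x) @^-1` [set` `]a, b]] = [set` `](c^-1 * a), (c^-1 * b)]].
    apply/seteqP; split => x /=; rewrite !in_itv /=;
    by rewrite !ler_pdivlMl ?ltr_pdivrMl.
  rewrite !lebesgue_measure_itv /= !lte_fin ltr_pM2l ?invr_gt0//.
  case: ifPn => ab; last by rewrite mule0.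
  rewrite -!EFinD -EFinM; congr EFin; field; exact: lt0r_neq0.
rewrite (lebesgue_measure_unique H mA) /nu /mscale /= /pushforward muleA -EFinM.
by rewrite mulVf ?mul1e// gt_eqF.
Qed.

Lemma ge0_integral_scale (c : R) (f : R -> \bar R) : 0 < c ->
  measurable_fun setT f -> (forall x : R, 0 < x -> (0 <= f x)%E) ->
  (\int[mu]_(x in `]0%R, +oo[) f (c * x)%R =
   (c^-1)%:E * \int[mu]_(x in `]0%R, +oo[) f x)%E.
Proof.
move=> c0 mf f0.
have cp : 0 <= c^-1 by rewrite invr_ge0 ltW.
transitivity (\int[image_measure mu (measurable_mulrl c)]_(x in `]0%R, +oo[) f x)%E.
  rewrite ge0_integral_pushforward//.
  - have -> // : (fun x : R => c * x) @^-1` `]0, +oo[ = `]0, +oo[%classic.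
    by apply/seteqP; split => x /=; rewrite !in_itv /= !andbT pmulr_rgt0.
  - exact: measurable_mulrl.
  - exact: measurable_funTS.
  - by move=> x; rewrite inE /= in_itv /= andbT => /f0.
transitivity (\int[mscale (NngNum cp) mu]_(x in `]0%R, +oo[) f x)%E; last first.
  rewrite ge0_integral_mscale//; first exact: measurable_funTS.
  by move=> x; rewrite /= in_itv /= andbT => /f0.
apply: eq_measure_integral => A mA _.
rewrite /mscale /= /pushforward; exact: lebesgue_measure_preimage_mulrl.
Qed.
End scale.
Section power_integral.
Context {R : realType}.
Local Notation mu := (@lebesgue_measure R).

Lemma continuous_powR_gt0 (p a : R) : 0 < a -> {for a, continuous (fun x => x `^ p)}.
Proof.
move=> a0; apply/differentiable_continuous/derivable1_diffP/derivable_powR.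
by rewrite in_itv /= a0.
Qed.

Lemma within_continuous_powR (p a b : R) : 0 < a ->
  {within `[a, b], continuous (fun x => x `^ p)}.
Proof.
move=> a0; apply: continuous_in_subspaceT => x; rewrite inE /= in_itv /= => /andP[ax _].
by apply: continuous_powR_gt0; exact: lt_le_trans ax.
Qed.

(** Fundamental theorem of calculus away from the origin, where the integrand blows up if
    [x < 1]. *)
Lemma integral_powR_cc (x a b : R) : 0 < x -> 0 < a -> a < b ->
  (\int[mu]_(v in `[a, b]) (x * v `^ (x - 1))%:E = (b `^ x)%:E - (a `^ x)%:E)%E.
Proof.
move=> x0 a0 ab.
apply: (@continuous_FTC2 _ _ (fun v => v `^ x)) => //.
- move=> v; apply: cvgM; first exact: cvg_cst.
  exact: within_continuous_powR.
- split.
  + move=> v; rewrite in_itv /= => /andP[av _]; apply: derivable_powR.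
    by rewrite in_itv /= andbT (lt_trans a0).
  + by apply: cvg_at_right_filter; exact: continuous_powR_gt0.
  + by apply: cvg_at_left_filter; apply: continuous_powR_gt0; exact: lt_trans ab.
- move=> v; rewrite in_itv /= => /andP[av _]; apply: powR_derive1.
  by rewrite in_itv /= andbT (lt_trans a0).
Qed.

Lemma measurable_powRl (p : R) : measurable_fun setT (fun x : R => x `^ p).
Proof. exact: measurable_powR. Qed.

Lemma integral_powR_oc (x u : R) : 0 < x -> 0 < u ->
  (\int[mu]_(v in `]0%R, u]) (x * v `^ (x - 1))%:E = (u `^ x)%:E)%E.
Proof.
move=> x0 u0.
(* These intervals exhaust []0, u]]; [n.+2] keeps the left end strictly below [u]. *)
pose F n : set R := `[u / n.+2%:R, u]%classic.
have FE : \bigcup_n F n = `]0%R, u]%classic.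
  apply/seteqP; split => v /=.
    move=> [n _]; rewrite /F /= !in_itv /= => /andP[h ->]; rewrite andbT.
    by apply: lt_le_trans h; rewrite divr_gt0.
  rewrite in_itv /= => /andP[v0 vu].
  have := archi_boundP (ltW (divr_gt0 u0 v0)); set n := Num.bound _ => hn.
  exists n => //; rewrite /F /= in_itv /= vu andbT ler_pdivrMr// mulrC -ler_pdivrMr//.
  apply: ltW; apply: (lt_le_trans hn); rewrite ler_nat.
  exact: leq_trans (leqnSn _).
have mf : measurable_fun setT (fun v : R => (x * v `^ (x - 1))%:E).
  apply/measurable_EFinP; apply: measurable_funM => //; exact: measurable_powRl.
have H1 : (\int[mu]_(v in F i) (x * v `^ (x - 1))%:E)%E @[i --> \oo] -->
  (\int[mu]_(v in `]0%R, u]) (x * v `^ (x - 1))%:E)%E.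
  rewrite -FE; apply: ge0_nondecreasing_set_cvg_integral => //.
  - move=> m n mn; apply/subsetPset => v; rewrite /F /= !in_itv /= => /andP[h ->].
    rewrite andbT (le_trans _ h)// ler_pM2l// lef_pV2 ?posrE// ler_nat.
    by rewrite !ltnS.
  - by move=> n; exact: measurable_itv.
  - by move=> n; exact: measurable_funTS.
  - by move=> n v _; rewrite lee_fin mulr_ge0 ?powR_ge0// ltW.
have H2 : (\int[mu]_(v in F i) (x * v `^ (x - 1))%:E)%E @[i --> \oo] --> (u `^ x)%:E.
  rewrite (_ : (fun i => _) = (fun i => (u `^ x - (u / i.+2%:R) `^ x)%:E)); last first.
    apply/funext => i; rewrite integral_powR_cc// ?divr_gt0//.
    by rewrite ltr_pdivrMr// ltr_pMr// ltr1n.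
  apply: cvg_EFin; first exact: nearW.
  rewrite -[X in _ --> X]subr0; apply: cvgB; first exact: cvg_cst.
  have /cvg_at_rightP := powR_cvg0 x0; apply.
  split => [n|]; first by rewrite divr_gt0.
  rewrite -[X in _ --> X](mulr0 u); apply: cvgM; first exact: cvg_cst.
  have := @cvg_harmonic R; rewrite -(cvg_shiftn 1); apply: cvg_trans.
  by apply: near_eq_cvg; apply: nearW => n; rewrite /harmonic /= addn1.
exact: cvg_unique H1 H2.
Qed.
End power_integral.
Lemma measurable_boolR (R : realType) (d : measure_display) (T : measurableType d)
  (b : T -> bool) : measurable_fun setT b -> measurable_fun setT (fun t => (b t)%:R : R).
Proof.
move=> mb.
have -> : (fun t => (b t)%:R : R) = (fun t => if b t then 1 else 0 : R).
  by apply/funext => t; case: (b t).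
by apply: measurable_fun_ifT.
Qed.

Section realvalued_integral.
Context {R : realType} {d : measure_display} {T : measurableType d}
  (mu : {measure set T -> \bar R}).

Lemma integralZl_EFin (D : set T) (c : R) (f : T -> R) : measurable D ->
  measurable_fun setT f -> (forall x, D x -> 0 <= f x) -> 0 <= c ->
  (\int[mu]_(x in D) (c * f x)%:E = c%:E * \int[mu]_(x in D) (f x)%:E)%E.
Proof.
move=> mD mf f0 c0; rewrite -ge0_integralZl//.
by apply/measurable_EFinP; exact: measurable_funTS.
Qed.

Lemma integralZr_EFin (D : set T) (c : R) (f : T -> R) : measurable D ->
  measurable_fun setT f -> (forall x, D x -> 0 <= f x) -> 0 <= c ->
  (\int[mu]_(x in D) (f x * c)%:E = \int[mu]_(x in D) (f x)%:E * c%:E)%E.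
Proof.
move=> mD mf f0 c0; rewrite muleC -integralZl_EFin//.
by apply: eq_integral => x _; rewrite mulrC.
Qed.

Lemma ge0_integralD_EFin (D : set T) (f g : T -> R) : measurable D ->
  measurable_fun setT f -> measurable_fun setT g ->
  (forall x, D x -> 0 <= f x) -> (forall x, D x -> 0 <= g x) ->
  (\int[mu]_(x in D) (f x + g x)%:E =
   \int[mu]_(x in D) (f x)%:E + \int[mu]_(x in D) (g x)%:E)%E.
Proof.
move=> mD mf mg f0 g0; rewrite -ge0_integralD//;
by apply/measurable_EFinP; exact: measurable_funTS.
Qed.

Lemma le_integral_EFin (D : set T) (f g : T -> R) : measurable D ->
  measurable_fun setT f -> measurable_fun setT g ->
  (forall x, D x -> 0 <= f x <= g x) ->
  (\int[mu]_(x in D) (f x)%:E <= \int[mu]_(x in D) (g x)%:E)%E.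
Proof.
move=> mD mf mg fg; apply: ge0_le_integral => //.
- by move=> x /fg /andP[]; rewrite lee_fin.
- by apply/measurable_EFinP; exact: measurable_funTS.
- by apply/measurable_EFinP; exact: measurable_funTS.
- by move=> x /fg /andP[]; rewrite lee_fin.
Qed.
End realvalued_integral.

Lemma powRD_gt0 (R : realType) (x r s : R) : 0 < x -> x `^ (r + s) = x `^ r * x `^ s.
Proof. by move=> x0; rewrite powRD// (gt_eqF x0) implybT. Qed.

Section Gamma.
Context {R : realType}.
Local Notation mu := (@lebesgue_measure R).

Lemma integral_expRN_cy (v : R) :
  (\int[mu]_(u in `[v, +oo[) (expR (- u))%:E = (expR (- v))%:E)%E.
Proof.
have d u : is_derive u (1:R) (fun u : R => - expR (- u)) (expR (- u)).
  by apply: is_derive_eq; rewrite mulrN1 opprK.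
rewrite (@ge0_continuous_FTC2y _ _ (fun u => - expR (- u)) _ 0)//.
- by rewrite add0e -EFinN opprK.
- apply: continuous_subspaceT => u; apply: continuous_comp; first exact: opp_continuous.
  exact: continuous_expR.
- rewrite -[X in _ --> X]oppr0; apply: cvgN; exact: cvgr_expR.
- have c : {for v, continuous (fun u : R => - expR (- u))}.
    by apply/differentiable_continuous/derivable1_diffP; have [] := d v.
  exact: cvg_at_right_filter.
- by move=> u _; rewrite derive1E; have [_ ->] := d u.
Qed.

Definition Gamma_int (x : R) : \bar R :=
  (\int[mu]_(u in `]0%R, +oo[) (u `^ (x - 1) * expR (- u))%:E)%E.

Lemma measurable_expRN : measurable_fun setT (fun u : R => expR (- u)).
Proof. by apply: measurableT_comp => //; exact: measurable_funN. Qed.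

Lemma Gamma_int_ge0 x : (0 <= Gamma_int x)%E.
Proof. by apply: integral_ge0 => u _; rewrite lee_fin mulr_ge0 ?powR_ge0 ?expR_ge0. Qed.

Lemma Gamma_int1 : Gamma_int 1 = 1%E.
Proof.
rewrite /Gamma_int subrr.
under eq_integral do rewrite powRr0 mul1r.
rewrite integral_itv_obnd_cbnd; first by rewrite integral_expRN_cy oppr0 expR0.
apply/measurable_EFinP; apply: measurable_funTS; exact: measurable_expRN.
Qed.

(* Tonelli on {v <= u}, writing u^x as the integral of x v^(x-1) over ]0, u]. *)
Lemma Gamma_intS (x : R) : 0 < x -> Gamma_int (x + 1) = (x%:E * Gamma_int x)%E.
Proof.
move=> x0; rewrite /Gamma_int addrK.
pose f (u v : R) := (x * v `^ (x - 1) * expR (- u) * (v <= u)%R%:R)%:E.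
transitivity (\int[mu]_(u in `]0%R, +oo[) \int[mu]_(v in `]0%R, +oo[) f u v)%E.
  apply: eq_integral => u; rewrite inE /= in_itv /= andbT => u0.
  rewrite EFinM -integral_powR_oc// muleC -ge0_integralZl//; last 2 first.
  - apply/measurable_EFinP; apply: measurable_funTS.
    by apply: measurable_funM => //; exact: measurable_powRl.
  - by move=> v _; rewrite lee_fin mulr_ge0 ?powR_ge0// ltW.
  rewrite [LHS]integral_mkcond [RHS]integral_mkcond; apply: eq_integral => v _.
  rewrite !patchE /f; case: ifPn; rewrite ?inE ?notin_setE /= in_itv /=.
    move=> /andP[v0 vu]; rewrite ifT ?inE /= ?in_itv /= ?v0//.
    by rewrite -EFinM vu mulr1 (mulrC (expR _)).
  move=> /negP h; case: ifPn => //; rewrite inE /= in_itv /= andbT => v0.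
  by move: h; rewrite v0 /= => /negbTE ->; rewrite mulr0.
have mf : measurable_fun setT (fun p : R * R => f p.1 p.2).
  apply/measurable_EFinP; apply: measurable_funM; last first.
    apply: measurable_boolR; exact: measurable_fun_ler.
  apply: measurable_funM; last first.
    exact: (measurableT_comp measurable_expRN).
  apply: measurable_funM => //.
  exact: (measurableT_comp (measurable_powRl _)).
rewrite tonelli_in//; last first.
  move=> u v _ _; rewrite lee_fin !mulr_ge0 ?powR_ge0 ?expR_ge0//; exact: ltW.
rewrite -ge0_integralZl//; last 3 first.
- apply/measurable_EFinP; apply: measurable_funTS.
  apply: measurable_funM; [exact: measurable_powRl|exact: measurable_expRN].
- by move=> v _; rewrite lee_fin mulr_ge0 ?powR_ge0 ?expR_ge0.
- by rewrite lee_fin ltW.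
apply: eq_integral => v; rewrite inE /= in_itv /= andbT => v0.
rewrite -EFinM mulrA EFinM -integral_expRN_cy -ge0_integralZl//; last 2 first.
- apply/measurable_EFinP; apply: measurable_funTS; exact: measurable_expRN.
- by rewrite lee_fin mulr_ge0 ?powR_ge0// ltW.
rewrite [LHS]integral_mkcond [RHS]integral_mkcond; apply: eq_integral => u _.
rewrite !patchE /f; case: ifPn; rewrite ?inE ?notin_setE /= in_itv /= andbT.
  move=> u0; case: ifPn; rewrite ?inE ?notin_setE /= in_itv /= andbT => vu.
    by rewrite vu mulr1.
  by move/negP/negbTE : vu => ->; rewrite mulr0.
move=> /negP u0; case: ifPn; rewrite ?inE ?notin_setE /= ?in_itv /= ?andbT => // vu.
by move: u0; rewrite (lt_le_trans v0 vu).
Qed.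

(** For y in [[1, 2]] the bound u^(y-1) <= 1 + u gives the majorant Gamma(1) + Gamma(2). The
    recurrence carries finiteness to larger arguments, and back from [x + 1] to [x] because the
    factor [x] is positive. *)
Lemma Gamma_int_lty (x : R) : 0 < x -> (Gamma_int x < +oo)%E.
Proof.
have H1 y : 1 <= y <= 2 -> (Gamma_int y < +oo)%E.
  move=> /andP[y1 y2].
  apply: (@le_lt_trans _ _ (Gamma_int 1 + Gamma_int 2)%E); last first.
    rewrite (_ : 2 = 1 + 1 :> R)// Gamma_intS// Gamma_int1 mule1.
    by rewrite -EFinD ltry.
  rewrite /Gamma_int -ge0_integralD//; last 4 first.
  - by move=> u _; rewrite lee_fin mulr_ge0 ?powR_ge0 ?expR_ge0.
  - apply/measurable_EFinP; apply: measurable_funTS.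
    apply: measurable_funM; [exact: measurable_powRl|exact: measurable_expRN].
  - by move=> u _; rewrite lee_fin mulr_ge0 ?powR_ge0 ?expR_ge0.
  - apply/measurable_EFinP; apply: measurable_funTS.
    apply: measurable_funM; [exact: measurable_powRl|exact: measurable_expRN].
  apply: ge0_le_integral => //.
  - by move=> u _; rewrite lee_fin mulr_ge0 ?powR_ge0 ?expR_ge0.
  - apply/measurable_EFinP; apply: measurable_funTS.
    apply: measurable_funM; [exact: measurable_powRl|exact: measurable_expRN].
  - apply/measurable_EFinP; apply: measurable_funTS.
    apply: measurable_funD;
    (apply: measurable_funM; [exact: measurable_powRl|exact: measurable_expRN]).
  move=> u; rewrite /= in_itv /= andbT => u0.
  rewrite lee_fin -mulrDl ler_wpM2r ?expR_ge0// subrr powRr0.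
  have -> : (2 - 1 : R) = 1 by lra.
  rewrite (powRr1 (ltW u0)).
  have [u1|u1] := leP 1 u.
    apply: (@le_trans _ _ (u `^ 1)); last by rewrite (powRr1 (ltW u0)) lerDr.
    by apply: ler_powR => //; lra.
  apply: (@le_trans _ _ (u `^ 0)); last by rewrite powRr0 lerDl ltW.
  by apply: ger_powR; [rewrite u0 (ltW u1)|lra].
have H2 n y : 1 <= y <= n.+2%:R -> (Gamma_int y < +oo)%E.
  elim: n y => [|n IH] y; first exact: H1.
  move=> /andP[y1 yn].
  have [y2|y2] := leP y 2; first by apply: H1; rewrite y1.
  have -> : y = (y - 1) + 1 by lra.
  have /IH h : 1 <= y - 1 <= n.+2%:R.
    by apply/andP; split; [lra|rewrite lerBlDr natr1].
  rewrite Gamma_intS; last by lra.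
  by rewrite lte_mul_pinfty// ?lee_fin; lra.
move=> x0.
have hx : (Gamma_int (x + 1) < +oo)%E.
  have := archi_boundP (ltW x0); set n := Num.bound x => hn.
  apply: (H2 n); apply/andP; split; first lra.
  by rewrite -addn1 -addn1 !natrD; lra.
move: hx; rewrite Gamma_intS//; have := Gamma_int_ge0 x.
case: (Gamma_int x) => [r| |] //; first by move=> _ _; rewrite ltry.
by rewrite gt0_muley// lte_fin.
Qed.

Lemma Gamma_intE (x : R) : 0 < x -> Gamma_int x = (Gammaf x)%:E.
Proof.
move=> x0; rewrite /Gammaf /Rintegral -/(Gamma_int x) fineK//.
by rewrite ge0_fin_numE ?Gamma_int_ge0// Gamma_int_lty.
Qed.

Lemma Gammaf1 : Gammaf 1 = 1 :> R.
Proof. by apply: EFin_inj; rewrite -Gamma_intE// Gamma_int1. Qed.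

Lemma GammafS (x : R) : 0 < x -> Gammaf (x + 1) = x * Gammaf x :> R.
Proof.
move=> x0; apply: EFin_inj; rewrite EFinM -!Gamma_intE ?Gamma_intS//.
by rewrite addr_gt0.
Qed.

Lemma Gammaf_nat n : Gammaf n.+1%:R = n`!%:R :> R.
Proof.
elim: n => [|n IH]; first by rewrite Gammaf1 fact0.
by rewrite -natr1 GammafS ?ltr0Sn// IH -natrM factS.
Qed.

Lemma measurable_Gamma_integrand (x t : R) :
  measurable_fun setT (fun u : R => u `^ (x - 1) * expR (- (t * u))).
Proof.
apply: measurable_funM; first exact: measurable_powRl.
apply: measurableT_comp => //; apply: measurable_funN; exact: mulrl_measurable.
Qed.

Lemma Gammaf_gt0 (x : R) : 0 < x -> 0 < Gammaf x.
Proof.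
move=> x0; rewrite -lte_fin -Gamma_intE//.
(* On [[1, 2]] the integrand is at least e^-2 / 2, since u^(x-1) >= u^-1 >= 1/2 there. *)
have c0 : 0 < expR (- 2) / 2 :> R by rewrite divr_gt0 ?expR_gt0.
apply: (@lt_le_trans _ _ (\int[mu]_(u in `[1%R, 2%R]) (expR (- 2) / 2)%:E)%E).
  rewrite integral_cst//= lebesgue_measure_itv /= lte_fin ltr1n -EFinD -EFinM lte_fin.
  by rewrite mulr_gt0//; lra.
apply: (@le_trans _ _ (\int[mu]_(u in `[1%R, 2%R]) (u `^ (x - 1) * expR (- u))%:E)%E).
  apply: le_integral_EFin => //.
  - apply: measurable_funM; [exact: measurable_powRl|exact: measurable_expRN].
  - move=> u; rewrite /= in_itv /= => /andP[u1 u2]; rewrite (ltW c0) mulrC.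
    apply: ler_pM; rewrite ?expR_ge0// ?ler_expR ?lerN2//.
    apply: (@le_trans _ _ (u `^ (- 1))).
      rewrite powR_inv1; last by lra.
      by rewrite lef_pV2 ?posrE//; lra.
    by apply: ler_powR => //; lra.
apply: ge0_subset_integral => //.
- apply/measurable_EFinP; apply: measurable_funTS.
  apply: measurable_funM; [exact: measurable_powRl|exact: measurable_expRN].
- by move=> u _; rewrite lee_fin mulr_ge0 ?powR_ge0 ?expR_ge0.
- by move=> u; rewrite /= !in_itv /= andbT => /andP[u1 _]; exact: lt_le_trans u1.
Qed.

Lemma Gamma_int_scale (x t : R) : 0 < x -> 0 < t ->
  (\int[mu]_(u in `]0%R, +oo[) (u `^ (x - 1) * expR (- (t * u)))%:E
   = (t `^ (- x) * Gammaf x)%:E)%E.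
Proof.
move=> x0 t0.
have := @ge0_integral_scale R t (fun u => (u `^ (x - 1) * expR (- u))%:E) t0.
rewrite -/(Gamma_int x) Gamma_intE// => H.
have {H} := H _ _.
have -> : (\int[mu]_(u in `]0%R, +oo[) ((t * u) `^ (x - 1) * expR (- (t * u)))%:E =
  (t `^ (x - 1))%:E * \int[mu]_(u in `]0%R, +oo[) (u `^ (x - 1) * expR (- (t * u)))%:E)%E.
  rewrite -integralZl_EFin//.
  - apply: eq_integral => u; rewrite inE /= in_itv /= andbT => u0.
    by rewrite powRM ?(ltW t0) ?(ltW u0)// mulrA.
  - exact: measurable_Gamma_integrand.
  - by move=> u _; rewrite mulr_ge0 ?powR_ge0 ?expR_ge0.
  - exact: powR_ge0.
move=> H; have {H} := H _ _ => H.
have tx : t `^ (x - 1) != 0 by rewrite gt_eqF// powR_gt0.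
move: H; set I := integral _ _ _ => H.
rewrite -[LHS]mul1e -(mulVf tx) EFinM -muleA H; last 2 first.
- apply/measurable_EFinP.
  apply: measurable_funM; [exact: measurable_powRl|exact: measurable_expRN].
- by move=> u _; rewrite lee_fin mulr_ge0 ?powR_ge0 ?expR_ge0.
rewrite -!EFinM mulrA; congr (_ * _)%:E.
rewrite -powRN -powR_inv1 ?(ltW t0)// -powRD_gt0//.
by congr powR; ring.
Qed.

(** Writing (r + t)^-(p+q) as a Gamma integral over [s] and exchanging the integrals leaves a Gamma
    integral in [t], then one in [s]. *)
Lemma beta_prime_integral (r p q : R) : 0 < r -> 0 < p -> 0 < q ->
  (\int[mu]_(t in `]0%R, +oo[) (t `^ (p - 1) * (r + t) `^ (- (p + q)))%:E
   = (r `^ (- q) * (Gammaf p * Gammaf q / Gammaf (p + q)))%:E)%E.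
Proof.
move=> r0 p0 q0; have pq0 : 0 < p + q by rewrite addr_gt0.
have G0 := Gammaf_gt0 pq0.
pose f (t s : R) :=
  (t `^ (p - 1) / Gammaf (p + q) * (s `^ (p + q - 1) * expR (- ((r + t) * s))))%:E.
transitivity (\int[mu]_(t in `]0%R, +oo[) \int[mu]_(s in `]0%R, +oo[) f t s)%E.
  apply: eq_integral => t; rewrite inE /= in_itv /= andbT => t0.
  have t1 : 0 < r + t by rewrite addr_gt0.
  rewrite integralZl_EFin//.
  - rewrite Gamma_int_scale// -EFinM; congr EFin; field; exact: lt0r_neq0.
  - exact: measurable_Gamma_integrand.
  - by move=> u _; rewrite mulr_ge0 ?powR_ge0 ?expR_ge0.
  - by rewrite divr_ge0 ?powR_ge0// ltW.
rewrite tonelli_in//; last 2 first.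
- apply/measurable_EFinP; apply: measurable_funM.
    by apply: measurable_funM => //; exact: (measurableT_comp (measurable_powRl _)).
  apply: measurable_funM; first exact: (measurableT_comp (measurable_powRl _)).
  apply: measurableT_comp => //; apply: measurable_funN; apply: measurable_funM => //.
  exact: measurable_funD.
- by move=> t s _ _; rewrite lee_fin !mulr_ge0 ?powR_ge0 ?expR_ge0// invr_ge0 ltW.
transitivity (\int[mu]_(s in `]0%R, +oo[)
   (Gammaf p / Gammaf (p + q) * (s `^ (q - 1) * expR (- (r * s))))%:E)%E; last first.
  rewrite integralZl_EFin//.
  - rewrite Gamma_int_scale// -EFinM; congr EFin.
    move: (Gammaf p) (Gammaf q) (Gammaf (p + q)) G0 => Gp Gq Gpq G0.
    field; exact: lt0r_neq0.
  - exact: measurable_Gamma_integrand.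
  - by move=> u _; rewrite mulr_ge0 ?powR_ge0 ?expR_ge0.
  - by apply: divr_ge0; apply: ltW; exact: Gammaf_gt0.
apply: eq_integral => s; rewrite inE /= in_itv /= andbT => s0.
transitivity (\int[mu]_(t in `]0%R, +oo[)
   ((s `^ (p + q - 1) * expR (- (r * s)) / Gammaf (p + q)) * (t `^ (p - 1) * expR (- (s * t))))%:E)%E.
  apply: eq_integral => t _; congr EFin.
  have -> : expR (- ((r + t) * s)) = expR (- (r * s)) * expR (- (s * t)).
    by rewrite -expRD; congr expR; ring.
  ring.
rewrite integralZl_EFin//.
- rewrite Gamma_int_scale// -EFinM; congr EFin.
  have -> : s `^ (p + q - 1) = s `^ p * s `^ (q - 1).
    by rewrite -powRD_gt0//; congr powR; ring.
  move: (Gammaf p) (Gammaf (p + q)) G0 => Gp Gpq G0.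
  by rewrite powRN; field; rewrite !gt_eqF// powR_gt0.
- exact: measurable_Gamma_integrand.
- by move=> u _; rewrite mulr_ge0 ?powR_ge0 ?expR_ge0.
- by rewrite divr_ge0 ?mulr_ge0 ?powR_ge0 ?expR_ge0// ltW.
Qed.

Let divfG (X Y Z G : R) : G != 0 -> X / G * Y * (Z * G) = X * (Y * Z).
Proof. by move=> G0; field. Qed.

(** The coupling factor (a + b)^-p is replaced by a Gamma integral over [t] of e^(-(a+b)t), after
    which [a] and [b] separate into Gamma integrals of rate [r + t]. A beta integral in [t] remains;
    [p < A + B] makes it converge. *)
Lemma Gamma_pair_integral (r A B p : R) : 0 < r -> 0 < A -> 0 < B -> 0 < p -> p < A + B ->
  (\int[mu]_(a in `]0%R, +oo[) \int[mu]_(b in `]0%R, +oo[)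
     ((a `^ (A - 1) * expR (- (r * a))) * ((b `^ (B - 1) * expR (- (r * b)))
      * (a + b) `^ (- p)))%:E
   = (r `^ (- (A + B - p)) * (Gammaf A * Gammaf B * Gammaf (A + B - p) / Gammaf (A + B)))%:E)%E.
Proof.
move=> r0 A0 B0 p0 pAB.
have Gp := Gammaf_gt0 p0.
have GA := Gammaf_gt0 A0.
have GB := Gammaf_gt0 B0.
pose F (a t : R) := (Gammaf B / Gammaf p * (t `^ (p - 1) * (r + t) `^ (- B)) *
   (a `^ (A - 1) * expR (- ((r + t) * a))))%:E.
transitivity (\int[mu]_(a in `]0%R, +oo[) \int[mu]_(t in `]0%R, +oo[) F a t)%E.
  apply: eq_integral => a; rewrite inE /= in_itv /= andbT => a0.
  pose c := a `^ (A - 1) * expR (- (r * a)) / Gammaf p.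
  pose f (b t : R) := (c * (b `^ (B - 1) * expR (- (r * b))) *
     (t `^ (p - 1) * expR (- ((a + b) * t))))%:E.
  have c0 : 0 <= c.
    by apply: divr_ge0; [apply: mulr_ge0; [exact: powR_ge0|exact: expR_ge0]|exact: (ltW Gp)].
  transitivity (\int[mu]_(b in `]0%R, +oo[) \int[mu]_(t in `]0%R, +oo[) f b t)%E.
    apply: eq_integral => b; rewrite inE /= in_itv /= andbT => b0.
    rewrite integralZl_EFin//.
    - rewrite Gamma_int_scale ?addr_gt0// -EFinM; congr EFin.
      exact: (esym (divfG _ _ _ (lt0r_neq0 Gp))).
    - exact: measurable_Gamma_integrand.
    - by move=> u _; rewrite mulr_ge0 ?powR_ge0 ?expR_ge0.
    - by rewrite mulr_ge0// mulr_ge0 ?powR_ge0 ?expR_ge0.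
  rewrite tonelli_in//; last 2 first.
  - apply/measurable_EFinP; apply: measurable_funM.
      apply: measurable_funM => //.
      exact: (measurableT_comp (measurable_Gamma_integrand _ _)).
    apply: measurable_funM; first exact: (measurableT_comp (measurable_powRl _)).
    apply: measurableT_comp => //; apply: measurable_funN; apply: measurable_funM => //.
    exact: measurable_funD.
  - move=> t s _ _; rewrite lee_fin.
    by do ![exact: c0|exact: powR_ge0|exact: expR_ge0|apply: mulr_ge0].
  apply: eq_integral => t; rewrite inE /= in_itv /= andbT => t0.
  transitivity (\int[mu]_(b in `]0%R, +oo[)
    (c * (t `^ (p - 1) * expR (- (a * t))) * (b `^ (B - 1) * expR (- ((r + t) * b))))%:E)%E.
    apply: eq_integral => b _; congr EFin.
    have -> : expR (- ((a + b) * t)) = expR (- (a * t)) * expR (- (b * t)).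
      by rewrite -expRD; congr expR; ring.
    have -> : expR (- ((r + t) * b)) = expR (- (r * b)) * expR (- (b * t)).
      by rewrite -expRD; congr expR; ring.
    ring.
  rewrite integralZl_EFin//.
  - rewrite Gamma_int_scale ?addr_gt0// -EFinM; congr EFin.
    have -> : expR (- ((r + t) * a)) = expR (- (r * a)) * expR (- (a * t)).
      by rewrite -expRD; congr expR; ring.
    rewrite /c; move: (Gammaf p) (Gammaf B) => *; ring.
  - exact: measurable_Gamma_integrand.
  - by move=> u _; rewrite mulr_ge0 ?powR_ge0 ?expR_ge0.
  - by rewrite mulr_ge0// mulr_ge0 ?powR_ge0 ?expR_ge0.
have BG0 : 0 <= Gammaf B / Gammaf p := divr_ge0 (ltW GB) (ltW Gp).
rewrite tonelli_in//; last 2 first.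
- apply/measurable_EFinP; apply: measurable_funM.
    apply: measurable_funM => //; apply: measurable_funM.
      exact: (measurableT_comp (measurable_powRl _)).
    apply: (measurableT_comp (measurable_powRl _)); exact: measurable_funD.
  apply: measurable_funM; first exact: (measurableT_comp (measurable_powRl _)).
  apply: measurableT_comp => //; apply: measurable_funN; apply: measurable_funM => //.
  exact: measurable_funD.
- move=> t s _ _; rewrite lee_fin.
  by do ![exact: BG0|exact: powR_ge0|exact: expR_ge0|apply: mulr_ge0].
transitivity (\int[mu]_(t in `]0%R, +oo[) ((Gammaf A * Gammaf B / Gammaf p) *
  (t `^ (p - 1) * (r + t) `^ (- (p + (A + B - p)))))%:E)%E.
  apply: eq_integral => t; rewrite inE /= in_itv /= andbT => t0.
  have rt : 0 < r + t by rewrite addr_gt0.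
  rewrite integralZl_EFin//.
  - rewrite Gamma_int_scale// -EFinM; congr EFin.
    have -> : - (p + (A + B - p)) = (- A) + (- B) by ring.
    rewrite (powRD_gt0 (- A) (- B) rt); move: (Gammaf p) (Gammaf A) (Gammaf B) => *; ring.
  - exact: measurable_Gamma_integrand.
  - by move=> u _; rewrite mulr_ge0 ?powR_ge0 ?expR_ge0.
  - by rewrite mulr_ge0// mulr_ge0 ?powR_ge0 ?expR_ge0.
rewrite integralZl_EFin//.
- rewrite beta_prime_integral ?subr_gt0// -EFinM; congr EFin.
  have -> : p + (A + B - p) = A + B by ring.
  have := Gammaf_gt0 (addr_gt0 A0 B0).
  move: (Gammaf p) (Gammaf A) (Gammaf B) (Gammaf (A + B)) Gp => *.
  by field; rewrite !lt0r_neq0.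
- apply: measurable_funM; first exact: measurable_powRl.
  by apply: (measurableT_comp (measurable_powRl _)); exact: measurable_funD.
- by move=> u _; rewrite mulr_ge0 ?powR_ge0.
- exact: (divr_ge0 (mulr_ge0 (ltW GA) (ltW GB)) (ltW Gp)).
Qed.
End Gamma.

(** * Binomial series *)

Section realvalued_integrable.
Context {R : realType} {d : measure_display} {T : measurableType d}
  (mu : {measure set T -> \bar R}) (D : set T).
Hypothesis mD : measurable D.

Lemma dominated_integrable_EFin (f g : T -> R) :
  measurable_fun setT f -> measurable_fun setT g ->
  (forall x, D x -> `|f x| <= g x) -> (\int[mu]_(x in D) (g x)%:E < +oo)%E ->
  mu.-integrable D (EFin \o f).
Proof.
move=> mf mg fg goo; apply/integrableP; split.
  by apply/measurable_EFinP; exact: measurable_funTS.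
apply: le_lt_trans goo; apply: le_integral_EFin => //.
  exact: measurableT_comp.
by move=> x /fg; rewrite normr_ge0.
Qed.

Lemma dominated_convergence_EFin (f_ : nat -> T -> R) (f g : T -> R) :
  (forall n, measurable_fun setT (f_ n)) -> measurable_fun setT f ->
  measurable_fun setT g ->
  (forall x, D x -> f_ n x @[n --> \oo] --> f x) ->
  (forall n x, D x -> `|f_ n x| <= g x) -> (\int[mu]_(x in D) (g x)%:E < +oo)%E ->
  (\int[mu]_(x in D) (f_ n x)%:E)%E @[n --> \oo] --> (\int[mu]_(x in D) (f x)%:E)%E.
Proof.
move=> mf_ mf mg f_f f_g goo.
have mE h : measurable_fun setT h -> measurable_fun D (fun x => (h x : R)%:E).
  by move=> mh; apply/measurable_EFinP; exact: measurable_funTS.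
have cv : {ae mu, forall x, D x -> (f_ n x)%:E @[n --> \oo] --> (f x)%:E}.
  by apply: aeW => x Dx; apply: cvg_EFin; [exact: nearW|exact: f_f].
have ig : mu.-integrable D (fun x => (g x)%:E).
  apply: (@dominated_integrable_EFin g g) => // x Dx; rewrite ger0_norm//.
  exact: le_trans (f_g 0 x Dx).
have bd : {ae mu, forall x n, D x -> (`|(f_ n x)%:E| <= (g x)%:E)%E}.
  by apply: aeW => x n Dx; rewrite /= lee_fin f_g.
by have [_ _] := dominated_convergence mD (fun n => mE _ (mf_ n)) (mE _ mf) cv ig bd.
Qed.

(** The coefficients [c n] are signed, so linearity goes through integrability, which is read off
    from the finite values [K n]. *)
Lemma integral_lincomb (h : nat -> T -> R) (K c : nat -> R) (N : nat) :
  (forall n, measurable_fun setT (h n)) -> (forall n x, D x -> 0 <= h n x) ->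
  (forall n, \int[mu]_(x in D) (h n x)%:E = (K n)%:E)%E ->
  (\int[mu]_(x in D) (\sum_(n < N) c n * h n x)%:E)%E = (\sum_(n < N) c n * K n)%:E.
Proof.
move=> mh h0 hK.
have ih n : mu.-integrable D (EFin \o h n).
  apply: (@dominated_integrable_EFin _ (h n)) => //; last by rewrite hK ltry.
  by move=> x Dx; rewrite ger0_norm// h0.
under eq_integral do rewrite -sumEFin.
rewrite integral_sum//=.
  rewrite -sumEFin; apply: eq_bigr => n _.
  under eq_integral do rewrite EFinM.
  by rewrite integralZl ?hK// ih.
move=> n; under eq_fun do rewrite EFinM.
exact: (integrableZl mD _ (ih n)).
Qed.
End realvalued_integrable.

Section binomial_series.
Context {R : realType}.
Local Notation mu := (@lebesgue_measure R).

Lemma norm_expR_partial_le (x : R) N : `|\sum_(n < N) x ^+ n / n`!%:R| <= expR `|x|.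
Proof.
apply: (le_trans (ler_norm_sum _ _ _)).
have -> : \sum_(n < N) `|x ^+ n / n`!%:R| = series (exp_coeff `|x|) N.
  rewrite /series /= big_mkord; apply: eq_bigr => n _.
  by rewrite /exp_coeff normrM normrX normfV normr_nat.
apply: nondecreasing_cvgn_le; last exact: is_cvg_series_exp_coeff.
by apply: nondecreasing_series => n _ _; exact: exp_coeff_ge0.
Qed.

Lemma cvg_expR_partial (x : R) : \sum_(n < N) x ^+ n / n`!%:R @[N --> \oo] --> expR x.
Proof.
have := @is_cvg_series_exp_coeff R x.
rewrite (_ : series _ = fun N => \sum_(n < N) x ^+ n / n`!%:R); last first.
  by apply/funext => N; rewrite /series /= big_mkord.
by move=> c; rewrite /expR; move: c; rewrite (_ : series _ = fun N => \sum_(n < N) x ^+ n / n`!%:R)//;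
  apply/funext => N; rewrite /series /= big_mkord.
Qed.

Lemma pochhammerS (p : R) n : pochhammer p n.+1 = pochhammer p n * (p + n%:R).
Proof. by rewrite /pochhammer big_ord_recr. Qed.

Lemma pochhammer_shift (p : R) n : pochhammer p n.+1 = p * pochhammer (p + 1) n.
Proof.
rewrite /pochhammer big_ord_recl /= addr0; congr (_ * _).
by apply: eq_bigr => i _; rewrite /bump /= natrD addrA.
Qed.

Lemma pochhammer_gt0 (p : R) n : 0 < p -> 0 < pochhammer p n.
Proof. by move=> p0; apply: prodr_gt0 => i _; rewrite ltr_wpDr. Qed.

Lemma Gammaf_pochhammer (p : R) n : 0 < p ->
  Gammaf (p + n%:R) = pochhammer p n * Gammaf p.
Proof.
move=> p0; elim: n => [|n IH]; first by rewrite addr0 /pochhammer big_ord0 mul1r.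
have pn : 0 < p + n%:R by rewrite ltr_wpDr.
by rewrite -natr1 addrA (GammafS pn) IH pochhammerS [RHS]mulrAC [RHS]mulrC.
Qed.

(* Expand e^(w s) in the Gamma integral of (1 - w)^(-p). *)
Lemma negative_binomial_series (p w : R) : 0 < p -> `|w| < 1 ->
  \sum_(n < N) pochhammer p n / n`!%:R * w ^+ n @[N --> \oo] --> (1 - w) `^ (- p).
Proof.
move=> p0 w1.
have w2 : 0 < 1 - w by have := ler_norm w; lra.
have w3 : 0 < 1 - `|w| by rewrite subr_gt0.
have Gp := Gammaf_gt0 p0.
pose h n (s : R) := s `^ (p + n%:R - 1) * expR (- (1 * s)).
pose D : set R := `]0%R, +oo[%classic.
have hE N s : D s -> \sum_(n < N) (w ^+ n / n`!%:R) * h n s =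
    (\sum_(n < N) (w * s) ^+ n / n`!%:R) * (s `^ (p - 1) * expR (- s)).
  rewrite /D /= in_itv /= andbT => s0.
  rewrite mulr_suml; apply: eq_bigr => n _.
  rewrite /h mul1r (_ : p + n%:R - 1 = (p - 1) + n%:R); last by ring.
  rewrite powRD_gt0// powR_mulrn ?(ltW s0)// exprMn; ring.
have mh n : measurable_fun setT (h n) by exact: measurable_Gamma_integrand.
have h0 n s : D s -> 0 <= h n s by move=> _; rewrite mulr_ge0 ?powR_ge0 ?expR_ge0.
have hK n : (\int[mu]_(s in D) (h n s)%:E = (Gammaf (p + n%:R))%:E)%E.
  by rewrite Gamma_int_scale ?ltr_wpDr// powR1 mul1r.
have H : (\int[mu]_(s in D) (\sum_(n < N) (w ^+ n / n`!%:R) * h n s)%:E)%E @[N --> \oo]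
   --> (\int[mu]_(s in D) (expR (w * s) * (s `^ (p - 1) * expR (- s)))%:E)%E.
  (* Partial sums of e^(ws) are bounded by e^(|w|s), and [|w| < 1] leaves an exponential decay of
     rate 1 - |w|. *)
  apply: (@dominated_convergence_EFin _ _ _ mu D _ _ _
    (fun s => s `^ (p - 1) * expR (- ((1 - `|w|) * s)))).
  - exact: measurable_itv.
  - move=> N; apply: measurable_sum => n; by apply: measurable_funM => //; exact: mh.
  - apply: measurable_funM; first by apply: measurableT_comp => //; exact: mulrl_measurable.
    by apply: measurable_funM; [exact: measurable_powRl|exact: measurable_expRN].
  - exact: measurable_Gamma_integrand.
  - move=> s Ds; under eq_cvg do rewrite hE//.
    by apply: cvgM; [exact: cvg_expR_partial|exact: cvg_cst].
  - move=> N s Ds; rewrite hE//.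
    move: Ds; rewrite /D /= in_itv /= andbT => s0.
    rewrite normrM (ger0_norm (mulr_ge0 (powR_ge0 _ _) (expR_ge0 _))).
    rewrite mulrCA ler_wpM2l ?powR_ge0//.
    apply: (@le_trans _ _ (expR (`|w * s|) * expR (- s))).
      by rewrite ler_wpM2r ?expR_ge0// norm_expR_partial_le.
    rewrite -expRD ler_expR normrM (gtr0_norm s0); lra.
  - by rewrite Gamma_int_scale// ltry.
have E2 : (\int[mu]_(s in D) (expR (w * s) * (s `^ (p - 1) * expR (- s)))%:E)%E =
    ((1 - w) `^ (- p) * Gammaf p)%:E.
  rewrite -Gamma_int_scale//; apply: eq_integral => s _; congr EFin.
  rewrite mulrCA -expRD; congr (_ * expR _); ring.
rewrite E2 in H.
have {}H : \sum_(n < N) (w ^+ n / n`!%:R) * Gammaf (p + n%:R) @[N --> \oo] -->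
    (1 - w) `^ (- p) * Gammaf p.
  have /fine_cvg := H; apply: cvg_trans; apply: near_eq_cvg; apply: nearW => N /=.
  by rewrite (@integral_lincomb R _ _ mu D (measurable_itv _) h (fun n => Gammaf (p + n%:R))
    (fun n => w ^+ n / n`!%:R) N mh h0 hK).
have -> : (1 - w) `^ (- p) = (1 - w) `^ (- p) * Gammaf p * (Gammaf p)^-1.
  by rewrite mulfK// gt_eqF.
have : (\sum_(n < N) (w ^+ n / n`!%:R) * Gammaf (p + n%:R)) * (Gammaf p)^-1 @[N --> \oo]
    --> (1 - w) `^ (- p) * Gammaf p * (Gammaf p)^-1.
  by apply: cvgM => //; exact: cvg_cst.
apply: cvg_trans; apply: near_eq_cvg; apply: nearW => N /=.
rewrite mulr_suml; apply: eq_bigr => n _; rewrite Gammaf_pochhammer//.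
by move: (Gammaf p) Gp => G G0; field; rewrite pnatr_eq0 -lt0n fact_gt0 lt0r_neq0.
Qed.

(* (1 - w)^de = (1 - w) (1 - w)^(de - 1). *)
Lemma binomial_series (de w : R) : 0 < de < 1 -> `|w| < 1 ->
  \sum_(n < N) pochhammer (- de) n / n`!%:R * w ^+ n @[N --> \oo] --> (1 - w) `^ de.
Proof.
move=> /andP[d0 d1] w1.
have w2 : 0 < 1 - w by have := ler_norm w; lra.
have p0 : 0 < 1 - de by rewrite subr_gt0.
pose c n : R := pochhammer (1 - de) n / n`!%:R.
(* Multiplying the series of (1-w)^(de-1) by 1 - w turns its coefficients [c n] into their
   differences. *)
have cE n : pochhammer (- de) n.+1 / n.+1`!%:R = c n.+1 - c n.
  rewrite /c pochhammer_shift (_ : - de + 1 = 1 - de) 1?addrC// pochhammerS factS natrM.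
  by field; rewrite pnatr_eq0 -lt0n fact_gt0 nat1r pnatr_eq0.
have SE N : \sum_(n < N.+1) pochhammer (- de) n / n`!%:R * w ^+ n =
    \sum_(n < N.+1) c n * w ^+ n - w * \sum_(n < N) c n * w ^+ n.
  elim: N => [|N IH].
    by rewrite !big_ord1 big_ord0 mulr0 subr0 /c /pochhammer !big_ord0.
  rewrite big_ord_recr /= IH [in RHS]big_ord_recr /= cE [X in _ = _ - w * X]big_ord_recr /=.
  by rewrite exprS; ring.
have H := negative_binomial_series p0 w1.
suff HS : \sum_(n < N.+1) c n * w ^+ n - w * \sum_(n < N) c n * w ^+ n @[N --> \oo]
    --> (1 - w) `^ de.
  rewrite -(cvg_shiftS (fun N => \sum_(n < N) pochhammer (- de) n / n`!%:R * w ^+ n)).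
  by apply: cvg_trans HS; apply: near_eq_cvg; apply: nearW => N; rewrite -SE.
have -> : (1 - w) `^ de = (1 - w) `^ (- (1 - de)) - w * (1 - w) `^ (- (1 - de)).
  have {1}-> : de = 1 + - (1 - de) by ring.
  by rewrite powRD_gt0// (powRr1 (ltW w2)) mulrBl mul1r.
apply: cvgB; last by apply: cvgM; [exact: cvg_cst|exact: H].
by rewrite (cvg_shiftS (fun N => \sum_(n < N) c n * w ^+ n)).
Qed.

(** Each step multiplies by (n - de)/(n + 1), of modulus at most 1. The bound lets a geometric
    series dominate the binomial expansion of order [de]. *)
Lemma norm_binomial_coeff_le1 (de : R) n : 0 < de < 1 ->
  `|pochhammer (- de) n / n`!%:R| <= 1.
Proof.
move=> /andP[d0 d1]; elim: n => [|n IH].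
  by rewrite /pochhammer big_ord0 fact0 divr1 normr1.
rewrite pochhammerS factS natrM.
have -> : pochhammer (- de) n * (- de + n%:R) / (n.+1%:R * n`!%:R) =
  (pochhammer (- de) n / n`!%:R) * ((- de + n%:R) / n.+1%:R).
  by field; rewrite pnatr_eq0 -lt0n fact_gt0 nat1r pnatr_eq0.
rewrite normrM mulr_ile1// normrM normfV normr_nat ler_pdivrMr ?ltr0Sn// mul1r.
rewrite -natr1 ler_norml; have := ler0n R n; set x := n%:R => ?.
by apply/andP; split; lra.
Qed.
End binomial_series.

(** * Fractional moments of pairs of Gamma variables *)

Lemma tonelli_prod_in (R : realType) (d1 d2 : measure_display)
  (T1 : measurableType d1) (T2 : measurableType d2)
  (m1 : {sigma_finite_measure set T1 -> \bar R})
  (m2 : {sigma_finite_measure set T2 -> \bar R})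
  (D1 : set T1) (D2 : set T2) (f : T1 -> T2 -> \bar R) :
  measurable D1 -> measurable D2 ->
  measurable_fun setT (fun p : T1 * T2 => f p.1 p.2) ->
  (forall x y, D1 x -> D2 y -> (0 <= f x y)%E) ->
  (\int[m1 \x m2]_(p in D1 `*` D2) f p.1 p.2 =
   \int[m1]_(x in D1) \int[m2]_(y in D2) f x y)%E.
Proof.
move=> mD1 mD2 mf f0.
pose F := (fun p : T1 * T2 => f p.1 p.2) \_ (D1 `*` D2).
have mF : measurable_fun setT F.
  apply/(measurable_restrictT _ _).1; first exact: measurableX.
  exact: measurable_funTS.
have F0 p : (0 <= F p)%E.
  rewrite /F patchE; case: ifPn => //; rewrite inE => -[? ?]; exact: f0.
rewrite integral_mkcond (fubini_tonelli1 F mF F0).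
rewrite [RHS]integral_mkcond; apply: eq_integral => x _.
rewrite /fubini_F patchE; case: ifPn => xD.
  rewrite [RHS]integral_mkcond; apply: eq_integral => y _.
  by rewrite /F !patchE in_setX /= xD.
by apply: integral0_eq => y _; rewrite /F patchE in_setX /= (negbTE xD).
Qed.

Section Gamma_pair.
Context {R : realType}.
Local Notation mu := (@lebesgue_measure R).
Local Notation pos := (`]0%R, +oo[%classic : set R).
Variables (m de : R) (gam : probability (measurableTypeR R) R).
Hypotheses (m0 : 0 < m) (d01 : 0 < de < 1).
Hypothesis gamE : forall f : R -> \bar R, measurable_fun setT f ->
  (forall x, 0 < x -> (0 <= f x)%E) ->
  (\int[gam]_(x in pos) f x = \int[mu]_(x in pos) (f x * (gamma_pdf m x)%:E))%E.

Let D2 : set (R * R) := pos `*` pos.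
Let mD2 : measurable (D2 : set (measurableTypeR R * measurableTypeR R)).
Proof. by apply: measurableX; exact: measurable_itv. Qed.

Let D2P (p : R * R) : D2 p -> 0 < p.1 /\ 0 < p.2.
Proof. by rewrite /D2 /= !in_itv /= !andbT. Qed.

Lemma measurable_gamma_pdf : measurable_fun setT (gamma_pdf m).
Proof.
apply: measurable_funM => //; apply: measurable_funM.
  by apply: measurable_funM => //; exact: measurable_powRl.
apply: measurableT_comp => //; apply: measurable_funN; exact: mulrl_measurable.
Qed.

Lemma gamma_pdf_ge0 (x : R) : 0 <= gamma_pdf m x.
Proof.
apply: divr_ge0; last exact: (ltW (Gammaf_gt0 m0)).
by rewrite !mulr_ge0 ?powR_ge0 ?expR_ge0.
Qed.

(** The law [gam] is known only through [gamE], so the product is treated one coordinate at a time.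
    The integrand is cut to [D2] to make the inner integral nonnegative and measurable on the whole
    line. *)
Lemma Gamma_pair_density (f : R -> R -> R) :
  measurable_fun setT (fun p : R * R => f p.1 p.2) ->
  (forall a b, 0 < a -> 0 < b -> 0 <= f a b) ->
  (\int[gam \x gam]_(p in D2) (f p.1 p.2)%:E =
   \int[mu \x mu]_(p in D2) (f p.1 p.2 * (gamma_pdf m p.1 * gamma_pdf m p.2))%:E)%E.
Proof.
move=> mf f0.
have mfE : measurable_fun setT (fun p : R * R => (f p.1 p.2)%:E) by exact/measurable_EFinP.
have mpos : measurable pos by exact: measurable_itv.
have mfp : measurable_fun setT (fun p : R * R => (f p.1 p.2 * gamma_pdf m p.2)%:E).
  apply/measurable_EFinP; apply: measurable_funM => //.
  exact: (measurableT_comp measurable_gamma_pdf).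
rewrite (@tonelli_prod_in _ _ _ _ _ gam gam pos pos (fun a b => (f a b)%:E))//; last first.
  by move=> a b; rewrite /= !in_itv /= !andbT lee_fin; exact: f0.
rewrite (@tonelli_prod_in _ _ _ _ _ mu mu pos pos
  (fun a b => (f a b * (gamma_pdf m a * gamma_pdf m b))%:E))//; last 2 first.
- apply/measurable_EFinP; apply: measurable_funM => //; apply: measurable_funM;
  exact: (measurableT_comp measurable_gamma_pdf).
- move=> a b; rewrite /= !in_itv /= !andbT lee_fin => a0 b0.
  apply: mulr_ge0; [exact: f0|apply: mulr_ge0; exact: gamma_pdf_ge0].
pose G := (fun p : R * R => (f p.1 p.2 * gamma_pdf m p.2)%:E) \_ D2.
have mG : measurable_fun setT G.
  by apply/(measurable_restrictT _ _).1 => //; exact: measurable_funTS.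
have G0 p : (0 <= G p)%E.
  rewrite /G patchE; case: ifPn => //; rewrite inE => /D2P[a0 b0].
  by rewrite lee_fin; apply: mulr_ge0; [exact: f0|exact: gamma_pdf_ge0].
pose F a := (\int[mu]_b G (a, b))%E.
have FE a : 0 < a -> F a = (\int[mu]_(b in pos) (f a b * gamma_pdf m b)%:E)%E.
  move=> a0; rewrite [RHS]integral_mkcond; apply: eq_integral => b _.
  by rewrite /G !patchE in_setX /= [a \in _]mem_set//= in_itv /= a0.
transitivity (\int[gam]_(a in pos) F a)%E.
  apply: eq_integral => a; rewrite inE /= in_itv /= andbT => a0.
  rewrite FE// gamE//.
    by apply/measurable_EFinP; exact: (measurableT_comp mf (measurable_pair1 a)).
  by move=> b b0; rewrite lee_fin f0.
rewrite gamE; last 2 first.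
- exact: (measurable_fun_fubini_tonelli_F (m2 := mu) G mG G0).
- by move=> a _; exact: integral_ge0.
apply: eq_integral => a; rewrite inE /= in_itv /= andbT => a0.
rewrite FE// -ge0_integralZr//; last 3 first.
- apply: measurable_funTS; exact: (measurableT_comp mfp (measurable_pair1 a)).
- move=> b; rewrite /= in_itv /= andbT => b0.
  by rewrite lee_fin; apply: mulr_ge0; [exact: f0|exact: gamma_pdf_ge0].
- by rewrite lee_fin gamma_pdf_ge0.
apply: eq_integral => b _; rewrite -EFinM; congr EFin; ring.
Qed.

(** The powers combine with the densities into Gamma integrands of shapes [m + i] and [m + j] and
    common rate [m], the case of [Gamma_pair_integral]. *)
Lemma Gamma_pair_moment (i j p : R) : 0 <= i -> 0 <= j -> 0 < p -> p < 2 * m + i + j ->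
  (\int[gam \x gam]_(q in D2) (q.1 `^ i * q.2 `^ j * (q.1 + q.2) `^ (- p))%:E =
   (m `^ (p - i - j) * (Gammaf (m + i) / Gammaf m) * (Gammaf (m + j) / Gammaf m)
    * (Gammaf (2 * m + i + j - p) / Gammaf (2 * m + i + j)))%:E)%E.
Proof.
move=> i0 j0 p0 pij.
have mi : 0 < m + i by rewrite ltr_wpDr.
have mj : 0 < m + j by rewrite ltr_wpDr.
have Gm := Gammaf_gt0 m0.
have mpos : measurable pos by exact: measurable_itv.
have mg a b : measurable_fun setT (fun x : R => x `^ (a - 1) * expR (- (b * x))) :=
  measurable_Gamma_integrand a b.
pose H (a b : R) := (a `^ (m + i - 1) * expR (- (m * a))) *
  ((b `^ (m + j - 1) * expR (- (m * b))) * (a + b) `^ (- p)).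
have mH : measurable_fun setT (fun q : R * R => H q.1 q.2).
  apply: measurable_funM; first exact: (measurableT_comp (mg _ _)).
  apply: measurable_funM; first exact: (measurableT_comp (mg _ _)).
  by apply: (measurableT_comp (measurable_powRl _)); exact: measurable_funD.
have H0 a b : 0 <= H a b by rewrite !mulr_ge0 ?powR_ge0 ?expR_ge0.
rewrite (@Gamma_pair_density (fun a b => a `^ i * b `^ j * (a + b) `^ (- p))); last 2 first.
- apply: measurable_funM; last first.
    by apply: (measurableT_comp (measurable_powRl _)); exact: measurable_funD.
  by apply: measurable_funM; exact: (measurableT_comp (measurable_powRl _)).
- by move=> a b _ _; rewrite !mulr_ge0 ?powR_ge0.
transitivity (\int[mu \x mu]_(q in D2) ((m `^ m / Gammaf m) ^+ 2 * H q.1 q.2)%:E)%E.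
  apply: eq_integral => q; rewrite inE => /D2P[a0 b0]; congr EFin.
  rewrite /gamma_pdf /H.
  have -> : q.1 `^ (m + i - 1) = q.1 `^ i * q.1 `^ (m - 1).
    by rewrite -powRD_gt0//; congr powR; ring.
  have -> : q.2 `^ (m + j - 1) = q.2 `^ j * q.2 `^ (m - 1).
    by rewrite -powRD_gt0//; congr powR; ring.
  move: (Gammaf m) Gm => G G0; field; exact: lt0r_neq0.
rewrite integralZl_EFin//; last by rewrite sqr_ge0.
rewrite (@tonelli_prod_in _ _ _ _ _ mu mu pos pos (fun a b => (H a b)%:E))//; last 2 first.
- exact/measurable_EFinP.
- by move=> a b _ _; rewrite lee_fin.
rewrite Gamma_pair_integral//; last by apply: lt_le_trans pij _; lra.
rewrite -EFinM; congr EFin.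
have -> : m + i + (m + j) = 2 * m + i + j by ring.
have -> : - (2 * m + i + j - p) = (- m) + (- m) + (p - i - j) by ring.
rewrite !(powRD_gt0 _ _ m0) powRN.
have := powR_gt0 m m0; move: (m `^ m) => M M0.
have : 0 < 2 * m + i + j by lra.
move=> /Gammaf_gt0; move: (Gammaf (2 * m + i + j)) => G2 G20.
move: (Gammaf m) Gm => G G0.
move: (Gammaf _) (Gammaf _) (Gammaf _) (m `^ (p - i - j)) => *.
field; by rewrite !lt0r_neq0.
Qed.

(** The moment of order [de] of the sum of the two gains, a Gamma variable of shape 2m and rate m.
    The fraction q.2 / (q.1 + q.2) is Beta(m, m) and independent of the sum, which explains why
    [h n] has integral [K0] times (m)_n / (2m)_n. *)
Let K0 : R := m `^ (- de) * (Gammaf (2 * m + de) / Gammaf (2 * m)).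
Let h (n : nat) (q : R * R) : R := q.2 ^+ n * (q.1 + q.2) `^ (de - n%:R).

Let mh n : measurable_fun setT (h n).
Proof.
apply: measurable_funM; first exact: measurable_funX.
by apply: (measurableT_comp (measurable_powRl _)); exact: measurable_funD.
Qed.

Let h0 n q : D2 q -> 0 <= h n q.
Proof. by move=> /D2P[a0 b0]; rewrite mulr_ge0 ?powR_ge0// exprn_ge0// ltW. Qed.

Let m20 : 0 < 2 * m. Proof. by rewrite mulr_gt0. Qed.

(** For n >= 1 the exponent de - n of the sum is negative, as [Gamma_pair_moment] requires. *)
Let hK_gt0 n : (0 < n)%N -> (\int[gam \x gam]_(q in D2) (h n q)%:E =
  (K0 * (pochhammer m n / pochhammer (2 * m) n))%:E)%E.
Proof.
move=> n0; case/andP: d01 => d0 d1.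
have n1 : 1 <= n%:R :> R by rewrite ler1n.
transitivity (\int[gam \x gam]_(q in D2)
   (q.1 `^ 0 * q.2 `^ n%:R * (q.1 + q.2) `^ (- (n%:R - de)))%:E)%E.
  apply: eq_integral => q; rewrite inE => /D2P[a0 b0].
  by rewrite powRr0 mul1r powR_mulrn ?(ltW b0)// opprB.
rewrite Gamma_pair_moment//; last 2 first.
- by lra.
- by move: m0; lra.
congr EFin; rewrite !addr0 subr0.
have -> : n%:R - de - n%:R = - de by ring.
have -> : 2 * m + n%:R - (n%:R - de) = 2 * m + de by ring.
rewrite !Gammaf_pochhammer// /K0.
have := Gammaf_gt0 m0; have := Gammaf_gt0 m20.
have := pochhammer_gt0 n m20.
move: (Gammaf m) (Gammaf (2 * m)) (Gammaf (2 * m + de)) (pochhammer _ n) (pochhammer _ n).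
move=> G1 G2 G3 p1 p2 *; field; by rewrite !lt0r_neq0.
Qed.

(** For n = 0 the exponent is positive; splitting (a + b)^de as (a + b)(a + b)^(de-1) gives two
    moments with negative exponent. *)
Let hK n : (\int[gam \x gam]_(q in D2) (h n q)%:E =
  (K0 * (pochhammer m n / pochhammer (2 * m) n))%:E)%E.
Proof.
case: n => [|n]; last exact: hK_gt0.
case/andP: d01 => d0 d1.
transitivity (\int[gam \x gam]_(q in D2)
   (q.1 `^ 1 * q.2 `^ 0 * (q.1 + q.2) `^ (- (1 - de)) +
    q.1 `^ 0 * q.2 `^ 1 * (q.1 + q.2) `^ (- (1 - de)))%:E)%E.
  apply: eq_integral => q; rewrite inE => /D2P[a0 b0]; congr EFin.
  rewrite /h expr0 mul1r !powRr0 mul1r mulr1 !powRr1 ?(ltW a0) ?(ltW b0)// -mulrDl.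
  have ab : 0 < q.1 + q.2 by rewrite addr_gt0.
  by rewrite -[X in _ = X * _](powRr1 (ltW ab)) -powRD_gt0//; congr powR; ring.
have mp (i j : R) : measurable_fun setT
    (fun q : R * R => q.1 `^ i * q.2 `^ j * (q.1 + q.2) `^ (- (1 - de))).
  apply: measurable_funM.
    by apply: measurable_funM; exact: (measurableT_comp (measurable_powRl _)).
  by apply: (measurableT_comp (measurable_powRl _)); exact: measurable_funD.
rewrite ge0_integralD_EFin//;
  try exact: mp; try (by move=> q _; rewrite !mulr_ge0 ?powR_ge0).
rewrite !Gamma_pair_moment//; [|by move: m0; lra..].
rewrite -EFinD; congr EFin; rewrite !addr0 !subr0.
have -> : 1 - de - 1 = - de by ring.
have -> : 2 * m + 1 - (1 - de) = 2 * m + de by ring.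
rewrite (GammafS m0) (GammafS m20) /K0 /pochhammer !big_ord0.
have := Gammaf_gt0 m0; have := Gammaf_gt0 m20.
move: (Gammaf m) (Gammaf (2 * m)) (Gammaf (2 * m + de)) => G1 G2 G3 *.
by field; rewrite !lt0r_neq0.
Qed.

Lemma geometric_sum_le (q : R) N : 0 <= q < 1 -> \sum_(n < N) q ^+ n <= (1 - q)^-1.
Proof.
move=> /andP[q0 q1]; rewrite -[leRHS]mul1r ler_pdivlMr ?subr_gt0// mulrC.
have -> : (1 - q) * \sum_(n < N) q ^+ n = 1 - q ^+ N.
  by rewrite -opprB -[RHS]opprB subrX1 mulNr.
by rewrite gerBl exprn_ge0.
Qed.

(** The base is (a + b)(1 - y b/(a + b)); the binomial expansion of the second factor, integrated
    term by term, produces the hypergeometric coefficients. Dominated convergence also shows that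
    the series converges, so that [hyp2F1_series], a bare [limn], has its intended value. *)
Lemma Gamma_pair_hyp2F1_series (y : R) : `|y| < 1 ->
  (\int[gam \x gam]_(q in D2) ((q.1 + q.2 - y * q.2) `^ de)%:E =
   (K0 * hyp2F1_series (- de) m (2 * m) y)%:E)%E.
Proof.
move=> y1; have y3 : 0 < 1 - `|y| by rewrite subr_gt0.
pose c n := pochhammer (- de) n / n`!%:R * y ^+ n.
have hE N q : D2 q -> \sum_(n < N) c n * h n q = (q.1 + q.2) `^ de *
    \sum_(n < N) pochhammer (- de) n / n`!%:R * (y * (q.2 / (q.1 + q.2))) ^+ n.
  move=> /D2P[a0 b0]; have ab : 0 < q.1 + q.2 by rewrite addr_gt0.
  rewrite mulr_sumr; apply: eq_bigr => n _.
  rewrite /c /h powRD_gt0// powRN powR_mulrn ?(ltW ab)// !exprMn exprVn; ring.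
have w1 q : D2 q -> `|y * (q.2 / (q.1 + q.2))| <= `|y|.
  move=> /D2P[a0 b0]; have ab : 0 < q.1 + q.2 by rewrite addr_gt0.
  rewrite normrM ler_piMr// (ger0_norm (divr_ge0 (ltW b0) (ltW ab))) ler_pdivrMr// mul1r.
  by rewrite lerDr ltW.
have H : (\int[gam \x gam]_(q in D2) (\sum_(n < N) c n * h n q)%:E)%E @[N --> \oo]
   --> (\int[gam \x gam]_(q in D2) ((q.1 + q.2 - y * q.2) `^ de)%:E)%E.
  apply: (@dominated_convergence_EFin _ _ _ (gam \x gam)%E D2 mD2 _ _
    (fun q => (1 - `|y|)^-1 * h 0 q)).
  - by move=> N; apply: measurable_sum => n; apply: measurable_funM => //; exact: mh.
  - apply: (measurableT_comp (measurable_powRl _)); apply: measurable_funB.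
      exact: measurable_funD.
    exact: measurable_funM.
  - by apply: measurable_funM => //; exact: mh.
  - move=> q Dq; have [a0 b0] := D2P Dq.
    have ab : 0 < q.1 + q.2 by rewrite addr_gt0.
    have w2 : `|y * (q.2 / (q.1 + q.2))| < 1 := le_lt_trans (w1 _ Dq) y1.
    under eq_cvg do rewrite hE//.
    have -> : (q.1 + q.2 - y * q.2) `^ de =
        (q.1 + q.2) `^ de * (1 - y * (q.2 / (q.1 + q.2))) `^ de.
      rewrite -powRM ?(ltW ab)//; last first.
        by have := ler_norm (y * (q.2 / (q.1 + q.2))); lra.
      congr powR; field; exact: lt0r_neq0.
    by apply: cvgM; [exact: cvg_cst|exact: binomial_series].
  - move=> N q Dq; rewrite hE// normrM (ger0_norm (powR_ge0 _ _)).
    rewrite /h expr0 mul1r subr0 mulrC ler_wpM2r ?powR_ge0//.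
    apply: (@le_trans _ _ (\sum_(n < N) `|y| ^+ n)); last first.
      by apply: geometric_sum_le; rewrite normr_ge0.
    apply: (le_trans (ler_norm_sum _ _ _)); apply: ler_sum => n _.
    rewrite normrM normrX -[leRHS]mul1r ler_pM// ?norm_binomial_coeff_le1//.
    by rewrite lerXn2r ?nnegrE// w1.
  - rewrite integralZl_EFin//; first by rewrite hK -EFinM ltry.
    + exact: mh.
    + exact: h0.
    + by rewrite invr_ge0 ltW.
pose S N := \sum_(n < N) pochhammer (- de) n * pochhammer m n /
  (pochhammer (2 * m) n * n`!%:R) * y ^+ n.
have HS N : (\int[gam \x gam]_(q in D2) (\sum_(n < N) c n * h n q)%:E)%E = (K0 * S N)%:E.
  rewrite (@integral_lincomb R _ _ (gam \x gam)%E D2 mD2 h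
    (fun n => K0 * (pochhammer m n / pochhammer (2 * m) n)) c N mh h0 hK).
  congr EFin; rewrite mulr_sumr; apply: eq_bigr => n _; rewrite /c.
  have := pochhammer_gt0 n m20; move: (pochhammer (2 * m) n) => P P0.
  by field; rewrite pnatr_eq0 -lt0n fact_gt0 lt0r_neq0.
have K00 : K0 != 0.
  rewrite /K0 mulf_neq0// ?gt_eqF ?powR_gt0//; apply: divr_gt0; apply: Gammaf_gt0 => //.
  by case/andP: d01 => d0 _; rewrite addr_gt0.
(* Since [|y| < 1], the base is at most 2(a + b); finiteness permits passing from extended to real
   limits. *)
have Lfin : (\int[gam \x gam]_(q in D2) ((q.1 + q.2 - y * q.2) `^ de)%:E)%E \is a fin_num.
  rewrite ge0_fin_numE; last by apply: integral_ge0 => q _; rewrite lee_fin powR_ge0.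
  apply: (@le_lt_trans _ _ (\int[gam \x gam]_(q in D2) (2 `^ de * h 0 q)%:E)%E).
    apply: le_integral_EFin => //.
    - apply: (measurableT_comp (measurable_powRl _)); apply: measurable_funB.
        exact: measurable_funD.
      exact: measurable_funM.
    - by apply: measurable_funM => //; exact: mh.
    - move=> q /D2P[a0 b0]; rewrite powR_ge0 /= /h expr0 mul1r subr0.
      have := y1; rewrite ltr_norml => /andP[ya yb].
      rewrite -(powRM _ _ (addr_ge0 (ltW a0) (ltW b0)))//; case/andP: d01 => d0 d1.
      by apply: ge0_ler_powR; rewrite ?nnegrE; nra.
  rewrite integralZl_EFin//.
  - by rewrite hK -EFinM ltry.
  - exact: mh.
  - exact: h0.
move: H Lfin; set L := integral _ _ _ => H Lfin.
have Hf : K0 * S N @[N --> \oo] --> fine L.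
  have : (K0 * S N)%:E @[N --> \oo] --> (fine L)%:E.
    rewrite fineK//; apply: cvg_trans H; apply: near_eq_cvg; apply: nearW => N.
    by rewrite HS.
  exact: fine_cvg.
have {}Hf : S N @[N --> \oo] --> K0^-1 * fine L.
  have : K0^-1 * (K0 * S N) @[N --> \oo] --> K0^-1 * fine L.
    by apply: cvgM => //; exact: cvg_cst.
  by apply: cvg_trans; apply: near_eq_cvg; apply: nearW => N; rewrite mulKf.
by rewrite /hyp2F1_series (cvg_lim _ Hf)// mulrA mulfV// mul1r fineK.
Qed.

Let swapE (f : R -> R -> R) : measurable_fun setT (fun p : R * R => f p.1 p.2) ->
  (forall a b, 0 < a -> 0 < b -> 0 <= f a b) ->
  (\int[gam \x gam]_(p in D2) (f p.1 p.2)%:E = \int[gam \x gam]_(p in D2) (f p.2 p.1)%:E)%E.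
Proof.
move=> mf f0; have mpos : measurable pos by exact: measurable_itv.
have f0' a b : pos a -> pos b -> (0 <= (f a b)%:E)%E.
  by rewrite /= !in_itv /= !andbT lee_fin; exact: f0.
have mf1 : measurable_fun setT (fun p : R * R => (f p.1 p.2)%:E) by exact/measurable_EFinP.
have mf2 : measurable_fun setT (fun p : R * R => (f p.2 p.1)%:E).
  by apply/measurable_EFinP; exact: (measurableT_comp mf (@measurable_swap _ _ _ _)).
rewrite (@tonelli_prod_in _ _ _ _ _ gam gam pos pos (fun a b => (f a b)%:E))//.
rewrite (@tonelli_prod_in _ _ _ _ _ gam gam pos pos (fun a b => (f b a)%:E))//; last first.
  by move=> a b Da Db; exact: f0'.
exact: (@tonelli_in _ _ _ _ _ gam gam pos pos (fun a b => (f a b)%:E)).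
Qed.

Let mpow (u v : R) : measurable_fun setT (fun q : R * R => (u * q.1 + v * q.2) `^ de).
Proof.
by apply: (measurableT_comp (measurable_powRl _)); apply: measurable_funD; exact: measurable_funM.
Qed.

(** Rests on u a + v b = u (a + b - (1 - v/u) b). *)
Let factor (u v : R) : 0 < u -> 0 < v -> `|1 - v / u| < 1 ->
  (\int[gam \x gam]_(q in D2) ((u * q.1 + v * q.2) `^ de)%:E =
   (u `^ de * (K0 * hyp2F1_series (- de) m (2 * m) (1 - v / u)))%:E)%E.
Proof.
move=> u0 v0 y1; rewrite [RHS]EFinM -Gamma_pair_hyp2F1_series// -integralZl_EFin//.
- apply: eq_integral => q; rewrite inE => /D2P[a0 b0]; congr EFin.
  have := y1; rewrite ltr_norml => /andP[ya yb].
  rewrite -powRM ?(ltW u0)//; last by nra.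
  congr powR; field; exact: lt0r_neq0.
- apply: (measurableT_comp (measurable_powRl _)); apply: measurable_funB.
    exact: measurable_funD.
  exact: measurable_funM.
- by move=> q _; exact: powR_ge0.
- exact: powR_ge0.
Qed.

(** If 1 - v/u > -1, the weight [u] is factored out and the series applies. Otherwise v/u >= 2; the
    gains, having the same law, are exchanged and [v] is factored out, so that the series is taken
    at 1 - u/v, in [[1/2, 1[]. This is Pfaff's formula, whose second parameter 2m - m is again m. *)
Lemma Gamma_pair_powR_moment (u v : R) : 0 < u -> 0 < v ->
  (\int[gam \x gam]_(q in D2) ((u * q.1 + v * q.2) `^ de)%:E =
   (u `^ de * m `^ (- de) * Gammaf (2 * m + de)
     * hyp2F1reg (- de) m (2 * m) (1 - v / u))%:E)%E.
Proof.
move=> u0 v0; have vu : 0 < v / u by rewrite divr_gt0.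
rewrite /hyp2F1reg /hyp2F1; case: ifPn => [x1|].
  rewrite factor//; last by rewrite ltr_norml x1 /=; lra.
  congr EFin; rewrite /K0.
  move: (Gammaf (2 * m)) (Gammaf _) (hyp2F1_series _ _ _ _) => *; ring.
rewrite -leNgt => x1.
have uv : u / v <= 2^-1.
  by rewrite -[u / v]invf_div lef_pV2 ?posrE//; lra.
have uv0 : 0 < u / v by rewrite divr_gt0.
rewrite (@swapE (fun a b => (u * a + v * b) `^ de) (mpow u v)); last first.
  by move=> *; exact: powR_ge0.
transitivity (\int[gam \x gam]_(q in D2) ((v * q.1 + u * q.2) `^ de)%:E)%E.
  by apply: eq_integral => q _; rewrite addrC.
rewrite factor//; last by rewrite ltr_norml; lra.
have -> : (1 - v / u) / (1 - v / u - 1) = 1 - u / v.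
  have E : u - v + -1 * u = - v by ring.
  by field; rewrite ?E ?oppr_eq0 !lt0r_neq0.
have -> : 1 - (1 - v / u) = v / u by ring.
have -> : 2 * m - m = m by ring.
rewrite opprK [(v / u) `^ de]powRM ?invr_ge0 ?(ltW u0) ?(ltW v0)//.
rewrite -[u^-1](powR_inv1 (ltW u0)) -powRrM mulN1r [u `^ (- de)]powRN.
congr EFin; rewrite /K0; have := powR_gt0 de u0; move: (u `^ de) => U U0.
have := Gammaf_gt0 m20.
move: (Gammaf (2 * m)) (Gammaf _) (hyp2F1_series _ _ _ _) => *.
by field; rewrite !lt0r_neq0.
Qed.

(** The case f = 1 of [gamE]; it follows that the gains are almost surely positive. *)
Lemma Gamma_pair_total : gam pos = 1%E.
Proof.
have -> : gam pos = (\int[gam]_(x in pos) 1)%E by rewrite integral_cst// mul1e.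
rewrite gamE//.
transitivity (\int[mu]_(x in pos)
    ((m `^ m / Gammaf m) * (x `^ (m - 1) * expR (- (m * x))))%:E)%E.
  apply: eq_integral => x _; rewrite mul1e /gamma_pdf; congr EFin.
  move: (Gammaf m) => *; ring.
rewrite integralZl_EFin//; last 3 first.
- exact: measurable_Gamma_integrand.
- by move=> x _; rewrite mulr_ge0 ?powR_ge0 ?expR_ge0.
- by apply: divr_ge0; [exact: powR_ge0|exact: (ltW (Gammaf_gt0 m0))].
rewrite Gamma_int_scale// -EFinM powRN; congr EFin.
have := Gammaf_gt0 m0; have := powR_gt0 m m0.
move: (Gammaf m) (m `^ m) => *; by field; rewrite !lt0r_neq0.
Qed.

(** The degenerate weight occurs when (T - z)^+ vanishes. The term [0 * q.1] is kept so that one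
    statement on Laplace transforms serves both cases. *)
Lemma Gamma_powR_moment (v : R) : 0 < v ->
  (\int[gam \x gam]_(q in D2) ((0 * q.1 + v * q.2) `^ de)%:E =
   (v `^ de * m `^ (- de) * (Gammaf (m + de) / Gammaf m))%:E)%E.
Proof.
move=> v0; case/andP: d01 => d0 d1.
have mpos : measurable pos by exact: measurable_itv.
have mp : measurable_fun setT (fun b : R => (v * b) `^ de).
  by apply: (measurableT_comp (measurable_powRl _)); exact: measurable_funM.
rewrite (@tonelli_prod_in _ _ _ _ _ gam gam pos pos (fun a b => ((0 * a + v * b) `^ de)%:E))//; last 2 first.
- by apply/measurable_EFinP; exact: (mpow 0 v).
- by move=> a b _ _; rewrite lee_fin powR_ge0.
transitivity (\int[gam]_(b in pos) ((v * b) `^ de)%:E)%E.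
  under eq_integral do under eq_integral do rewrite mul0r add0r.
  move: (\int[gam]_(b in pos) ((v * b) `^ de)%:E)%E => C.
  by rewrite (integral_cst gam mpos C) [X in (_ * X)%E]Gamma_pair_total mule1.
rewrite gamE; last 2 first.
- exact/measurable_EFinP.
- by move=> b _; rewrite lee_fin powR_ge0.
transitivity (\int[mu]_(x in pos)
    ((v `^ de * (m `^ m / Gammaf m)) * (x `^ ((m + de) - 1) * expR (- (m * x))))%:E)%E.
  apply: eq_integral => x; rewrite inE /= in_itv /= andbT => x0.
  rewrite -EFinM /gamma_pdf powRM ?(ltW v0) ?(ltW x0)//; congr EFin.
  have -> : m + de - 1 = de + (m - 1) by ring.
  rewrite (powRD_gt0 de (m - 1) x0); move: (Gammaf m) => *; ring.
rewrite integralZl_EFin//; last 3 first.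
- exact: measurable_Gamma_integrand.
- by move=> x _; rewrite mulr_ge0 ?powR_ge0 ?expR_ge0.
- apply: mulr_ge0; first exact: powR_ge0.
  by apply: divr_ge0; [exact: powR_ge0|exact: (ltW (Gammaf_gt0 m0))].
rewrite Gamma_int_scale ?addr_gt0// -EFinM; congr EFin.
rewrite opprD (powRD_gt0 (- m) (- de) m0) [m `^ (- m)]powRN.
have := Gammaf_gt0 m0; have := powR_gt0 m m0.
move: (Gammaf m) (m `^ m) (Gammaf _) => *; by field; rewrite !lt0r_neq0.
Qed.

Lemma Gamma_powR_momentl (u : R) : 0 < u ->
  (\int[gam \x gam]_(q in D2) ((u * q.1 + 0 * q.2) `^ de)%:E =
   (u `^ de * m `^ (- de) * (Gammaf (m + de) / Gammaf m))%:E)%E.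
Proof.
move=> u0; rewrite -(Gamma_powR_moment u0).
rewrite (swapE (f := fun a b => (u * a + 0 * b) `^ de)); last 2 first.
- exact: (mpow u 0).
- by move=> a b _ _; exact: powR_ge0.
by apply: eq_integral => q _; rewrite addrC.
Qed.
End Gamma_pair.

(** * Planar integrals *)

Lemma integral_boolR (R : realType) (d : measure_display) (T : measurableType d)
  (m : {measure set T -> \bar R}) (b : T -> bool) : measurable [set x | b x] ->
  (\int[m]_x ((b x)%:R)%:E)%E = m [set x | b x].
Proof.
move=> mb; transitivity (\int[m]_x (\1_[set x | b x] x)%:E)%E.
  apply: eq_integral => x _; rewrite indicE.
  by case: (boolP (b x)) => bx; [rewrite mem_set|rewrite memNset//=; exact/negP].
by rewrite integral_indic// setIT.
Qed.

Section planar_measure.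
Context {R : realType}.
Local Notation mu := (@lebesgue_measure R).
Local Notation leb2 := (@leb2 R).

Let MR := measurableTypeR R.

Let leb2_sigma_finite : sigma_finite setT (mu \x mu)%E.
Proof.
pose I (n : nat) : set MR := `[- n%:R, n%:R]%classic.
have mI n : measurable (I n) by exact: measurable_itv.
exists (fun n => I n `*` I n).
  apply/seteqP; split => // -[a b] _.
  exists (maxn (Num.bound `|a|) (Num.bound `|b|)) => //; rewrite /I /= !in_itv /= -!ler_norml.
  by split; apply: (le_trans (ltW (archi_boundP (normr_ge0 _)))); rewrite ler_nat ?leq_maxl ?leq_maxr.
move=> n; split; first exact: measurableX.
rewrite product_measure1E//= !lebesgue_measure_itv /=.
by case: ifPn => _; rewrite ?mule0// -EFinD -EFinM ltry.
Qed.

(** Tonelli's theorem between the plane and another space needs the product measure packed with its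
    sigma-finiteness. *)
Definition leb2_sf : {sigma_finite_measure set (MR * MR)%type -> \bar R} :=
  HB.pack (mu \x mu)%E (Measure_isSigmaFinite.Build _ _ _ (mu \x mu)%E leb2_sigma_finite).

Let scale2 (k : R) (p : MR * MR) : MR * MR := (k * p.1, k * p.2).

Let measurable_scale2 k : measurable_fun setT (scale2 k).
Proof.
apply/measurable_fun_pairP; split.
  by apply: (measurableT_comp (measurable_mulrl k)).
by apply: (measurableT_comp (measurable_mulrl k)).
Qed.

Let EFin3 (a b c : R) (x y : \bar R) : a * b * c = 1 ->
  (a%:E * (b%:E * x * (c%:E * y)) = x * y)%E.
Proof.
move=> E; rewrite (muleC b%:E x) -!muleA (muleA b%:E) -EFinM (muleCA a%:E x).
by rewrite (muleA a%:E) -EFinM mulrA E mul1e.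
Qed.

(** Uniqueness of the product measure: [k ^+ 2] times the image under scaling agrees with it on
    rectangles. *)
Lemma leb2_scale (k : R) (A : set (MR * MR)) : 0 < k -> measurable A ->
  leb2 (scale2 k @^-1` A) = ((k ^- 2)%:E * leb2 A)%E.
Proof.
move=> k0 mA.
have k2 : 0 <= k ^+ 2 by rewrite sqr_ge0.
pose nu := mscale (NngNum k2) (image_measure (mu \x mu)%E (measurable_scale2 k)).
have H : forall A B : set MR, measurable A -> measurable B ->
    nu (A `*` B) = (mu A * mu B)%E.
  move=> X Y mX mY; rewrite /nu /mscale /= /pushforward.
  have -> : scale2 k @^-1` (X `*` Y) =
    ((fun x => k * x) @^-1` X) `*` ((fun x => k * x) @^-1` Y) by [].
  have mk (Z : set MR) : measurable Z -> measurable ((fun x : MR => (k * x) : MR) @^-1` Z).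
    by move=> mZ; rewrite -[X in measurable X]setTI; exact: measurable_mulrl.
  rewrite product_measure1E; [|exact: mk..].
  rewrite [LHS](_ : _ = ((k ^+ 2)%:E * (mu ((fun x => (k * x)%R) @^-1` X) *
    mu ((fun x => (k * x)%R) @^-1` Y)))%E)// !lebesgue_measure_preimage_mulrl//.
  apply: EFin3; by field; exact: lt0r_neq0.
have -> : leb2 A = nu A by exact: (product_measure_unique H mA).
rewrite /nu /mscale /= /pushforward muleA -EFinM mulVf ?mul1e//.
by rewrite expf_neq0// lt0r_neq0.
Qed.

(** The parameter is the squared radius, which makes the area linear in [s]. *)
Definition disc (s : R) : set (R * R) := [set p | p.1 ^+ 2 + p.2 ^+ 2 <= s].

Lemma measurable_sqnorm : measurable_fun setT (fun p : R * R => p.1 ^+ 2 + p.2 ^+ 2).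
Proof. by apply: measurable_funD; exact: measurable_funX. Qed.

Lemma measurable_le_set (d : measure_display) (T : measurableType d) (f g : T -> R) :
  measurable_fun setT f -> measurable_fun setT g -> measurable [set x | f x <= g x].
Proof.
move=> mf mg; have H := measurable_fun_ler mf mg.
rewrite (_ : [set x | _] = setT `&` (fun x => f x <= g x) @^-1` [set true]).
  exact: H.
by rewrite setTI; apply/seteqP; split => x /=; case: (f x <= g x).
Qed.

Lemma measurable_disc s : measurable (disc s).
Proof. by apply: measurable_le_set => //; exact: measurable_sqnorm. Qed.

Let disc_scale (s : R) : 0 < s -> leb2 (disc s) = (s%:E * leb2 (disc 1))%E.
Proof.
move=> s0; have k0 : 0 < (Num.sqrt s)^-1 by rewrite invr_gt0 sqrtr_gt0.
have -> : disc s = scale2 (Num.sqrt s)^-1 @^-1` disc 1.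
  apply/seteqP; split => p; rewrite /disc /=;
  by rewrite !exprMn -mulrDr exprVn sqr_sqrtr ?(ltW s0)// ler_pdivrMl// mulr1.
rewrite leb2_scale//; last exact: measurable_disc.
by rewrite exprVn invrK sqr_sqrtr// ltW.
Qed.

(** By inclusion in a square. The area must be known to be a real constant before the Gauss integral
    can determine it. *)
Let disc1_lty : (leb2 (disc 1) < +oo)%E.
Proof.
have mI : measurable (`[-1, 1]%classic : set MR) by exact: measurable_itv.
apply: (@le_lt_trans _ _ (leb2 (`[-1, 1]%classic `*` `[-1, 1]%classic))).
  apply: le_measure; rewrite ?inE//; [exact: measurable_disc|exact: measurableX|].
  move=> p; rewrite /disc /= !in_itv /= => h.
  by split; apply/andP; split; nra.
rewrite /leb2 product_measure1E//= !lebesgue_measure_itv /=.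
by rewrite lte_fin gtrN// -EFinD -EFinM ltry.
Qed.

(** e^-q is the integral of e^-s over s >= q. With [q] a squared norm, the layers are discs. *)
Let le_indic_integral (q : R) : 0 <= q ->
  (\int[mu]_(s in `]0%R, +oo[) (expR (- s) * (q <= s)%R%:R)%:E = (expR (- q))%:E)%E.
Proof.
rewrite le_eqVlt => /predU1P[<-|q0]; last first.
  rewrite -integral_expRN_cy [LHS]integral_mkcond [RHS]integral_mkcond.
  apply: eq_integral => s _; rewrite !patchE !mem_setE !in_itv /= !andbT.
  have [qs|qs] := leP q s; first by rewrite (lt_le_trans q0 qs) mulr1.
  by rewrite mulr0; case: ifP.
rewrite -integral_expRN_cy -integral_itv_obnd_cbnd; last first.
  by apply/measurable_EFinP; apply: measurable_funTS; exact: measurable_expRN.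
by apply: eq_integral => s; rewrite inE /= in_itv /= andbT => s0; rewrite (ltW s0) mulr1.
Qed.

(* Two evaluations of the Gauss integral: as a product, and by layers. *)
Let disc1 : leb2 (disc 1) = pi%:E.
Proof.
pose f (p : MR * MR) (s : MR) : \bar R := (expR (- s) * (p.1 ^+ 2 + p.2 ^+ 2 <= s)%R%:R)%:E.
have mpos : measurable (`]0%R, +oo[%classic : set MR) by exact: measurable_itv.
have sq0 (p : R * R) : 0 <= p.1 ^+ 2 + p.2 ^+ 2 by rewrite addr_ge0 ?sqr_ge0.
have E1 : (\int[mu \x mu]_(p in setT) \int[mu]_(s in `]0%R, +oo[) f p s = pi%:E)%E.
  transitivity (\int[mu \x mu]_(p in setT `*` setT) (gauss_fun p.1 * gauss_fun p.2)%:E)%E.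
    rewrite setXTT; apply: eq_integral => p _; rewrite le_indic_integral//.
    by rewrite /gauss_fun -expRD opprD.
  rewrite (@tonelli_prod_in _ _ _ _ _ mu mu setT setT
    (fun x y => (gauss_fun x * gauss_fun y)%:E))//; last 2 first.
  - by apply/measurable_EFinP; apply: measurable_funM;
      exact: (measurableT_comp (@measurable_gauss_fun R)).
  - by move=> x y _ _; rewrite lee_fin mulr_ge0 ?gauss_fun_ge0.
  transitivity (\int[mu]_x ((Num.sqrt pi) * gauss_fun x)%:E)%E.
    apply: eq_integral => x _; rewrite integralZl_EFin//.
    + by rewrite integralT_gauss -EFinM mulrC.
    + exact: measurable_gauss_fun.
    + by move=> *; exact: gauss_fun_ge0.
    + exact: gauss_fun_ge0.
  rewrite integralZl_EFin//.
  - by rewrite integralT_gauss -EFinM -expr2 sqr_sqrtr// pi_ge0.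
  - exact: measurable_gauss_fun.
  - by move=> *; exact: gauss_fun_ge0.
rewrite -E1 (@tonelli_in _ _ _ _ _ leb2_sf mu setT `]0%R, +oo[%classic f)//; last 2 first.
- apply/measurable_EFinP; apply: measurable_funM.
    exact: (measurableT_comp measurable_expRN).
  apply: measurable_boolR; apply: measurable_fun_ler => //.
  exact: (measurableT_comp measurable_sqnorm).
- by move=> p s _ _; rewrite lee_fin mulr_ge0 ?expR_ge0.
have fc : leb2 (disc 1) = (fine (leb2 (disc 1)))%:E by rewrite fineK// ge0_fin_numE.
have c0 : 0 <= fine (leb2 (disc 1)) by rewrite fine_ge0.
(* The disc at layer [s] has [s] times the area of the unit disc, and the integral of s e^-s is
   Gamma(2) = 1. *)
transitivity (\int[mu]_(s in `]0%R, +oo[)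
  (fine (leb2 (disc 1)) * (s `^ (2 - 1) * expR (- s)))%:E)%E.
  rewrite integralZl_EFin//.
  - rewrite -/(Gamma_int 2) (_ : 2 = 1 + 1 :> R)// Gamma_intS// Gamma_int1 !mule1.
    by rewrite fc.
  - apply: measurable_funM; [exact: measurable_powRl|exact: measurable_expRN].
  - by move=> x _; rewrite mulr_ge0 ?powR_ge0 ?expR_ge0.
apply: eq_integral => s; rewrite inE /= in_itv /= andbT => s0.
rewrite integralZl_EFin//; last first.
  by apply: measurable_boolR; apply: measurable_fun_ler => //; exact: measurable_sqnorm.
have -> : (\int[mu \x mu]_x (x.1 ^+ 2 + x.2 ^+ 2 <= s)%R%:R%:E)%E = leb2 (disc s).
  by apply: (integral_boolR leb2_sf); exact: measurable_disc.
rewrite (disc_scale s0); move: fc; case: (leb2 (disc 1)) => [r| |]// _.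
rewrite /= -!EFinM; congr EFin.
have -> : 2 - 1 = 1 :> R by ring.
by rewrite powRr1 ?(ltW s0)//; ring.
Qed.

Lemma leb2_disc (s : R) : 0 < s -> leb2 (disc s) = (s * pi)%:E.
Proof. by move=> s0; rewrite (disc_scale s0) disc1. Qed.

(** [powR] sends base [0] and exponent [- al] to [0]: with this default value of the path gain, the
    origin belongs to no level set at a positive level, hence the removed centre. *)
Lemma leb2_punctured_disc (s : R) : 0 < s ->
  leb2 (disc s `\` [set (0, 0)]) = (s * pi)%:E.
Proof.
move=> s0; rewrite -leb2_disc//.
have m00 : measurable ([set (0, 0)] : set (MR * MR)).
  rewrite (_ : [set _] = [set 0] `*` [set 0]); first by apply: measurableX.
  by apply/seteqP; split => -[a b] /= [-> ->].
have z : leb2 [set (0, 0)] = 0%E.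
  rewrite (_ : [set _] = [set 0] `*` [set 0]); last first.
    by apply/seteqP; split => -[a b] /= [-> ->].
  by rewrite /leb2 product_measure1E//= lebesgue_measure_set1 mul0e.
rewrite [RHS](_ : _ = leb2 ((disc s `\` [set (0, 0)]) `|` [set (0, 0)])); last first.
  congr leb2; apply/seteqP; split => p /=.
    move=> h; have [->|pn] := eqVneq p (0, 0); first by right.
    by left; split => //; apply/eqP.
  move=> [[]//|->]; rewrite /disc /= expr0n /= addr0 ltW//.
rewrite -[RHS]/(leb2_sf _) measureU//; last 2 first.
- by apply: measurableD => //; exact: measurable_disc.
- by apply/seteqP; split => p // [[_ h] h2].
by rewrite [X in (_ + X)%E]z adde0.
Qed.

Let exp_layer (x : R) : 0 <= x ->
  (\int[mu]_(t in `]0%R, +oo[) (expR (- t) * (t <= x)%R%:R)%:E = (1 - expR (- x))%:E)%E.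
Proof.
rewrite le_eqVlt => /predU1P[<-|x0].
  rewrite oppr0 expR0 subrr; apply: integral0_eq => t; rewrite /= in_itv /= andbT => t0.
  by rewrite leNgt t0 mulr0.
have d u : is_derive u (1:R) (fun u : R => - expR (- u)) (expR (- u)).
  by apply: is_derive_eq; rewrite mulrN1 opprK.
have c u : {for u, continuous (fun u : R => - expR (- u))}.
  by apply/differentiable_continuous/derivable1_diffP; have [] := d u.
transitivity (\int[mu]_(t in `[0%R, x]) (expR (- t))%:E)%E; last first.
  rewrite (@continuous_FTC2 _ _ (fun u => - expR (- u)) _ _ x0).
  - by rewrite -EFinB oppr0 expR0 opprK addrC.
  - apply: continuous_subspaceT => u; apply: continuous_comp; first exact: opp_continuous.
    exact: continuous_expR.
  - split.
    + by move=> u _; have [] := d u.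
    + exact: (cvg_at_right_filter (c 0)).
    + exact: (cvg_at_left_filter (c x)).
  - by move=> u _; rewrite derive1E; have [_ ->] := d u.
rewrite -integral_itv_obnd_cbnd; last first.
  by apply/measurable_EFinP; apply: measurable_funTS; exact: measurable_expRN.
rewrite [LHS]integral_mkcond [RHS]integral_mkcond.
apply: eq_integral => t _; rewrite !patchE !mem_setE !in_itv /= !andbT.
by case: (0 < t); case: (t <= x); rewrite ?mulr1 ?mulr0.
Qed.

Lemma norm2E (p : R * R) : norm2 p = (p.1 ^+ 2 + p.2 ^+ 2) `^ 2^-1.
Proof. by rewrite /norm2 powR12_sqrt// addr_ge0 ?sqr_ge0. Qed.

Lemma measurable_norm2 : measurable_fun setT (fun p : R * R => norm2 p).
Proof.
under eq_fun do rewrite norm2E.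
exact: (measurableT_comp (measurable_powRl _) measurable_sqnorm).
Qed.

(** 1 - e^-x is the integral of e^-t over 0 < t <= x, and for fixed [t] the points with t <= W
    |p|^-al form a punctured disc of squared radius (W/t)^(2/al). What remains is the Gamma integral
    of t^(-2/al) e^-t, convergent because [al] exceeds 2. *)
Lemma planar_layer_cake (W al : R) : 0 < W -> 2 < al ->
  (\int[leb2]_p (1 - expR (- (W * norm2 p `^ (- al))))%:E =
   (pi * W `^ (2 / al) * Gammaf (1 - 2 / al))%:E)%E.
Proof.
move=> W0 al2; have al0 : 0 < al by apply: lt_trans al2.
have mpos : measurable (`]0%R, +oo[%classic : set MR) by exact: measurable_itv.
pose f (p : MR * MR) (t : MR) : \bar R := (expR (- t) * (t <= W * norm2 p `^ (- al))%R%:R)%:E.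
have mW : measurable_fun setT (fun p : MR * MR => W * norm2 p `^ (- al)).
  apply: measurable_funM => //.
  exact: (measurableT_comp (measurable_powRl _) measurable_norm2).
transitivity (\int[mu \x mu]_(p in setT) \int[mu]_(t in `]0%R, +oo[) f p t)%E.
  by apply: eq_integral => p _; rewrite exp_layer// mulr_ge0 ?powR_ge0// ltW.
rewrite (@tonelli_in _ _ _ _ _ leb2_sf mu setT `]0%R, +oo[%classic f)//; last 2 first.
- apply/measurable_EFinP; apply: measurable_funM.
    exact: (measurableT_comp measurable_expRN).
  apply: measurable_boolR; apply: measurable_fun_ler => //.
  exact: (measurableT_comp mW).
- by move=> p s _ _; rewrite lee_fin mulr_ge0 ?expR_ge0.
have d1 : 2 / al < 1 by rewrite ltr_pdivrMr// mul1r.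
transitivity (\int[mu]_(t in `]0%R, +oo[)
  (pi * W `^ (2 / al) * (t `^ ((1 - 2 / al) - 1) * expR (- (1 * t))))%:E)%E; last first.
  rewrite integralZl_EFin//.
  - by rewrite Gamma_int_scale ?subr_gt0// powR1 mul1r.
  - exact: measurable_Gamma_integrand.
  - by move=> x _; rewrite mulr_ge0 ?powR_ge0 ?expR_ge0.
  - by rewrite mulr_ge0 ?powR_ge0// pi_ge0.
apply: eq_integral => t; rewrite inE /= in_itv /= andbT => t0.
have Wt : 0 < W / t by rewrite divr_gt0.
rewrite integralZl_EFin//; last first.
  by apply: measurable_boolR; exact: measurable_fun_ler.
have layerP (q : R) : 0 < q ->
    q <= (W / t) `^ (2 / al) <-> t <= W * q `^ (2^-1 * - al).
  move=> q0; have -> : 2^-1 * - al = - (al / 2) by ring.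
  have a2 : 0 < al / 2 by rewrite divr_gt0.
  have qa : 0 < q `^ (al / 2) by rewrite powR_gt0.
  have E : (W / t) `^ (2 / al) `^ (al / 2) = W / t.
    rewrite -powRrM; have -> : 2 / al * (al / 2) = 1 by field; exact: lt0r_neq0.
    by rewrite (powRr1 (ltW Wt)).
  have E2 : (t <= W * q `^ (- (al / 2))) = (q `^ (al / 2) <= W / t).
    by rewrite powRN ler_pdivlMr// ler_pdivlMr// mulrC.
  have Z0 : 0 <= (W / t) `^ (2 / al) by exact: powR_ge0.
  rewrite E2; move: E Z0; move: ((W / t) `^ (2 / al)) => Z E Z0; rewrite -E; split => h.
    by apply: ge0_ler_powR; rewrite ?nnegrE ?powR_ge0 ?(ltW q0) ?(ltW a2).
  rewrite leNgt; apply/negP => h2; move: h; rewrite leNgt => /negP; apply.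
  by apply: gt0_ltr_powR; rewrite ?nnegrE ?powR_ge0 ?(ltW q0).
have -> : (\int[mu \x mu]_p (t <= W * norm2 p `^ (- al))%R%:R%:E)%E =
    leb2 (disc ((W / t) `^ (2 / al)) `\` [set (0, 0)]).
  have -> : disc ((W / t) `^ (2 / al)) `\` [set (0, 0)] =
      [set p | t <= W * norm2 p `^ (- al)].
    apply/seteqP; split => -[a b]; rewrite /disc /= norm2E /= -powRrM.
      move=> [h1 h2].
      have q0 : 0 < a ^+ 2 + b ^+ 2.
        rewrite lt_neqAle addr_ge0 ?sqr_ge0// andbT eq_sym paddr_eq0 ?sqr_ge0// !sqrf_eq0.
        by apply/negP => /andP[/eqP ? /eqP ?]; apply: h2; congr pair.
      exact: (layerP _ q0).1.
    have [q0|] := ltP 0 (a ^+ 2 + b ^+ 2).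
      move=> h; split; first exact: (layerP _ q0).2.
      by move=> [a0 b0]; move: q0; rewrite a0 b0 expr0n addr0 ltxx.
    move=> q0 h; exfalso.
    have q1 : a ^+ 2 + b ^+ 2 = 0 by apply/eqP; rewrite eq_le q0 addr_ge0 ?sqr_ge0.
    move: h; rewrite q1 powR0 ?mulr0 ?leNgt ?t0//.
    by rewrite mulf_neq0 ?invr_eq0 ?oppr_eq0 ?lt0r_neq0.
  by apply: (integral_boolR leb2_sf); exact: measurable_le_set.
rewrite leb2_punctured_disc ?powR_gt0// -EFinM; congr EFin.
rewrite powRM ?invr_ge0 ?(ltW W0) ?(ltW t0)// -[t^-1](powR_inv1 (ltW t0)) -powRrM.
have -> : 1 - 2 / al - 1 = -1 * (2 / al) by ring.
by rewrite mul1r; ring.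
Qed.
End planar_measure.

(** * Independence *)

Definition image_prob (d1 d2 : measure_display) (T1 : measurableType d1)
  (T2 : measurableType d2) (R : realType) (P : probability T1 R)
  (f : T1 -> T2) (mf : measurable_fun setT f) : probability T2 R :=
  HB.pack (pushforward P f : set T2 -> \bar R)
    (Measure.on (image_measure P mf))
    (Measure_isProbability.Build _ _ _ (image_measure P mf) (probability_setT P)).

Lemma bigsetI_seqP (T : Type) (I : eqType) (J : seq I) (E : I -> set T) w :
  (\big[setI/setT]_(j <- J) E j) w <-> forall j, j \in J -> E j w.
Proof.
elim: J => [|i J IH]; first by rewrite big_nil.
rewrite big_cons; split.
  by move=> [Ei /IH h] j; rewrite in_cons => /predU1P[->//|]; exact: h.
move=> h; split; first by apply: h; rewrite mem_head.
by apply/IH => j jJ; apply: h; rewrite in_cons jJ orbT.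
Qed.

Section independence.
Context {R : realType} {d : measure_display} {Omega : measurableType d}
  (P : probability Omega R) {I : eqType} (F : I -> set (set Omega)).
Hypotheses (Fsig : forall i, sigma_algebra setT (F i))
  (Fmeas : forall i, F i `<=` measurable) (indF : mutually_indep P F).

Definition other_sets (i0 : I) : set (set Omega) := \bigcup_(i in [set i | i != i0]) F i.

(** Finite intersections of events from the families other than [i0]: a pi-system that generates the
    sigma-algebra of all of them together. *)
Let cyl (i0 : I) : set (set Omega) := [set E | exists (J : seq I) (E_ : I -> set Omega),
  [/\ uniq J, i0 \notin J, forall j, j \in J -> F j (E_ j) &
      E = \big[setI/setT]_(j <- J) E_ j]].

Let FT i : F i setT.
Proof.
by have [h0 hD _] := Fsig i; have := hD _ h0; rewrite setD0.
Qed.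

Let FI i A B : F i A -> F i B -> F i (A `&` B).
Proof.
move=> FA FB.
have h := (sigma_algebra_id (Fsig i)).
have mA : @measurable _ (g_sigma_algebraType (F i)) A by exact: sub_sigma_algebra.
have mB : @measurable _ (g_sigma_algebraType (F i)) B by exact: sub_sigma_algebra.
by rewrite -h; exact: (@measurableI _ (g_sigma_algebraType (F i))).
Qed.

Let cyl_setI i0 : setI_closed (cyl i0).
Proof.
move=> _ _ [J1 [E1 [u1 n1 F1 ->]]] [J2 [E2 [u2 n2 F2 ->]]].
(* Index lists are merged, and an event missing from one of them is padded with [setT]. *)
exists (undup (J1 ++ J2)), (fun j => (if j \in J1 then E1 j else setT) `&`
                                     (if j \in J2 then E2 j else setT)).
split.
- exact: undup_uniq.
- by rewrite mem_undup mem_cat negb_or n1.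
- by move=> j _; apply: FI; case: ifPn => jJ; [exact: F1|exact: FT|exact: F2|exact: FT].
apply/seteqP; split => w.
  move=> [/bigsetI_seqP h1 /bigsetI_seqP h2]; apply/bigsetI_seqP => j _.
  by split; case: ifPn => // jJ; [exact: h1|exact: h2].
move=> /bigsetI_seqP h; split; apply/bigsetI_seqP => j /= jJ.
  by have := h j; rewrite /= mem_undup mem_cat jJ => -[].
by have := h j; rewrite /= mem_undup mem_cat jJ orbT => -[].
Qed.

Let cyl_meas i0 : cyl i0 `<=` measurable.
Proof.
move=> _ [J [E [_ _ FE ->]]]; rewrite big_seq; apply: bigsetI_measurable => j jJ.
by apply: (Fmeas (i := j)); exact: FE.
Qed.

(** For fixed [A], the finite measures P(A and .) and P(A) P(.) agree on the pi-system [cyl i0] by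
    mutual independence, hence on the sigma-algebra it generates. *)
Lemma indep_of_others (i0 : I) A B : F i0 A -> <<s other_sets i0 >> B ->
  P (A `&` B) = (P A * P B)%E.
Proof.
move=> FA sB.
have mA : measurable A by exact: Fmeas FA.
have PA0 : 0 <= fine (P A) by rewrite fine_ge0.
pose m1 := mrestr P mA.
pose m2 := mscale (NngNum PA0) P.
have cT : cyl i0 setT by exists [::], (fun=> setT); split => //; rewrite big_nil.
have H : forall E, cyl i0 E -> m1 E = m2 E.
  move=> _ [J [E [uJ nJ FE ->]]]; rewrite /m1 /m2 /mrestr /mscale /=.
  rewrite fineK ?fin_num_measure//.
  pose E' j := if j == i0 then A else E j.
  have eE : \big[setI/setT]_(j <- J) E j = \big[setI/setT]_(j <- J) E' j.
    apply: eq_big_seq => j jJ; rewrite /E'; case: eqP => // ji.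
    by move: nJ; rewrite -ji jJ.
  have FE' j : j \in i0 :: J -> F j (E' j).
    rewrite in_cons /E'; case: eqP => [->//|_ /= jJ]; exact: FE.
  have := indF (J := i0 :: J) (E := E') _ FE'.
  rewrite /= nJ uJ => /(_ isT).
  rewrite !big_cons {1 3}/E' eqxx setIC eE => ->; congr (_ * _)%E.
  have -> // := indF (J := J) (E := E') uJ.
  by move=> j jJ; apply: FE'; rewrite in_cons jJ orbT.
have sub : <<s other_sets i0 >> `<=` <<s cyl i0 >>.
  apply: smallest_sub; first exact: smallest_sigma_algebra.
  move=> E [j ji FE]; apply: sub_sigma_algebra.
  exists [:: j], (fun=> E); split => //.
  - by rewrite inE eq_sym; exact: ji.
  - by move=> k; rewrite inE => /eqP ->.
  - by rewrite big_seq1.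
have := @g_sigma_algebra_measure_unique _ R Omega (cyl i0) (@cyl_meas i0) (fun=> setT)
  (fun=> cT) _ m1 m2 (@cyl_setI i0) H _ B (sub _ sB).
move=> U; have : m1 B = m2 B.
  apply: U; first by apply/seteqP; split => // w _; exists 0%N.
  have E : m1 setT = P A by congr (P _); rewrite setTI.
  have lt : (m1 setT < +oo)%E by rewrite E ltey_eq fin_num_measure.
  by move=> _; exact: lt.
by rewrite /m1 /m2 /mrestr /mscale /= setIC fineK// fin_num_measure.
Qed.

Lemma other_sets_measurable (i0 : I) : <<s other_sets i0 >> `<=` measurable.
Proof.
apply: smallest_sub; first exact: sigma_algebra_measurable.
by move=> E [j _]; exact: Fmeas.
Qed.

(** Omega with the sigma-algebra of all families but [i0]: depending only on the other variables
    becomes plain measurability. *)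
Local Notation others i0 := (g_sigma_algebraType (other_sets i0)).

Lemma measurable_others (d' : measure_display) (T : measurableType d') (i0 i : I) (X : Omega -> T) :
  i != i0 -> (forall B, measurable B -> F i (X @^-1` B)) ->
  measurable_fun setT (X : others i0 -> T).
Proof.
move=> ii0 FX _ B mB; rewrite setTI; apply: sub_sigma_algebra.
by exists i => //; exact: FX.
Qed.

(** By independence the map w |-> (w, Y w) into [others i0 * T] has a product law. Tonelli then
    integrates out [Y] with [w] frozen, which takes the place of conditioning on all other
    variables. *)
Lemma indep_fubini (d' : measure_display) (T : measurableType d') (i0 : I) (Y : Omega -> T)
  (mY : measurable_fun setT Y) (f : Omega -> T -> \bar R) :
  (forall B, measurable B -> F i0 (Y @^-1` B)) ->
  measurable_fun setT (fun p : others i0 * T => f p.1 p.2) ->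
  (forall w y, (0 <= f w y)%E) ->
  (\int[P]_w f w (Y w) = \int[P]_w \int[image_prob P mY]_y f w y)%E.
Proof.
move=> FY mf f0.
have mid : measurable_fun setT (fun w : Omega => w : others i0).
  by move=> _ B mB; rewrite setTI; exact: (@other_sets_measurable i0 B mB).
pose P' := image_prob P mid.
have mphi : measurable_fun setT (fun w : Omega => (w : others i0, Y w)).
  by apply: measurable_fun_pair.
pose Q := image_measure P mphi.
have HQ : forall (A : set (others i0)) (B : set T), measurable A -> measurable B ->
    Q (A `*` B) = (P' A * image_prob P mY B)%E.
  move=> A B mA mB.
  rewrite muleC -(indep_of_others (FY _ mB) mA) /=.
  by congr (P _); apply/seteqP; split => w [].
have PQ := product_measure_unique HQ.
transitivity (\int[Q]_p f p.1 p.2)%E.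
  by rewrite ge0_integral_pushforward.
transitivity (\int[P' \x image_prob P mY]_p f p.1 p.2)%E.
  by apply: eq_measure_integral => A mA _; exact: (esym (PQ A mA)).
rewrite (fubini_tonelli1 (m1 := P') (m2 := image_prob P mY) (fun p => f p.1 p.2))//.
rewrite ge0_integral_pushforward//.
- apply: (measurable_fun_fubini_tonelli_F (m2 := image_prob P mY)
    (fun p : others i0 * T => f p.1 p.2) mf) => p; exact: f0.
- by move=> w _; exact: integral_ge0.
Qed.
End independence.

Lemma integral_level (R : realType) (z : \bar R) : (0 <= z)%E ->
  (\int[@lebesgue_measure R]_(t in `]0%R, +oo[) ((t%:E < z)%E%:R)%:E)%E = z.
Proof.
case: z => [r| |]//; last first.
  by rewrite (eq_integral (fun=> 1%E)) => [|t _];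
    rewrite ?integral_cst//= ?lebesgue_measure_itv /= ?ltry ?mul1e.
rewrite lee_fin => r0.
transitivity (\int[@lebesgue_measure R]_(t in `]0%R, r[) (cst 1%E t))%E.
  rewrite [LHS]integral_mkcond [RHS]integral_mkcond; apply: eq_integral => t _.
  rewrite !patchE !mem_setE !in_itv /= andbT lte_fin.
  by case: (0 < t); case: (t < r).
rewrite integral_cst//= mul1e lebesgue_measure_itv /= lte_fin.
move: r0; rewrite le_eqVlt => /predU1P[<-|r0]; first by rewrite ltxx.
by rewrite r0 oppr0 adde0.
Qed.

(** The hypothesis speaks of sets only. A nonnegative function is the integral over levels [t] of
    the indicators of [t < f x], and Tonelli brings the set formula under that integral. *)
Lemma integral_density (R : realType) (gam : probability (measurableTypeR R) R)
  (pdf : R -> R) : measurable_fun setT pdf -> (forall x, 0 <= pdf x) ->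
  (forall B : set R, measurable B ->
     gam B = (\int[@lebesgue_measure R]_(y in B `&` `[0%R, +oo[) (pdf y)%:E)%E) ->
  forall f : R -> \bar R, measurable_fun setT f -> (forall x, 0 < x -> (0 <= f x)%E) ->
  (\int[gam]_(x in `]0%R, +oo[) f x =
   \int[@lebesgue_measure R]_(x in `]0%R, +oo[) (f x * (pdf x)%:E))%E.
Proof.
move=> mpdf pdf0 gamE f mf f0; set mu := @lebesgue_measure R.
pose pos : set (measurableTypeR R) := `]0%R, +oo[%classic.
have mpos : measurable pos by exact: measurable_itv.
pose g (x t : measurableTypeR R) : R := (t%:E < f x)%E%:R.
have mg : measurable_fun setT (fun p : measurableTypeR R * measurableTypeR R => g p.1 p.2).
  apply: measurable_boolR; apply: measurable_fun_lte.
    exact/measurable_EFinP.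
  exact: (measurableT_comp mf).
have g0 x t : 0 <= g x t by [].
transitivity (\int[gam]_(x in pos) \int[mu]_(t in pos) (g x t)%:E)%E.
  apply: eq_integral => x; rewrite inE /= in_itv /= andbT => x0.
  by rewrite integral_level// f0.
rewrite (@tonelli_in _ _ _ _ _ gam mu pos pos (fun x t => (g x t)%:E))//; last 2 first.
- exact/measurable_EFinP.
- by move=> x t _ _; rewrite lee_fin g0.
transitivity (\int[mu]_(t in pos) \int[mu]_(x in pos) (g x t * pdf x)%:E)%E; last first.
  rewrite (@tonelli_in _ _ _ _ _ mu mu pos pos (fun t x => (g x t * pdf x)%:E))//; last 2 first.
  - apply/measurable_EFinP; apply: measurable_funM.
      exact: (measurableT_comp mg (@measurable_swap _ _ _ _)).
    exact: (measurableT_comp mpdf).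
  - by move=> x t _ _; rewrite lee_fin mulr_ge0.
  apply: eq_integral => x; rewrite inE /pos /= in_itv /= andbT => x0.
  rewrite integralZr_EFin//; first by rewrite integral_level// f0.
  exact: (measurableT_comp mg (measurable_pair1 x)).
apply: eq_integral => t _.
have mgt : measurable_fun setT (g ^~ t) by exact: (measurableT_comp mg (measurable_pair2 t)).
have mB : measurable (pos `&` [set x | (t%:E < f x)%E]).
  apply: measurableI => //.
  rewrite (_ : [set x | _] = setT `&` (fun x => (t%:E < f x)%E) @^-1` [set true]).
    by apply: measurable_fun_lte.
  by rewrite setTI; apply/seteqP; split => x /=; case: (t%:E < f x)%E.
transitivity (gam (pos `&` [set x | (t%:E < f x)%E])).
  rewrite -[RHS]mul1e -integral_cst// [RHS]integral_mkcond [LHS]integral_mkcond.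
  apply: eq_integral => x _; rewrite !patchE in_setI.
  case: ifPn => //= _; rewrite /g /=.
  by case: (boolP (t%:E < f x)%E) => h; [rewrite mem_set|rewrite memNset//=; exact/negP].
rewrite gamE// [LHS]integral_mkcond [RHS]integral_mkcond.
apply: eq_integral => x _; rewrite !patchE !in_setI.
have -> : (x \in `[0%R, +oo[%classic) = (0 <= x) by rewrite mem_setE in_itv /= andbT.
have -> : (x \in pos) = (0 < x) by rewrite mem_setE in_itv /= andbT.
have [x0|x0] := ltP 0 x => //=; rewrite (ltW x0) andbT /g /=.
by case: (boolP (t%:E < f x)%E) => h; [rewrite mem_set// mul1r|rewrite memNset//= ?mul0r//; exact/negP].
Qed.

(** * Laplace functional of the Poisson process *)

Lemma cvg_EFin_seq (R : realType) (u : nat -> R) (l : R) :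
  u n @[n --> \oo] --> l -> (u n)%:E @[n --> \oo] --> l%:E.
Proof. by move=> ul; apply: cvg_EFin => //; exact: nearW. Qed.

Lemma eseries_limE (R : realType) (f : nat -> R) (l : R) :
  \sum_(n < N) f n @[N --> \oo] --> l -> (\sum_(n <oo) (f n)%:E)%E = l%:E.
Proof.
move=> fl; apply: cvg_lim => //.
apply: cvg_trans (cvg_EFin_seq fl); apply: near_eq_cvg; apply: nearW => N.
by rewrite -sumEFin big_mkord.
Qed.

Lemma nat_nondecreasing_dichotomy (c : nat -> nat) :
  {homo c : m n / (m <= n)%N} ->
  (exists n, \forall N \near \oo, c N = n) \/ (forall M, \forall N \near \oo, (M <= c N)%N).
Proof.
move=> hc; have [[M cM]|h] := pselect (exists M, forall N, (c N <= M)%N).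
  left; elim: M cM => [|M IH] cM.
    by exists 0%N; apply: nearW => N; apply/eqP; rewrite -leqn0.
  have [h|/existsNP[N0 /negP]] := pselect (forall N, (c N <= M)%N); first exact: IH.
  rewrite -ltnNge => hN0; exists M.+1; exists N0 => // N /= N0N.
  by apply/eqP; rewrite eqn_leq cM (leq_trans hN0)// hc.
right => M; move/forallNP : h => /(_ M)/existsNP[N0 /negP]; rewrite -ltnNge => hN0.
by exists N0 => // N /= N0N; apply: leq_trans (ltnW hN0) _; exact: hc.
Qed.

(** The exponential series with argument nu e^-r. *)
Lemma poisson_generating (R : realType) (nu r : R) :
  (\sum_(m <oo) (expR (- (r * m%:R)) * poisson_mass nu m)%:E =
   (expR (- (nu * (1 - expR (- r)))))%:E)%E.
Proof.
apply: eseries_limE.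
have -> : - (nu * (1 - expR (- r))) = - nu + nu * expR (- r) by ring.
rewrite expRD.
have H : expR (- nu) * \sum_(n < N) (nu * expR (- r)) ^+ n / n`!%:R @[N --> \oo] -->
    expR (- nu) * expR (nu * expR (- r)).
  by apply: cvgM; [exact: cvg_cst|exact: cvg_expR_partial].
apply: cvg_trans H; apply: near_eq_cvg; apply: nearW => N.
rewrite /= mulr_sumr; apply: eq_bigr => m _.
have -> : expR (- (r * m%:R)) = expR (- r) ^+ m.
  by rewrite -expRM_natr -mulNr.
rewrite /poisson_mass exprMn; ring.
Qed.

Section point_counts.
Context {R : realType} {d : measure_display} {Omega : measurableType d}
  (P : probability Omega R) (lam : R) (x : nat -> Omega -> R * R).
Hypothesis HP : is_PPP P lam x.

Let mx i : measurable_fun setT (x i). Proof. by have [h _] := HP. Qed.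

Definition cnt (A : set (R * R)) (N : nat) (w : Omega) : nat := \sum_(i < N) (x i w \in A).

Lemma cnt_homo A w : {homo (fun N => cnt A N w) : m n / (m <= n)%N}.
Proof.
apply: homo_leq => //; first exact: leq_trans.
by move=> n; rewrite /cnt big_ord_recr /= leq_addr.
Qed.

Lemma cnt_sumE A N w : (\sum_(0 <= i < N) (\1_A (x i w))%:E)%E = ((cnt A N w)%:R : R)%:E.
Proof.
rewrite big_mkord sumEFin; congr EFin.
rewrite /cnt natr_sum; apply: eq_bigr => i _; by rewrite indicE.
Qed.

Lemma count_pts_fin A w n : (\forall N \near \oo, cnt A N w = n) ->
  count_pts x A w = n%:R%:E.
Proof.
move=> h; apply: cvg_lim => //.
under eq_fun do rewrite cnt_sumE.
apply: cvg_near_cst; apply: filterS h => N ->//.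
Qed.

Lemma count_pts_infty A w : (forall M, \forall N \near \oo, (M <= cnt A N w)%N) ->
  count_pts x A w = +oo%E.
Proof.
move=> h; apply: cvg_lim => //.
under eq_fun do rewrite cnt_sumE.
by apply/cvgenyP; apply/cvgnyPge => M; exact: h.
Qed.

(** For [r > 0] this is e^(-r m) if [A] contains m points and [0] if it contains infinitely many, so
    almost sure finiteness of the count need not be settled beforehand. *)
Definition expcount (r : R) (A : set (R * R)) (w : Omega) : R :=
  limn (fun N => expR (- (r * (cnt A N w)%:R))).

(** Counts along the sequence either stabilise or diverge. In the second case both sides vanish: no
    finite count is attained, and [r > 0]. The factor [y] carries the rest of a product through the
    expansion. *)
Lemma cvg_expcount r A w : 0 < r ->
  expR (- (r * (cnt A N w)%:R)) @[N --> \oo] --> expcount r A w /\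
  (forall y, 0 <= y -> (expcount r A w * y)%:E =
    (\sum_(m <oo) (expR (- (r * m%:R)) *
       (\1_[set w | count_pts x A w = m%:R%:E] w * y))%:E)%E).
Proof.
move=> r0; have [[n hn]|hoo] := nat_nondecreasing_dichotomy (@cnt_homo A w).
  have E := count_pts_fin hn.
  have cv : expR (- (r * (cnt A N w)%:R)) @[N --> \oo] --> expR (- (r * n%:R)).
    by apply: cvg_near_cst; apply: filterS hn => N ->.
  have -> : expcount r A w = expR (- (r * n%:R)) by exact: cvg_lim cv.
  split => // y y0; rewrite (@nneseriesD1 R _ n xpredT)//; last first.
    by move=> k _; rewrite lee_fin !mulr_ge0// ?expR_ge0// indicE.
  rewrite eseries0 ?adde0; last first.
    move=> m _ /= mn; rewrite indicE memNset ?mul0r ?mulr0//= E => -[] /eqP.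
    by rewrite eqr_nat eq_sym; apply/negP.
  by rewrite indicE mem_set ?mul1r.
have E := count_pts_infty hoo.
have cv : expR (- (r * (cnt A N w)%:R)) @[N --> \oo] --> (0 : R).
  have h1 : r * (cnt A N w)%:R @[N --> \oo] --> +oo.
    apply/cvgryPge => B; apply: filterS (hoo (Num.bound (`|B| / r))) => N hN.
    apply: (le_trans (ler_norm B)); rewrite mulrC -ler_pdivrMr//.
    apply: (le_trans (ltW (archi_boundP _))); last by rewrite ler_nat.
    by rewrite divr_ge0// ltW.
  exact: (cvg_comp _ _ h1 (@cvgr_expR R)).
have -> : expcount r A w = 0 by exact: cvg_lim cv.
split => // y y0; rewrite mul0r eseries0// => m _ _.
by rewrite indicE memNset ?mul0r ?mulr0//= E.
Qed.

Let mcount A : measurable A -> measurable_fun setT (count_pts x A).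
Proof.
move=> mA; apply: ge0_emeasurable_sum => [k w _ _|k _].
  by rewrite lee_fin indicE.
apply/measurable_EFinP; apply: (measurableT_comp _ (mx k)); exact: measurable_indic.
Qed.

Let count_set (A : set (R * R)) (m : nat) : set Omega :=
  [set w | count_pts x A w = m%:R%:E].

Let mcount_set A m : measurable A -> measurable (count_set A m).
Proof.
move=> mA; rewrite (_ : count_set A m = setT `&` count_pts x A @^-1` [set m%:R%:E]).
  exact: mcount.
by rewrite setTI.
Qed.

Lemma measurable_cnt A N : measurable A -> measurable_fun setT (fun w => (cnt A N w)%:R : R).
Proof.
move=> mA; rewrite (_ : (fun w => _) = (fun w => \sum_(i < N) \1_A (x i w))); last first.
  by apply/funext => w; rewrite /cnt natr_sum; apply: eq_bigr => i _; rewrite indicE.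
by apply: measurable_sum => i; apply: (measurableT_comp _ (mx i)); exact: measurable_indic.
Qed.

Lemma measurable_expcount r A : 0 < r -> measurable A -> measurable_fun setT (expcount r A).
Proof.
move=> r0 mA; apply: (measurable_fun_cvg (h := fun N w => expR (- (r * (cnt A N w)%:R)))).
  move=> N; apply: measurableT_comp => //; apply: measurable_funN; apply: measurable_funM => //.
  exact: measurable_cnt.
by move=> w _; have [] := cvg_expcount A w r0.
Qed.

Lemma expcount_ge0 r A w : 0 < r -> 0 <= expcount r A w.
Proof.
move=> r0; have [cv _] := cvg_expcount A w r0.
by apply: (limr_ge (cvgP _ cv)); apply: nearW => N; exact: expR_ge0.
Qed.

(** * Joint Laplace transforms of counts in disjoint bounded sets *)

Section families.
Context {I : eqType} (r : I -> R) (A : I -> set (R * R)).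
Hypotheses (r0 : forall j, 0 < r j) (mA : forall j, measurable (A j))
  (bA : forall j, bounded2 (A j)).

Let p j := poisson_mass (lam * fine (leb2 (A j))).
Let G j := expR (- (lam * fine (leb2 (A j)) * (1 - expR (- r j)))).

(** The weights are nonnegative because [is_PPP] makes them probabilities. *)
Let p_ge0 j n : 0 <= p j n.
Proof.
have [_ /(_ 1%N (fun=> A j) (fun=> n))] := HP.
rewrite !big_ord1 => H; rewrite -lee_fin -H//.
by move=> a b; rewrite !ord1.
Qed.

(** [is_PPP] indexes its sets by ordinals; [nth] translates to lists, which suit the induction that
    follows. *)
Lemma poisson_joint (J : seq I) (n : I -> nat) : uniq J ->
  (forall i j, i \in J -> j \in J -> i != j -> A i `&` A j = set0) ->
  (\int[P]_w (\prod_(j <- J) \1_(count_set (A j) (n j)) w)%:E)%E =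
  (\prod_(j <- J) p j (n j))%:E.
Proof.
case: J => [_ _|j0 J0].
  under eq_integral do rewrite big_nil.
  by rewrite integral_cst// mul1e big_nil; exact: probability_setT.
set J := j0 :: J0 => uJ dJ.
have [_ /(_ (size J) (fun i => A (nth j0 J i)) (fun i => n (nth j0 J i)))] := HP.
move=> H.
have {H} := H (fun i => mA _) (fun i => bA _) _.
rewrite -(big_mkord xpredT (fun i => [set w | count_pts x (A (nth j0 J i)) w = (n (nth j0 J i))%:R%:E])).
rewrite -(big_nth j0 xpredT (fun j => count_set (A j) (n j))).
rewrite -(big_mkord xpredT (fun i => (poisson_mass (lam * fine (leb2 (A (nth j0 J i)))) (n (nth j0 J i)))%:E)).
rewrite -(big_nth j0 xpredT (fun j => (p j (n j))%:E)) prodEFin.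
move=> <-.
  rewrite -[RHS]mul1e -[RHS]integral_cst//; last first.
    by apply: bigsetI_measurable => j _; exact: mcount_set.
  rewrite [RHS]integral_mkcond; apply: eq_integral => w _; rewrite patchE.
  case: ifPn; rewrite ?inE ?notin_setE => h.
    rewrite big1_seq// => j /= jJ; rewrite indicE mem_set//.
    by move/bigsetI_seqP : h; exact.
  have /existsNP[j /not_implyP[jJ nj]] : ~ (forall j, j \in J -> count_set (A j) (n j) w).
    by move=> h2; apply: h; apply/bigsetI_seqP.
  by rewrite (bigD1_seq j)//= indicE memNset// mul0r.
move=> a b ab; apply: dJ; rewrite ?mem_nth//.
by rewrite nth_uniq.
Qed.

(** Induction on [J1]: the head is expanded over its possible counts m and moved to [J2] with count
    m prescribed, where the hypothesis applies; the sum over m is then a Poisson generating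
    function. *)
Lemma expcount_joint (J1 J2 : seq I) (n : I -> nat) : uniq (J1 ++ J2) ->
  (forall i j, i \in J1 ++ J2 -> j \in J1 ++ J2 -> i != j -> A i `&` A j = set0) ->
  (\int[P]_w ((\prod_(j <- J1) expcount (r j) (A j) w) *
     \prod_(j <- J2) \1_(count_set (A j) (n j)) w)%:E)%E =
  ((\prod_(j <- J1) G j) * \prod_(j <- J2) p j (n j))%:E.
Proof.
elim: J1 J2 n => [|j J1 IH] J2 n uJ dJ.
  under eq_integral do rewrite big_nil mul1r.
  by rewrite big_nil mul1r poisson_joint.
have pJ : perm_eq ((j :: J1) ++ J2) (J1 ++ j :: J2).
  by have /permPl := perm_catCA [:: j] J1 J2.
have uJ' : uniq (J1 ++ j :: J2) by rewrite -(perm_uniq pJ).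
have jJ2 : j \notin J2.
  by move: uJ => /= /andP[]; rewrite mem_cat negb_or => /andP[].
have dJ' i k : i \in J1 ++ j :: J2 -> k \in J1 ++ j :: J2 -> i != k -> A i `&` A k = set0.
  by rewrite -!(perm_mem pJ); exact: dJ.
pose X w := (\prod_(j <- J1) expcount (r j) (A j) w) *
     \prod_(j <- J2) (\1_(count_set (A j) (n j)) w : R).
have X0 w : 0 <= X w.
  by rewrite mulr_ge0//; apply: prodr_ge0 => i _; [exact: expcount_ge0|rewrite indicE].
have mX : measurable_fun setT X.
  apply: measurable_funM; apply: measurable_prod => i _; first exact: measurable_expcount.
  by apply: measurable_indic; exact: mcount_set.
transitivity (\int[P]_w (\sum_(m <oo) (expR (- (r j * m%:R)) *
    (\1_(count_set (A j) m) w * X w))%:E))%E.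
  apply: eq_integral => w _; rewrite big_cons -mulrA.
  by have [_ H] := cvg_expcount (A j) w (r0 j); exact: (H _ (X0 w)).
rewrite integral_nneseries//; last 2 first.
- move=> m; apply/measurable_EFinP; apply: measurable_funM => //; apply: measurable_funM => //.
  by apply: measurable_indic; exact: mcount_set.
- move=> m w _; rewrite lee_fin indicE; apply: mulr_ge0; first exact: expR_ge0.
  exact: (mulr_ge0 _ (X0 w)).
pose K := (\prod_(j <- J1) G j) * \prod_(j <- J2) p j (n j).
transitivity (\sum_(m <oo) (K%:E * (expR (- (r j * m%:R)) * p j m)%:E))%E.
  apply: eq_eseriesr => m _.
  rewrite integralZl_EFin//; last 2 first.
  - apply: measurable_funM => //.
    by apply: measurable_indic; exact: mcount_set.
  - by move=> w _; rewrite indicE; exact: (mulr_ge0 _ (X0 w)).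
  (* Prescribing the count at [j] does not disturb [J2], which does not contain [j]. *)
  have nE i : i \in J2 -> (if i == j then m else n i) = n i.
    by move=> iJ; case: eqP => // ij; move: jJ2; rewrite -ij iJ.
  have IHm := IH (j :: J2) (fun i => if i == j then m else n i) uJ' dJ'.
  have -> : (\int[P]_w (\1_(count_set (A j) m) w * X w)%:E)%E = (K * p j m)%:E.
    transitivity ((\prod_(j <- J1) G j) *
        \prod_(i <- j :: J2) p i (if i == j then m else n i))%:E.
      rewrite -IHm; apply: eq_integral => w _; rewrite big_cons eqxx; congr EFin.
      have -> : \prod_(i <- J2) \1_(count_set (A i) (if i == j then m else n i)) w =
        \prod_(i <- J2) (\1_(count_set (A i) (n i)) w : R).
        by apply: eq_big_seq => i iJ; rewrite nE.
      by rewrite /X; ring.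
    rewrite big_cons eqxx; congr EFin.
    have -> : \prod_(i <- J2) p i (if i == j then m else n i) = \prod_(i <- J2) p i (n i).
      by apply: eq_big_seq => i iJ; rewrite nE.
    by rewrite /K; ring.
  by rewrite -!EFinM; congr EFin; ring.
rewrite nneseriesZl; last first.
  by move=> m _; rewrite lee_fin mulr_ge0 ?expR_ge0.
by rewrite poisson_generating -EFinM big_cons /K /G; congr EFin; ring.
Qed.

Lemma cvg_bigprod (J : seq I) (u : nat -> I -> R) (l : I -> R) :
  (forall j, u N j @[N --> \oo] --> l j) ->
  \prod_(j <- J) u N j @[N --> \oo] --> \prod_(j <- J) l j.
Proof.
move=> ul; elim: J => [|j J IH].
  by rewrite big_nil; under eq_fun do rewrite big_nil; exact: cvg_cst.
by rewrite big_cons; under eq_fun do rewrite big_cons; exact: cvgM.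
Qed.

(** Summed over the first N points, a simple function is a combination of counts, so the exponential
    is a product whose factors tend to the [expcount]; bounded convergence exchanges limit and
    expectation. *)
Lemma laplace_simple (J : seq I) : uniq J ->
  (forall i j, i \in J -> j \in J -> i != j -> A i `&` A j = set0) ->
  (\int[P]_w (expR (- \sum_(i < N) \sum_(j <- J) r j * \1_(A j) (x i w)))%:E)%E @[N --> \oo]
  --> (expR (- (lam * \sum_(j <- J) fine (leb2 (A j)) * (1 - expR (- r j)))))%:E.
Proof.
move=> uJ dJ.
have eE N w : expR (- \sum_(i < N) \sum_(j <- J) r j * \1_(A j) (x i w)) =
    \prod_(j <- J) expR (- (r j * (cnt (A j) N w)%:R)).
  rewrite -expR_sum exchange_big /= -sumrN; congr expR; apply: eq_bigr => j _.
  rewrite -mulr_sumr; congr (- (_ * _)); rewrite /cnt natr_sum.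
  by apply: eq_bigr => i _; rewrite indicE.
have -> : (expR (- (lam * \sum_(j <- J) fine (leb2 (A j)) * (1 - expR (- r j)))))%:E =
    (\int[P]_w (\prod_(j <- J) expcount (r j) (A j) w)%:E)%E.
  have := @expcount_joint J [::] (fun=> 0%N); rewrite cats0 => /(_ uJ dJ).
  under eq_integral do rewrite big_nil mulr1.
  rewrite big_nil mulr1 => ->; rewrite -expR_sum mulr_sumr -sumrN; congr (expR _)%:E.
  by apply: eq_bigr => j _; rewrite mulrA.
have mcn j N : measurable_fun setT (fun w => expR (- (r j * (cnt (A j) N w)%:R))).
  apply: measurableT_comp => //; apply: measurable_funN; apply: measurable_funM => //.
  exact: measurable_cnt.
under eq_fun do under eq_integral do rewrite eE.
apply: (@dominated_convergence_EFin _ _ _ P setT _ _ _ (fun=> 1)) => //.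
- by move=> N; apply: measurable_prod => j _; exact: mcn.
- by apply: measurable_prod => j _; exact: measurable_expcount.
- move=> w _; apply: cvg_bigprod => j; by have [] := cvg_expcount (A j) w (r0 j).
- move=> N w _; rewrite ger0_norm; last by apply: prodr_ge0 => j _; exact: expR_ge0.
  apply: prodr_ile1 => j _; rewrite expR_ge0 /= -expR0 ler_expR oppr_le0.
  by rewrite mulr_ge0// ltW.
- by rewrite integral_cst//= mul1e probability_setT ltry.
Qed.
End families.

Let box (n : nat) : set (R * R) := [set p | `|p.1| <= n%:R] `&` [set p | `|p.2| <= n%:R].

Let mbox n : measurable (box n).
Proof.
by apply: measurableI; apply: measurable_le_set => //; exact: measurableT_comp.
Qed.

Lemma leb2_bounded_lty (B : set (R * R)) : measurable B -> bounded2 B -> (leb2 B < +oo)%E.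
Proof.
move=> mB [s bB].
have mI : measurable (`[- s, s]%classic : set R) by exact: measurable_itv.
apply: (@le_lt_trans _ _ (leb2 (`[- s, s]%classic `*` `[- s, s]%classic))).
  apply: le_measure; rewrite ?inE//; first exact: measurableX.
  by move=> p /bB[]; rewrite !ler_norml /= !in_itv /= => -> ->.
rewrite /leb2 product_measure1E//= !lebesgue_measure_itv /=.
by case: ifPn => _; rewrite ?mule0// -EFinD -EFinM ltry.
Qed.

Import finmap HBNNSimple.

(** * Monotone approximation by simple functions of bounded support *)

Section general.
Variable (f : R * R -> R) (C : R).
Hypotheses (mf : measurable_fun setT f) (f0 : forall p, 0 <= f p).
Hypothesis fC : (\int[leb2]_p (1 - expR (- f p))%:E = C%:E)%E.

Let mfE : measurable_fun setT (fun p => (f p)%:E). Proof. exact/measurable_EFinP. Qed.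

Let phi (n : nat) : {nnsfun (R * R) >-> R} := nnsfun_approx measurableT mfE n.
(** The simple approximations from below are cut to a box because [is_PPP] only speaks of bounded
    sets. *)
Let fn (n : nat) (p : R * R) : R := phi n p * \1_(box n) p.

Let cvg_fn p : fn n p @[n --> \oo] --> f p.
Proof.
rewrite -[f p]mulr1; apply: cvgM.
  have H : (phi n p)%:E @[n --> \oo] --> (f p)%:E.
    by apply: (cvg_nnsfun_approx measurableT mfE) => // q _; rewrite lee_fin.
  exact: (fine_cvg H).
apply: cvg_near_cst; near=> n; rewrite indicE mem_set//; split => /=.
  near: n; exists (Num.bound `|p.1|) => // n /= hn.
  by apply: (le_trans (ltW (archi_boundP (normr_ge0 _)))); rewrite ler_nat.
near: n; exists (Num.bound `|p.2|) => // n /= hn.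
by apply: (le_trans (ltW (archi_boundP (normr_ge0 _)))); rewrite ler_nat.
Unshelve. all: by end_near. Qed.

Let phi_ge0 n p : 0 <= phi n p. Proof. exact: fun_ge0. Qed.

Let fn_ge0 n p : 0 <= fn n p.
Proof. by rewrite mulr_ge0// indicE. Qed.

Let fn_le n p : fn n p <= f p.
Proof.
apply: (@le_trans _ _ (phi n p)).
  by rewrite ler_piMr// indicE; case: (_ \in _).
rewrite -lee_fin /phi nnsfun_approxE; apply: le_approx => // q _.
by rewrite lee_fin.
Qed.

Let mfn n : measurable_fun setT (fn n).
Proof. by apply: measurable_funM => //; exact: measurable_indic. Qed.

Let J n : seq R := [seq r <- finmap.enum_fset (fset_set (range (phi n))) | 0 < r].
Let A n r : set (R * R) := phi n @^-1` [set r] `&` box n.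
(** Equal to [r] on the list [J n]; the value 1 elsewhere makes the rate positive at every index. *)
Let rr (r : R) : R := if 0 < r then r else 1.

Let J_uniq n : uniq (J n). Proof. by rewrite filter_uniq// fset_uniq. Qed.
Let rr_gt0 r : 0 < rr r. Proof. by rewrite /rr; case: ifPn. Qed.
Let mA n r : measurable (A n r).
Proof. by apply: measurableI => //; rewrite -[X in measurable X]setTI; exact: measurable_funP. Qed.
Let bA n r : bounded2 (A n r).
Proof. by exists n%:R => p [_ []]. Qed.

Let sum_single (s : seq R) (v c : R) : uniq s ->
  \sum_(r <- s) (if r == v then c else 0) = if v \in s then c else 0.
Proof.
move=> us; case: ifPn => vs.
  by rewrite (bigD1_seq v)//= eqxx big1 ?addr0// => r /negbTE ->.
by rewrite big1_seq// => r /= rs; case: eqP => // rv; move: vs; rewrite -rv rs.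
Qed.

(** At most one level set contains [p], so any [h] commutes with the decomposition; [h 0 = 0] covers
    the points in none of them. Used with the identity and with 1 - e^-y. *)
Let fn_sum (h : R -> R) n p : h 0 = 0 ->
  h (fn n p) = \sum_(r <- J n) h (rr r) * \1_(A n r) p.
Proof.
move=> h0.
transitivity (\sum_(r <- J n) (if r == phi n p then h (fn n p) else 0)).
  rewrite sum_single//; case: ifPn => //.
  rewrite mem_filter negb_and => /orP[|/negP].
    by rewrite -leNgt => v0; rewrite /fn (_ : phi n p = 0) ?mul0r//; apply/eqP; rewrite eq_le v0 phi_ge0.
  have pin : phi n p \in fset_set (range (phi n)).
    by rewrite in_fset_set//; apply/mem_set; exists p.
  by move=> nv; exfalso; apply: nv; exact: pin.
apply: eq_big_seq => r; rewrite mem_filter => /andP[r0 _].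
rewrite /rr r0; case: eqP => [->|rv].
  rewrite /fn !indicE.
  have -> : (p \in A n (phi n p)) = (p \in box n).
    by apply/idP/idP => /set_mem H; apply/mem_set; [case: H|split].
  by case: (p \in box n); rewrite ?mulr1 ?mulr0.
by rewrite indicE memNset ?mulr0// => -[/esym].
Qed.

Let Cn n : R := \sum_(r <- J n) fine (leb2 (A n r)) * (1 - expR (- rr r)).

Let one_sub_exp_ge0 (y : R) : 0 <= y -> 0 <= 1 - expR (- y).
Proof. by move=> y0; rewrite subr_ge0 -expR0 ler_expR oppr_le0. Qed.

Let fnC n : (\int[leb2]_p (1 - expR (- fn n p))%:E = (Cn n)%:E)%E.
Proof.
have c0 r : 0 <= 1 - expR (- rr r) by apply: one_sub_exp_ge0; exact: ltW.
transitivity (\int[leb2]_p (\sum_(r <- J n) ((1 - expR (- rr r)) * \1_(A n r) p)%:E))%E.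
  apply: eq_integral => p _; rewrite sumEFin; congr EFin.
  by rewrite (@fn_sum (fun y => 1 - expR (- y)))// oppr0 expR0 subrr.
rewrite /leb2 ge0_integral_sum//; last 2 first.
- by move=> r; apply/measurable_EFinP; apply: measurable_funM => //; apply: measurable_indic; exact: (mA n r).
- by move=> r p _; rewrite lee_fin mulr_ge0// indicE.
rewrite -sumEFin; apply: eq_bigr => r _.
rewrite integralZl_EFin//; last by apply: measurable_indic; exact: (mA n r).
rewrite [X in (_ * X)%E](_ : _ = leb2 (A n r)); last first.
  by rewrite integral_indic ?setIT//; exact: (mA n r).
rewrite EFinM muleC; congr (_ * _)%E.
by rewrite fineK// ge0_fin_numE//; exact: leb2_bounded_lty.
Qed.

Let m1e (h : R * R -> R) : measurable_fun setT h ->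
  measurable_fun setT (fun p => 1 - expR (- h p)).
Proof.
move=> mh; apply: measurable_funB => //; apply: measurableT_comp => //.
by apply: measurableT_comp.
Qed.

Let cvg_Cn : Cn n @[n --> \oo] --> C.
Proof.
have H : (\int[leb2]_p (1 - expR (- fn n p))%:E)%E @[n --> \oo] -->
    (\int[leb2]_p (1 - expR (- f p))%:E)%E.
  (* The limit integrand itself dominates, and [fC] makes its integral finite. *)
  apply: (@dominated_convergence_EFin _ _ _ (@leb2_sf R) setT _ _ _ (fun p => 1 - expR (- f p))) => //.
  - by move=> n; exact: (m1e (mfn n)).
  - exact: (m1e mf).
  - exact: (m1e mf).
  - move=> p _; apply: cvgB; first exact: cvg_cst.
    apply: (@continuous_cvg _ _ _ _ _ _ (fun y => expR (- y))); last exact: cvg_fn.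
    by apply: continuous_comp; [exact: opp_continuous|exact: continuous_expR].
  - move=> n p _; rewrite ger0_norm ?one_sub_exp_ge0//.
    by rewrite lerB// ler_expR lerN2.
  - by rewrite [ltLHS]fC ltry.
rewrite fC in H.
have : (Cn n)%:E @[n --> \oo] --> C%:E.
  by apply: cvg_trans H; apply: near_eq_cvg; apply: nearW => n; rewrite fnC.
exact: fine_cvg.
Qed.

Let b (n N : nat) : \bar R := (\int[P]_w (expR (- \sum_(i < N) fn n (x i w)))%:E)%E.
Let a (N : nat) : \bar R := (\int[P]_w (expR (- \sum_(i < N) f (x i w)))%:E)%E.

Let msum (g : R * R -> R) N : measurable_fun setT g ->
  measurable_fun setT (fun w => expR (- \sum_(i < N) g (x i w))).
Proof.
move=> mg; apply: measurableT_comp => //; apply: measurable_funN.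
by apply: measurable_sum => i; exact: (measurableT_comp mg (mx i)).
Qed.

Let cvg_b n : b n N @[N --> \oo] --> (expR (- (lam * Cn n)))%:E.
Proof.
have H := @laplace_simple R rr (A n) rr_gt0 (mA n) (bA n) (J n) (J_uniq n).
have {}H := H _.
apply: cvg_trans (H _); last first.
  move=> i j _ _ ij; apply/seteqP; split => p // [[pi _] [pj _]].
  by move: ij; rewrite -pi -pj eqxx.
apply: near_eq_cvg; apply: nearW => N; apply: eq_integral => w _.
congr (expR (- _))%:E; apply: eq_bigr => i _.
exact: esym (@fn_sum id n (x i w) erefl).
Qed.

Let fin01 (h : Omega -> R) : measurable_fun setT h -> (forall w, 0 <= h w <= 1) ->
  (\int[P]_w (h w)%:E)%E \is a fin_num.
Proof.
move=> mh h01; rewrite ge0_fin_numE; last first.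
  by apply: integral_ge0 => w _; rewrite lee_fin; case/andP: (h01 w).
apply: (@le_lt_trans _ _ (\int[P]_w 1%:E)%E); first by apply: le_integral_EFin.
by rewrite integral_cst//= mul1e probability_setT ltry.
Qed.

Let exp01 (y : R) : 0 <= y -> 0 <= expR (- y) <= 1.
Proof. by move=> y0; rewrite expR_ge0 -expR0 ler_expR oppr_le0. Qed.

Let bfin n N : b n N \is a fin_num.
Proof. by apply: fin01 => [|w]; [exact: msum|apply: exp01; exact: sumr_ge0]. Qed.
Let afin N : a N \is a fin_num.
Proof. by apply: fin01 => [|w]; [exact: msum|apply: exp01; exact: sumr_ge0]. Qed.

(** Adding points lowers the exponential, so [b n] decreases to its limit and stays above it. *)
Let b_ge n N : ((expR (- (lam * Cn n)))%:E <= b n N)%E.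
Proof.
have nb : nonincreasing_seq (b n).
  apply/nonincreasing_seqP => M; apply: le_integral_EFin => //; [exact: msum|exact: msum|].
  move=> w _; rewrite expR_ge0 ler_expR lerN2 big_ord_recr /= lerDl; exact: fn_ge0.
have := ereal_nonincreasing_cvgn nb => cv.
have -> : (expR (- (lam * Cn n)))%:E = ereal_inf (range (b n)).
  by apply: (cvg_unique _ (@cvg_b n) cv).
by apply: ereal_inf_lbound; exists N.
Qed.

Let a_le n N : (a N <= b n N)%E.
Proof.
apply: le_integral_EFin => //; [exact: msum|exact: msum|].
by move=> w _; rewrite expR_ge0 ler_expR lerN2; apply: ler_sum => i _; exact: fn_le.
Qed.

Let cvg_ba N : b n N @[n --> \oo] --> a N.
Proof.
apply: (@dominated_convergence_EFin _ _ _ P setT _ _ _ (fun=> 1)) => //.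
- by move=> n; exact: msum.
- exact: msum.
- move=> w _; apply: (@continuous_cvg _ _ _ _ _ _ (fun y => expR (- y))).
    by apply: continuous_comp; [exact: opp_continuous|exact: continuous_expR].
  elim: N => [|N IH].
    by rewrite big_ord0; under eq_fun do rewrite big_ord0; exact: cvg_cst.
  rewrite big_ord_recr /=; under eq_fun do rewrite big_ord_recr /=.
  by apply: cvgD; [exact: IH|exact: cvg_fn].
- move=> n w _; rewrite ger0_norm ?expR_ge0//.
  by have /andP[] := @exp01 (\sum_(i < N) fn n (x i w)) (sumr_ge0 _ (fun i _ => fn_ge0 n _)).
- by rewrite integral_cst//= mul1e probability_setT ltry.
Qed.

Let cvg_expCn : expR (- (lam * Cn n)) @[n --> \oo] --> expR (- (lam * C)).
Proof.
apply: (@continuous_cvg _ _ _ _ _ _ (fun y => expR (- (lam * y)))); last exact: cvg_Cn.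
apply: continuous_comp; last exact: continuous_expR.
by apply: continuous_comp; [exact: mulrl_continuous|exact: opp_continuous].
Qed.

(** The limits in n and N are exchanged by monotonicity. Letting n grow in [b_ge] gives the lower
    bound e^(-lam C) for every N. For the upper bound, a N <= b n N with n fixed so that e^(-lam Cn)
    exceeds e^(-lam C) by at most e/2, and then N large. The sum over all points never has to be
    given a meaning. *)
Lemma laplace_PPP :
  (\int[P]_w (expR (- \sum_(i < N) f (x i w)))%:E)%E @[N --> \oo] --> (expR (- (lam * C)))%:E.
Proof.
suff H : fine (a N) @[N --> \oo] --> expR (- (lam * C)).
  apply: cvg_trans (cvg_EFin_seq H); apply: near_eq_cvg; apply: nearW => N.
  by rewrite fineK.
have fb n : fine (b n N) @[N --> \oo] --> expR (- (lam * Cn n)).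
  exact: (fine_cvg (@cvg_b n)).
have fba N : fine (b n N) @[n --> \oo] --> fine (a N).
  by apply: (@fine_cvg _ _ _ _ (b ^~ N)); rewrite fineK//; exact: cvg_ba.
have lo N : expR (- (lam * C)) <= fine (a N).
  apply: (ler_cvg_to cvg_expCn (fba N)); apply: nearW => n.
  by rewrite -lee_fin fineK.
apply/cvgrPdist_le => e e0.
have e2 : 0 < e / 2 by rewrite divr_gt0.
have [n hn] : exists n, expR (- (lam * Cn n)) <= expR (- (lam * C)) + e / 2.
  have lt0 : expR (- (lam * C)) < expR (- (lam * C)) + e / 2 by rewrite ltrDl.
  have H : \forall n \near \oo, expR (- (lam * Cn n)) <= expR (- (lam * C)) + e / 2.
    exact: (cvgr_le _ cvg_expCn _ lt0).
  exact: filter_ex H.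
have lt : expR (- (lam * Cn n)) < expR (- (lam * C)) + e.
  by apply: (le_lt_trans hn); rewrite ltrD2l ltr_pdivrMr// ltr_pMr// ltr1n.
have H : \forall N \near \oo, fine (b n N) <= expR (- (lam * C)) + e.
  exact: (cvgr_le _ (fb n) _ lt).
apply: filterS H => N hN.
have hab : fine (a N) <= fine (b n N) by rewrite -lee_fin !fineK.
rewrite distrC ger0_norm ?subr_ge0// lerBlDl.
exact: le_trans hab hN.
Qed.
End general.
End point_counts.

(** * Averaging over Gamma marks *)

Section Gamma_laplace.
Context {R : realType}.
Local Notation mu := (@lebesgue_measure R).
Local Notation pos := (`]0%R, +oo[%classic : set R).

(** This is (1 + t/m)^-m, the Laplace transform of the Gamma law of shape m and mean 1. *)
Definition gamma_laplace (m t : R) : R := m `^ m * (m + t) `^ (- m).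

Lemma gamma_laplace_gt0 (m t : R) : 0 < m -> 0 <= t -> 0 < gamma_laplace m t.
Proof. by move=> m0 t0; rewrite mulr_gt0 ?powR_gt0 ?ltr_wpDr. Qed.

Lemma gamma_laplace_le1 (m t : R) : 0 < m -> 0 <= t -> gamma_laplace m t <= 1.
Proof.
move=> m0 t0; have mt : 0 < m + t by rewrite ltr_wpDr.
rewrite /gamma_laplace powRN ler_pdivrMr ?powR_gt0// mul1r.
by apply: ge0_ler_powR; rewrite ?nnegrE ?(ltW m0) ?(ltW mt) ?lerDl.
Qed.

Lemma measurable_gamma_laplace (m : R) : measurable_fun setT (gamma_laplace m).
Proof.
apply: measurable_funM => //; apply: (measurableT_comp (measurable_powRl _)).
exact: measurable_funD.
Qed.

Variables (m : R) (gam : probability (measurableTypeR R) R).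
Hypothesis m0 : 0 < m.
Hypothesis gamE : forall f : R -> \bar R, measurable_fun setT f ->
  (forall x, 0 < x -> (0 <= f x)%E) ->
  (\int[gam]_(x in pos) f x = \int[mu]_(x in pos) (f x * (gamma_pdf m x)%:E))%E.

Let D2 : set (R * R) := pos `*` pos.
Let mpos : measurable (pos : set (measurableTypeR R)).
Proof. exact: measurable_itv. Qed.
Let mD2 : measurable (D2 : set (measurableTypeR R * measurableTypeR R)).
Proof. by apply: measurableX; exact: measurable_itv. Qed.

Lemma integral_gamma_pos (f : R -> \bar R) : measurable_fun setT f -> (forall y, (0 <= f y)%E) ->
  (\int[gam]_y f y = \int[gam]_(y in pos) f y)%E.
Proof.
move=> mf f0.
have mN : measurable (~` pos : set (measurableTypeR R)) by exact: measurableC.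
have N0 : gam (~` pos) = 0%E by rewrite probability_setC// (Gamma_pair_total m0 gamE) subee.
rewrite (ge0_negligible_integral mN)//.
by rewrite setTD setCK.
Qed.

Lemma integral_gamma_exp (t : R) : 0 <= t ->
  (\int[gam]_(y in pos) (expR (- (t * y)))%:E = (gamma_laplace m t)%:E)%E.
Proof.
move=> t0.
rewrite gamE//; last by apply/measurable_EFinP; apply: measurableT_comp => //; apply: measurable_funN; exact: mulrl_measurable.
transitivity (\int[mu]_(x in pos)
    ((m `^ m / Gammaf m) * (x `^ (m - 1) * expR (- ((m + t) * x))))%:E)%E.
  apply: eq_integral => x _; rewrite /gamma_pdf -EFinM; congr EFin.
  rewrite mulrDl opprD expRD; move: (Gammaf m) => *; ring.
rewrite integralZl_EFin//; last 3 first.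
- exact: measurable_Gamma_integrand.
- by move=> x _; rewrite mulr_ge0 ?powR_ge0 ?expR_ge0.
- by apply: divr_ge0; [exact: powR_ge0|exact: (ltW (Gammaf_gt0 m0))].
have mt : 0 < m + t by rewrite ltr_wpDr.
rewrite Gamma_int_scale// -EFinM /gamma_laplace; congr EFin.
have := Gammaf_gt0 m0; move: (Gammaf m) (m `^ m) (_ `^ (- m)) => *.
by field; rewrite !lt0r_neq0.
Qed.

Lemma integral_gamma_pair_exp (a b : R) : 0 <= a -> 0 <= b ->
  (\int[gam \x gam]_(q in D2) (1 - expR (- (a * q.1 + b * q.2)))%:E =
   (1 - gamma_laplace m a * gamma_laplace m b)%:E)%E.
Proof.
move=> a0 b0.
have lin_ge0 q : D2 q -> 0 <= a * q.1 + b * q.2.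
  by rewrite /D2 /= !in_itv /= !andbT => -[q1 q2]; rewrite addr_ge0 ?mulr_ge0 ?(ltW q1) ?(ltW q2).
have me : measurable_fun setT (fun q : measurableTypeR R * measurableTypeR R => expR (- (a * q.1 + b * q.2))).
  apply: measurableT_comp => //; apply: measurable_funN.
  by apply: measurable_funD; exact: measurable_funM.
have E1 : (\int[gam \x gam]_(q in D2) (expR (- (a * q.1 + b * q.2)))%:E =
    (gamma_laplace m a * gamma_laplace m b)%:E)%E.
  rewrite (@tonelli_prod_in _ _ _ _ _ gam gam pos pos (fun x y => (expR (- (a * x + b * y)))%:E))//; last first.
    exact/measurable_EFinP.
  transitivity (\int[gam]_(x in pos) (expR (- (a * x)) * gamma_laplace m b)%:E)%E.
    apply: eq_integral => x _; rewrite EFinM -integral_gamma_exp// -integralZl_EFin//.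
      by apply: eq_integral => y _; rewrite opprD expRD.
    by apply: measurableT_comp => //; apply: measurable_funN; exact: mulrl_measurable.
  rewrite integralZr_EFin ?integral_gamma_exp//.
    by apply: measurableT_comp => //; apply: measurable_funN; exact: mulrl_measurable.
  exact: (ltW (gamma_laplace_gt0 m0 b0)).
have T1 : (\int[gam \x gam]_(q in D2) 1%:E = 1)%E.
  rewrite integral_cst// mul1e.
  transitivity (gam pos * gam pos)%E; first exact: product_measure1E.
  by rewrite (Gamma_pair_total m0 gamE) mule1.
(* The integrals live in the extended reals, so the difference is found by adding back the finite
   integral of the exponential. *)
have : (\int[gam \x gam]_(q in D2) (1 - expR (- (a * q.1 + b * q.2)))%:E +
        \int[gam \x gam]_(q in D2) (expR (- (a * q.1 + b * q.2)))%:E = 1)%E.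
  rewrite -ge0_integralD_EFin//; last 2 first.
  - exact: measurable_funB.
  - by move=> q /lin_ge0 h; rewrite subr_ge0 -expR0 ler_expR oppr_le0.
  by rewrite -[RHS]T1; apply: eq_integral => q _; rewrite subrK.
rewrite E1 EFinB => <-; by rewrite addeK.
Qed.

(** The integrand is the mean over two gains of 1 - e^(-c (u a + v b) |p|^-al), so the planar
    integral can be done with the gains fixed. The condition on [u + v] lets one weight vanish while
    u a + v b stays positive. *)
Lemma shot_noise_exponent (u v c al : R) : 0 <= u -> 0 <= v -> 0 < u + v -> 0 < c -> 2 < al ->
  (\int[leb2]_p (1 - gamma_laplace m (u * c * norm2 p `^ (- al)) *
                     gamma_laplace m (v * c * norm2 p `^ (- al)))%:E =
   (pi * Gammaf (1 - 2 / al) * c `^ (2 / al))%:E *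
   \int[gam \x gam]_(q in D2) ((u * q.1 + v * q.2) `^ (2 / al))%:E)%E.
Proof.
move=> u0 v0 uv c0 al2.
pose gam2 : probability _ R := (gam \x gam)%E.
pose F (p q : measurableTypeR R * measurableTypeR R) : R :=
  1 - expR (- (c * (u * q.1 + v * q.2) * norm2 p `^ (- al))).
have mq : measurable_fun setT (fun q : R * R => u * q.1 + v * q.2).
  by apply: measurable_funD; exact: measurable_funM.
have mF : measurable_fun setT (fun z : (measurableTypeR R * measurableTypeR R) *
    (measurableTypeR R * measurableTypeR R) => (F z.1 z.2)%:E).
  apply/measurable_EFinP; apply: measurable_funB => //; apply: measurableT_comp => //.
  apply: measurable_funN; apply: measurable_funM.
    by apply: measurable_funM => //; exact: (measurableT_comp mq).
  apply: (measurableT_comp (measurable_powRl _)).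
  exact: (measurableT_comp measurable_norm2).
have W0 q : D2 q -> 0 < c * (u * q.1 + v * q.2).
  rewrite /D2 /= !in_itv /= !andbT => -[q1 q2]; rewrite mulr_gt0//.
  move: u0; rewrite le_eqVlt => /predU1P[u0|u0].
    by rewrite -u0 mul0r add0r mulr_gt0//; move: uv; rewrite -u0 add0r.
  by rewrite ltr_pwDl ?mulr_gt0// mulr_ge0// (ltW q2).
have F0 p q : D2 q -> 0 <= F p q.
  by move=> /W0 h; rewrite /F subr_ge0 -expR0 ler_expR oppr_le0 mulr_ge0 ?powR_ge0// ltW.
transitivity (\int[leb2_sf]_(p in setT) \int[gam2]_(q in D2) (F p q)%:E)%E.
  apply: eq_integral => p _; rewrite -integral_gamma_pair_exp; last 2 first.
  - by rewrite !mulr_ge0 ?powR_ge0// ltW.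
  - by rewrite !mulr_ge0 ?powR_ge0// ltW.
  by apply: eq_integral => q _; rewrite /F; congr (1 - expR (- _))%:E; ring.
rewrite (@tonelli_in _ _ _ _ _ leb2_sf gam2 setT D2 (fun p q => (F p q)%:E))//; last first.
  by move=> p q _ Dq; rewrite lee_fin F0.
have d1 : 2 / al < 1 by rewrite ltr_pdivrMr ?mul1r// (lt_trans _ al2).
have Gp : 0 < Gammaf (1 - 2 / al) by apply: Gammaf_gt0; rewrite subr_gt0.
rewrite -integralZl_EFin//; last 3 first.
- by apply: (measurableT_comp (measurable_powRl _)).
- by move=> q _; exact: powR_ge0.
- by apply: mulr_ge0; [apply: mulr_ge0; [exact: pi_ge0|exact: (ltW Gp)]|exact: powR_ge0].
apply: eq_integral => q /set_mem Dq.
rewrite [LHS](planar_layer_cake (W0 q Dq) al2); congr EFin.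
have q0 : 0 <= u * q.1 + v * q.2 by move: (W0 q Dq); rewrite pmulr_rgt0// => /ltW.
rewrite powRM ?(ltW c0)//; move: (Gammaf _) => *; ring.
Qed.
End Gamma_laplace.

(** * Derivatives of Laplace transforms *)

(** One term of the series of e^(ty) is at most the whole. *)
Lemma pow_expRN_le (R : realType) (t y : R) n : 0 < t -> 0 <= y ->
  y ^+ n * expR (- (t * y)) <= n`!%:R / t ^+ n.
Proof.
move=> t0 y0; have ty0 : 0 <= t * y by rewrite mulr_ge0// ltW.
have f0 : 0 < n`!%:R :> R by rewrite ltr0n fact_gt0.
have H : (t * y) ^+ n / n`!%:R <= expR (t * y).
  have := norm_expR_partial_le (t * y) n.+1.
  rewrite big_ord_recr /= (ger0_norm ty0); apply: le_trans.
  apply: le_trans (ler_norm _); rewrite lerDr; apply: sumr_ge0 => i _.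
  by rewrite divr_ge0// exprn_ge0.
rewrite expRN ler_pdivlMr ?exprn_gt0// mulrAC ler_pdivrMr ?expR_gt0//.
by move: H; rewrite exprMn ler_pdivrMr// mulrC [y ^+ n * _]mulrC [expR _ * _]mulrC.
Qed.

Lemma near_gt0 (R : realType) (t : R) : 0 < t -> \forall s \near t, 0 < s.
Proof. by move=> t0; exact: lt_nbhsr. Qed.

(** The closed form [expo_fun] is matched with a Laplace transform for positive arguments only;
    these form an open set, so derivatives at 1 agree as well. *)
Lemma derive1_eq_gt0 (R : realType) (f g : R -> R) : (forall t, 0 < t -> f t = g t) ->
  forall t, 0 < t -> derive1 f t = derive1 g t.
Proof.
move=> fg t t0; rewrite !derive1E; apply: near_eq_derive.
by apply: filterS (near_gt0 t0) => s; exact: fg.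
Qed.

Lemma derive1n_eq_gt0 (R : realType) (f g : R -> R) n : (forall t, 0 < t -> f t = g t) ->
  forall t, 0 < t -> derive1n n f t = derive1n n g t.
Proof.
move=> fg; elim: n => [|n IH] t t0; first by rewrite !derive1n0 fg.
by rewrite !derive1nS; exact: derive1_eq_gt0.
Qed.

Section laplace_derivative.
Context {R : realType} {d : measure_display} {Omega : measurableType d}.
Variables (P : probability Omega R) (W V : Omega -> R) (K : R).
Hypotheses (mW : measurable_fun setT W) (mV : measurable_fun setT V).
Hypotheses (W0 : forall w, 0 <= W w <= K) (V0 : forall w, 0 <= V w).

Let K0 : 0 <= K.
Proof. by case/andP: (W0 point) => h1 h2; exact: le_trans h1 h2. Qed.

Let f n (t : R) w := W w * V w ^+ n * expR (- (t * V w)).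
Let F n (t : R) := (\int[P]_w f n t w)%R.

Let mf n t : measurable_fun setT (f n t).
Proof.
apply: measurable_funM; first by apply: measurable_funM => //; exact: measurable_funX.
by apply: measurableT_comp => //; apply: measurable_funN; exact: measurable_funM.
Qed.

Let f_le n (t t' : R) w : 0 < t -> t <= t' -> 0 <= f n t' w <= K * (n`!%:R / t ^+ n).
Proof.
move=> t0 tt'; case/andP: (W0 w) => w0 wK; apply/andP; split.
  by rewrite !mulr_ge0 ?expR_ge0// exprn_ge0.
rewrite /f -mulrA; apply: ler_pM => //; first by rewrite mulr_ge0 ?expR_ge0// exprn_ge0.
apply: le_trans (pow_expRN_le n t0 (V0 w)).
by rewrite ler_wpM2l ?exprn_ge0// ler_expR lerN2 ler_wpM2r.
Qed.

Let integrable_bounded (h : Omega -> R) (C : R) : measurable_fun setT h ->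
  (forall w, `|h w| <= C) -> P.-integrable setT (EFin \o h).
Proof.
move=> mh hC; apply: (@dominated_integrable_EFin _ _ _ P setT measurableT h (cst C)) => //.
by rewrite (integral_cst P measurableT C%:E) [X in (_ * X)%E](probability_setT P) mule1 ltry.
Qed.

Lemma laplace_integrable n (t : R) : 0 < t -> P.-integrable setT (EFin \o f n t).
Proof.
move=> t0; apply: (@integrable_bounded _ (K * (n`!%:R / t ^+ n))) => // w.
by case/andP: (@f_le n t t w t0 (lexx _)) => h1 h2; rewrite ger0_norm.
Qed.

Let derf n w (t : R) : is_derive t (1:R) ((f n) ^~ w) (- f n.+1 t w).
Proof.
have H : is_derive t (1:R) (fun t => expR (- (t * V w))) (expR (- (t * V w)) * (- V w)).
  apply: is_derive1_comp.
  have -> : (fun s : R => - (s * V w)) = (fun s => (- V w) * s) by apply/funext => s; rewrite mulNr mulrC.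
  rewrite -[X in is_derive _ _ _ X]mulr1; exact: is_deriveZ.
have := is_deriveZ (W w * V w ^+ n) H.
rewrite (_ : _ *: _ = - f n.+1 t w)//.
by rewrite /f exprS /GRing.scale /=; ring.
Qed.

(** Differentiation under the integral on []t/2, 2t[], where the next integrand is at most K
    (n+1)!/(t/2)^(n+1): the exponential absorbs the powers of [V], so no moment of [V] enters. *)
Let derF n (t : R) : 0 < t -> is_derive t (1:R) (F n) (- F n.+1 t).
Proof.
move=> t0.
have t2 : 0 < t / 2 by rewrite divr_gt0.
have It : `]t / 2, t * 2[%classic t.
  by rewrite /= in_itv /= ltr_pdivrMr// !ltr_pMr// ltr1n.
have d1 x w : partial1of2 (f n) x w = - f n.+1 x w.
  by rewrite partial1of2E; exact: (@derive_val _ _ _ _ _ _ _ (derf n w x)).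
pose C : R := K * (n.+1`!%:R / (t / 2) ^+ n.+1).
have C0 : 0 <= C by rewrite mulr_ge0// divr_ge0// exprn_ge0// ltW.
have intf x : `]t / 2, t * 2[%classic x -> P.-integrable setT (EFin \o f n x).
  by rewrite /= in_itv /= => /andP[h _]; apply: laplace_integrable; exact: lt_trans h.
have derf1 x w : `]t / 2, t * 2[%classic x -> [set: Omega] w -> derivable (f n ^~ w) x 1.
  by move=> _ _; exact: (@ex_derive _ _ _ _ _ _ _ (derf n w x)).
have intC : P.-integrable setT (EFin \o cst C).
  by apply: (@integrable_bounded _ C) => // w /=; rewrite ger0_norm.
have Cub x w : `]t / 2, t * 2[%classic x -> [set: Omega] w ->
    `|partial1of2 (f n) x w| <= cst C w.
  rewrite /= in_itv /= => /andP[h _] _; rewrite d1 normrN.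
  by case/andP: (@f_le n.+1 (t / 2) x w t2 (ltW h)) => h1 h2; rewrite ger0_norm.
apply: DeriveDef.
  exact: (derivable_under_integral measurableT It intf derf1 (fun=> C0) intC Cub).
rewrite -derive1E.
rewrite (differentiation_under_integral measurableT It intf derf1 (fun=> C0) intC Cub).
rewrite (_ : (fun y => _) = (fun w => - f n.+1 t w)); last by apply/funext => w; rewrite d1.
under eq_Rintegral do rewrite -mulN1r.
by rewrite RintegralZl ?mulN1r//; exact: laplace_integrable.
Qed.

(** The bounded weight [W] and the factor [r] allow two successive uses: with weight e^(-sX) for the
    derivatives in t, then with weight Y^mD e^-Y and the sign already obtained for those in s. *)
Lemma derive1n_laplace (r : R) n (t : R) : 0 < t ->
  derive1n n (fun t => r * \int[P]_w (W w * expR (- (t * V w))))%R t =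
  r * (-1) ^+ n * (\int[P]_w (W w * V w ^+ n * expR (- (t * V w))))%R.
Proof.
have -> : (fun t => r * \int[P]_w (W w * expR (- (t * V w))))%R = (fun t => r * F 0 t).
  apply/funext => s; congr (_ * _).
  by apply: eq_Rintegral => w _; rewrite /f expr0 mulr1.
elim: n t => [|n IH] t t0; first by rewrite derive1n0 expr0 mulr1.
rewrite derive1nS (derive1_eq_gt0 IH)// -/(F n.+1 t).
have H := is_deriveZ (r * (-1) ^+ n) (derF n t0).
rewrite derive1E [LHS](@derive_val _ _ _ _ _ _ _ H) exprS /GRing.scale /=; ring.
Qed.
End laplace_derivative.

(** * Survival function of the Erlang law *)

Section Gamma_survival.
Context {R : realType}.
Local Notation mu := (@lebesgue_measure R).
Local Notation pos := (`]0%R, +oo[%classic : set R).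

Let term (k : nat) (y : R) : R := y ^+ k / k`!%:R * expR (- y).

Let fact_neq0 k : k`!%:R != 0 :> R. Proof. by rewrite pnatr_eq0 -lt0n fact_gt0. Qed.

Let continuous_term k : continuous (term k).
Proof.
move=> y; apply: cvgM; first by apply: cvgMl; exact: exprn_continuous.
by apply: continuous_comp; [exact: opp_continuous|exact: continuous_expR].
Qed.

Let derive_expRN (y : R) : is_derive y (1:R) (fun u : R => expR (- u)) (- expR (- y)).
Proof. by apply: is_derive_eq; rewrite mulrN1. Qed.

(** The derivatives of consecutive terms telescope, leaving only the last. *)
Let derive_tail n (y : R) :
  is_derive y (1:R) (fun y => - \sum_(k < n.+1) term k y) (term n y).
Proof.
elim: n => [|n IH].
  have -> : (fun y => - \sum_(k < 1) term k y) = (fun y => - expR (- y)).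
    by apply/funext => u; rewrite big_ord1 /term expr0 divr1 mul1r.
  by rewrite /term expr0 divr1 mul1r -[expR _]opprK; exact: is_deriveN.
have -> : (fun y => - \sum_(k < n.+2) term k y) =
    (fun y => - \sum_(k < n.+1) term k y) - (fun y => term n.+1 y).
  by apply/funext => u; rewrite big_ord_recr /= opprD.
have H : is_derive y (1:R) (fun y => term n.+1 y) (term n y - term n.+1 y).
  have Hp : is_derive y (1:R) (fun y : R => y ^+ n.+1) (n.+1%:R * y ^+ n).
    by apply: DeriveDef; [exact: exprn_derivable|rewrite exp_derive /GRing.scale /= mulr1].
  have -> : (fun y => term n.+1 y) = n.+1`!%:R^-1 \*: ((fun y : R => y ^+ n.+1) * (fun u => expR (- u))).
    apply/funext => u; rewrite /term; transitivity (n.+1`!%:R^-1 * (u ^+ n.+1 * expR (- u))) => //.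
    by rewrite mulrA [_^-1 * _]mulrC.
  have HM := is_deriveM Hp (derive_expRN y).
  apply: (is_derive_eq (is_deriveZ n.+1`!%:R^-1 HM)).
  rewrite /GRing.scale /= /term factS natrM.
  have := fact_neq0 n; have : n.+1%:R != 0 :> R by rewrite pnatr_eq0.
  move: (n`!%:R) (n.+1%:R) => a b b0 a0; field; rewrite ?a0 ?b0//.
apply: (is_derive_eq (is_deriveB IH H)); ring.
Qed.

Let cvg_term k : term k y @[y --> +oo] --> (0:R).
Proof.
apply/cvgrPdist_le => e e0.
near=> y.
have y0 : 0 < y by near: y; exact: nbhs_pinfty_gt.
rewrite sub0r normrN ger0_norm; last by rewrite !mulr_ge0 ?expR_ge0 ?invr_ge0 ?exprn_ge0 ?(ltW y0).
have H : term k y <= k.+1`!%:R / y.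
  have := @pow_expRN_le R 1 y k.+1 ltr01 (ltW y0); rewrite mul1r expr1n divr1 => h.
  rewrite ler_pdivlMr//; apply: le_trans h.
  rewrite /term exprS mulrAC -!mulrA [y * _]mulrC -!mulrA ler_wpM2l ?exprn_ge0 ?(ltW y0)//.
  rewrite [leRHS]mulrC ler_piMl ?mulr_ge0 ?expR_ge0 ?(ltW y0)//.
  by rewrite invf_le1 ?ler1n ?ltr0n fact_gt0.
apply: (le_trans H); rewrite ler_pdivrMr// mulrC -ler_pdivrMr//.
Unshelve. all: by end_near. Qed.

Let integral_Erlang_tail n (c : R) : 0 <= c ->
  (\int[mu]_(y in `[c, +oo[) (term n y)%:E = (\sum_(k < n.+1) term k c)%:E)%E.
Proof.
move=> c0; rewrite (@ge0_continuous_FTC2y _ _ (fun y => - \sum_(k < n.+1) term k y) _ 0)//.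
- by rewrite add0e -EFinN opprK.
- move=> y cy; rewrite !mulr_ge0 ?expR_ge0 ?invr_ge0// exprn_ge0// (le_trans c0 cy)//.
- by apply: continuous_subspaceT => u; exact: continuous_term.
- rewrite -[X in _ --> X]oppr0; apply: cvgN.
  elim: n => [|n IH].
    by under eq_fun do rewrite big_ord1; exact: cvg_term.
  under eq_fun do rewrite big_ord_recr /=.
  by rewrite -[X in nbhs X]addr0; apply: cvgD; [exact: IH|exact: cvg_term].
- by move=> y _; have [] := derive_tail n y.
- have cc : {for c, continuous (fun y => - \sum_(k < n.+1) term k y)}.
    by apply/differentiable_continuous/derivable1_diffP; have [] := derive_tail n c.
  exact: cvg_at_right_filter.
- by move=> u _; rewrite derive1E; have [_ ->] := derive_tail n u.
Qed.

(** A negative threshold acts as [0]; this is where the positive part (T - z)^+ comes from. *)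
Let integral_Erlang_level n (c : R) :
  (\int[mu]_(y in `]0%R, +oo[) ((c <= y)%R%:R * term n y)%:E =
   (\sum_(k < n.+1) term k (Num.max c 0))%:E)%E.
Proof.
have mt D : measurable_fun D (term n).
  by apply: measurable_funTS; exact: continuous_measurable_fun.
have [c0|c0] := leP c 0.
  rewrite -integral_Erlang_tail// -integral_itv_obnd_cbnd; last exact/measurable_EFinP.
  apply: eq_integral => y; rewrite inE /= in_itv /= andbT => y0.
  by rewrite (le_trans c0 (ltW y0)) mul1r.
rewrite -integral_Erlang_tail ?(ltW c0)//.
rewrite [LHS]integral_mkcond [RHS]integral_mkcond; apply: eq_integral => y _.
rewrite !patchE !mem_setE !in_itv /= !andbT.
have [cy|yc] := leP c y; first by rewrite (lt_le_trans c0 cy) mul1r.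
by case: ifPn; rewrite // mul0r.
Qed.

Variables (n : nat) (gam : probability (measurableTypeR R) R).
Hypothesis gamE : forall f : R -> \bar R, measurable_fun setT f ->
  (forall x, 0 < x -> (0 <= f x)%E) ->
  (\int[gam]_(x in pos) f x = \int[mu]_(x in pos) (f x * (gamma_pdf n.+1%:R x)%:E))%E.

Lemma gamma_pdf_nat (y : R) : 0 < y ->
  gamma_pdf n.+1%:R y = n.+1%:R * (n.+1%:R * y) ^+ n / n`!%:R * expR (- (n.+1%:R * y)).
Proof.
move=> y0; rewrite /gamma_pdf Gammaf_nat -natr1 addrK natr1 !powR_mulrn ?(ltW y0)//.
by rewrite exprMn exprS mulrAC -!mulrA.
Qed.

Lemma gamma_survival (c : R) :
  (\int[gam]_y ((c <= y)%R%:R)%:E =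
   (\sum_(k < n.+1) (n.+1%:R * Num.max c 0) ^+ k / k`!%:R * expR (- (n.+1%:R * Num.max c 0)))%:E)%E.
Proof.
have n0 : 0 < n.+1%:R :> R by [].
have mc : measurable_fun setT (fun y : R => ((c <= y)%R%:R : R)%:E).
  by apply/measurable_EFinP; apply: measurable_boolR; exact: measurable_fun_ler.
rewrite (integral_gamma_pos n0 gamE)//.
rewrite gamE//.
pose f (x : R) : \bar R := ((n.+1%:R * c <= x)%R%:R * term n x)%:E.
have mf : measurable_fun setT f.
  apply/measurable_EFinP; apply: measurable_funM; last exact: continuous_measurable_fun.
  by apply: measurable_boolR; exact: measurable_fun_ler.
have f0 x : 0 < x -> (0 <= f x)%E.
  by move=> x0; rewrite lee_fin !mulr_ge0 ?expR_ge0 ?invr_ge0 ?exprn_ge0 ?(ltW x0).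
transitivity (\int[mu]_(x in pos) (n.+1%:R%:E * f (n.+1%:R * x)%R))%E.
  apply: eq_integral => y; rewrite inE /= in_itv /= andbT => y0.
  rewrite gamma_pdf_nat// /f -!EFinM ler_pM2l// /term; congr EFin; ring.
rewrite ge0_integralZl//; last 2 first.
- apply: measurable_funTS; apply: (measurableT_comp mf); exact: mulrl_measurable.
- by move=> x; rewrite /= in_itv /= andbT => x0; apply: f0; rewrite mulr_gt0.
rewrite ge0_integral_scale// muleA -EFinM mulfV ?lt0r_neq0// mul1e.
rewrite integral_Erlang_level; congr (\sum_(k < _) _)%:E.
by rewrite maxr_pMr ?mulr0// ltW.
Qed.

(** After y = b z the Jacobian [b] completes the power in the density to (mD z b)^mD / z, whence the
    factor [z^-1]; the threshold becomes a (T - z), and a > 0 comes out of the positive part. *)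
Lemma mrc_kernel (a b T : R) : 0 < a -> 0 < b ->
  (\int[gam]_y (\sum_(k < n.+1) (n.+1%:R * Num.max (a * (T - y / b)) 0) ^+ k / k`!%:R *
      expR (- (n.+1%:R * Num.max (a * (T - y / b)) 0)))%:E =
   \int[mu]_(z in pos) (\sum_(k < n.+1) (k`!%:R * n`!%:R)^-1 * (z^-1 *
      ((n.+1%:R * Num.max (T - z) 0 * a) ^+ k * (n.+1%:R * z * b) ^+ n.+1 *
       expR (- (n.+1%:R * Num.max (T - z) 0 * a + n.+1%:R * z * b)))))%:E)%E.
Proof.
move=> a0 b0.
have n0 : 0 < n.+1%:R :> R by [].
pose X (y : R) : R := n.+1%:R * Num.max (a * (T - y / b)) 0.
have X0 y : 0 <= X y by rewrite mulr_ge0// le_max lexx orbT.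
have mX : measurable_fun setT X.
  apply: measurable_funM => //; apply: measurable_maxr => //.
  by apply: measurable_funM => //; apply: measurable_funB => //; exact: measurable_funM.
pose G (y : R) : R := \sum_(k < n.+1) X y ^+ k / k`!%:R * expR (- X y).
have G0 y : 0 <= G y by apply: sumr_ge0 => k _; rewrite !mulr_ge0 ?expR_ge0 ?invr_ge0 ?exprn_ge0.
have mG : measurable_fun setT G.
  apply: measurable_sum => k; apply: measurable_funM.
    by apply: measurable_funM => //; exact: measurable_funX.
  by apply: measurableT_comp => //; exact: measurable_funN.
have mGE : measurable_fun setT (EFin \o G) by exact/measurable_EFinP.
rewrite (integral_gamma_pos n0 gamE)//.
rewrite gamE//; last by move=> y _; rewrite lee_fin; exact: G0.
pose F (y : R) : \bar R := (G y * gamma_pdf n.+1%:R y)%:E.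
have mF : measurable_fun setT F.
  by apply/measurable_EFinP; apply: measurable_funM => //; exact: measurable_gamma_pdf.
have F0 y : (0 <= F y)%E by rewrite lee_fin mulr_ge0// gamma_pdf_ge0.
transitivity (\int[mu]_(y in pos) F y)%E; first by [].
have := @ge0_integral_scale R b F b0 mF (fun y _ => F0 y).
move/(congr1 (fun z => b%:E * z)%E); rewrite muleA -EFinM mulfV ?lt0r_neq0// mul1e => <-.
rewrite -ge0_integralZl//; last 2 first.
- by apply: measurable_funTS; apply: (measurableT_comp mF); exact: mulrl_measurable.
- by rewrite lee_fin ltW.
apply: eq_integral => z; rewrite inE /= in_itv /= andbT => z0.
have bz : 0 < b * z by rewrite mulr_gt0.
rewrite /F -EFinM gamma_pdf_nat// /G mulr_suml mulr_sumr; congr EFin; apply: eq_bigr => k _.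
have -> : X (b * z) = n.+1%:R * Num.max (T - z) 0 * a.
  rewrite /X [b * z]mulrC mulfK ?lt0r_neq0// -mulrA; congr (_ * _).
  by rewrite [RHS]mulrC maxr_pMr ?mulr0// ltW.
have -> : n.+1%:R * (b * z) = n.+1%:R * z * b by ring.
rewrite opprD expRD exprS.
have := fact_neq0 n; have := fact_neq0 k; have := lt0r_neq0 z0; have := lt0r_neq0 b0.
set N : R := n.+1%:R; set E1 := expR _; set E2 := expR _; set A := (_ * a) ^+ k; set B := (N * z * b) ^+ n.
move: (n`!%:R) (k`!%:R) @A @B @E1 @E2; move: N => N c1 c2 A B E1 E2 b1 z1 c20 c10.
by field; rewrite ?b1 ?z1 ?c20 ?c10.
Qed.
End Gamma_survival.

(** * Interference *)

Section measurability.
Context {R : realType} {d : measure_display} {T : measurableType d}.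

Lemma limn_ereal_dichotomy (u : nat -> \bar R) :
  limn u = if limn_einf u == limn_esup u then limn_esup u else point.
Proof.
case: ifPn => [/eqP h|h]; last first.
  by apply: dvgP => /cvg_ex[l ul]; move: h; have [-> ->] := cvg_limn_einf_sup ul; rewrite eqxx.
apply: cvg_lim => //; apply: (@squeeze_cvge _ _ _ _ (einfs u) _ (esups u)).
- apply: nearW => n; apply/andP; split.
    by apply: ereal_inf_lbound; exists n => //=.
  by apply: ereal_sup_ubound; exists n => //=.
- by rewrite -h limn_einf_lim; exact: is_cvg_einfs.
- by rewrite limn_esup_lim; exact: is_cvg_esups.
Qed.

(* Off its set of convergence [limn] takes a fixed junk value, so no convergence is needed. *)
Lemma measurable_fun_limn_ereal (u : nat -> T -> \bar R) :
  (forall n, measurable_fun setT (u n)) ->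
  measurable_fun setT (fun w => limn (u ^~ w)).
Proof.
move=> mu.
have ms : measurable_fun setT (fun w => limn_esup (u ^~ w)).
  exact: measurable_fun_limn_esup.
have mi : measurable_fun setT (fun w => limn_einf (u ^~ w)).
  rewrite /limn_einf; apply: measurableT_comp => //.
  apply: (@measurable_fun_limn_esup _ _ _ _ (fun n w => - u n w)%E) => n.
  exact: measurableT_comp.
under eq_fun do rewrite limn_ereal_dichotomy.
by apply: measurable_fun_ifT => //; exact: measurable_fun_eqe.
Qed.

Lemma measurable_invr : measurable_fun setT (fun y : R => y^-1).
Proof.
have -> : (fun y : R => y^-1) = (fun y => if 0 <= y then y `^ (-1) else - (- y) `^ (-1)).
  apply/funext => y; case: ifPn => y0; first by rewrite powR_inv1.
  by rewrite powR_inv1 ?invrN ?opprK// oppr_ge0 ltW// ltNge.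
apply: measurable_fun_ifT.
- exact: measurable_fun_ler.
- exact: measurable_powRl.
- apply: measurableT_comp => //; apply: (measurableT_comp (measurable_powRl _)).
  exact: measurable_funN.
Qed.

Lemma measurable_interf (dist alpha : R) (x : nat -> T -> R * R) (k : nat -> T -> R) :
  (forall i, measurable_fun setT (x i)) -> (forall i, measurable_fun setT (k i)) ->
  measurable_fun setT (interf dist alpha x k).
Proof.
move=> mx mk; apply: measurable_funeM.
apply: measurable_fun_limn_ereal => N; under eq_fun do rewrite big_mkord.
apply: emeasurable_sum => i; apply/measurable_EFinP; apply: measurable_funM => //.
apply: (measurableT_comp (measurable_powRl _)).
exact: (measurableT_comp measurable_norm2).
Qed.

(* A positive finite version of the interference: negative fading gains and the
   values [0] and [+oo] only occur on a null set. *)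
Definition shot (dist alpha : R) (x : nat -> T -> R * R) (k : nat -> T -> R) (w : T) : R :=
  let r := fine (interf dist alpha x (fun i w => Num.max (k i w) 0) w) in
  if 0 < r then r else 1.

Lemma shot_gt0 dist alpha x k w : 0 < shot dist alpha x k w.
Proof. by rewrite /shot; case: ifPn. Qed.

Lemma measurable_shot (dist alpha : R) (x : nat -> T -> R * R) (k : nat -> T -> R) :
  (forall i, measurable_fun setT (x i)) -> (forall i, measurable_fun setT (k i)) ->
  measurable_fun setT (shot dist alpha x k).
Proof.
move=> mx mk.
have mf : measurable_fun setT (fun w => fine (interf dist alpha x (fun i w => Num.max (k i w) 0) w)).
  apply: measurableT_comp; first exact: fine_measurable.
  by apply: measurable_interf => // i; exact: measurable_maxr.
by apply: measurable_fun_ifT => //; exact: measurable_fun_ltr.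
Qed.
End measurability.

Lemma measurable_prod_seq (R : realType) (d : measure_display) (T : measurableType d)
  (I : eqType) (s : seq I) (h : I -> T -> R) :
  (forall i, i \in s -> measurable_fun setT (h i)) ->
  measurable_fun setT (fun w => \prod_(i <- s) h i w).
Proof.
elim: s => [|i s IH] mh; first by under eq_fun do rewrite big_nil; exact: measurable_cst.
under eq_fun do rewrite big_cons; apply: measurable_funM; first by apply: mh; rewrite mem_head.
by apply: IH => j js; apply: mh; rewrite in_cons js orbT.
Qed.

Lemma ord2P (n : 'I_2) : n = ord0 \/ n = ord_max.
Proof. by case: n => [[|[|//]] ?]; [left|right]; exact: val_inj. Qed.

Lemma integral_eq_off_null (R : realType) (d : measure_display) (T : measurableType d)
  (mu : {measure set T -> \bar R}) (N : set T) (f g : T -> R) :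
  measurable N -> mu N = 0%E -> measurable_fun setT f -> measurable_fun setT g ->
  (forall w, 0 <= f w) -> (forall w, 0 <= g w) -> (forall w, ~ N w -> f w = g w) ->
  (\int[mu]_w (f w)%:E = \int[mu]_w (g w)%:E)%E.
Proof.
move=> mN N0 mf mg f0 g0 fg.
rewrite (ge0_negligible_integral mN)//; last first.
- by move=> w _; rewrite lee_fin.
- exact/measurable_EFinP.
rewrite [RHS](ge0_negligible_integral mN)//; last first.
- by move=> w _; rewrite lee_fin.
- exact/measurable_EFinP.
by apply: eq_integral => w /set_mem[_ Nw]; rewrite fg.
Qed.

(** Convertible with the family in the independence hypothesis of the theorem. *)
Definition mark_sets {R : realType} {d : measure_display} {Omega : measurableType d}
  (x : nat -> Omega -> R * R) (g : 'I_2 -> Omega -> R) (h : 'I_2 -> nat -> Omega -> R)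
  (o : option ('I_2 + ('I_2 * nat))) : set (set Omega) :=
  match o with
  | None => sigma_pp x
  | Some (inl n) => sigma_rv (g n)
  | Some (inr (n, i)) => sigma_rv (h n i)
  end.

Section model.
Context {R : realType} {d : measure_display} {Omega : measurableType d}.
Variables (P : probability Omega R) (lam dist alpha mI : R) (x : nat -> Omega -> R * R)
  (g : 'I_2 -> Omega -> R) (h : 'I_2 -> nat -> Omega -> R).
Hypotheses (lam0 : 0 < lam) (dist0 : 0 < dist) (alpha2 : 2 < alpha) (mI0 : 0 < mI).
Hypothesis HP : is_PPP P lam x.
Hypothesis mg : forall n, measurable_fun setT (g n).
Hypothesis hlaw : forall n i, gamma_law P mI (h n i).
Local Notation F := (mark_sets x g h).
Hypothesis indF : mutually_indep P F.

Let mx i : measurable_fun setT (x i). Proof. exact: HP.1. Qed.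
Let mh n i : measurable_fun setT (h n i). Proof. exact: (hlaw n i).1. Qed.

Lemma mark_sigma_algebra o : sigma_algebra setT (F o).
Proof. by case: o => [[n|[n i]]|]; exact: smallest_sigma_algebra. Qed.

Lemma mark_sigma_measurable o : F o `<=` measurable.
Proof.
have H (G : set (set Omega)) : G `<=` measurable -> <<s G >> `<=` measurable.
  by move=> GM; apply: smallest_sub => //; exact: sigma_algebra_measurable.
by case: o => [[n|[n i]]|]; apply: H => E; [move=> [B [mB ->]]|move=> [B [mB ->]]|move=> [i [B [mB ->]]]];
  rewrite -[X in measurable X]setTI; [exact: mg|exact: mh|exact: mx].
Qed.

Let Fh j (B : set R) : measurable B -> F (Some (inr j)) (h j.1 j.2 @^-1` B).
Proof. by case: j => n i mB; apply: sub_sigma_algebra; exists B. Qed.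
Let Fx i (B : set (R * R)) : measurable B -> F None (x i @^-1` B).
Proof. by move=> mB; apply: sub_sigma_algebra; exists i, B. Qed.

Let mhR n i : measurable_fun setT (h n i : Omega -> measurableTypeR R). Proof. exact: mh. Qed.
Let gam n i : probability (measurableTypeR R) R := image_prob P (mhR n i).
Let pos : set R := `]0%R, +oo[%classic.

Let gamE n i (f : R -> \bar R) : measurable_fun setT f ->
  (forall x, 0 < x -> (0 <= f x)%E) ->
  (\int[gam n i]_(x in pos) f x = \int[lebesgue_measure]_(x in pos) (f x * (gamma_pdf mI x)%:E))%E.
Proof.
apply: (integral_density (measurable_gamma_pdf mI) (gamma_pdf_ge0 mI0)) => B mB.
exact: (hlaw n i).2.
Qed.

Let c : R := dist `^ alpha.
Let c0 : 0 < c. Proof. exact: powR_gt0. Qed.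
Let k n i w : R := Num.max (h n i w) 0.
Let k0 n i w : 0 <= k n i w. Proof. by rewrite le_max lexx orbT. Qed.
Let L := gamma_laplace mI.
(** The rate that multiplies, in the exponent, the mark of point [j.2] in branch [j.1]. *)
Let co (u v : R) (j : 'I_2 * nat) (w : Omega) : R :=
  (if j.1 == ord0 then u else v) * c * norm2 (x j.2 w) `^ (- alpha).

Let co_ge0 u v j w : 0 <= u -> 0 <= v -> 0 <= co u v j w.
Proof. by move=> u0 v0; rewrite /co; case: ifPn => _; rewrite !mulr_ge0 ?powR_ge0// ltW. Qed.

Let mco u v j i0 : i0 != None ->
  measurable_fun setT (co u v j : g_sigma_algebraType (other_sets F i0) -> R).
Proof.
move=> i0N; apply: measurable_funM => //; apply: (measurableT_comp (measurable_powRl _)).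
apply: (measurableT_comp measurable_norm2).
by apply: (measurable_others (i := None)); [rewrite eq_sym|exact: Fx].
Qed.

(** One mark at a time: the gain indexed by [j] is independent of all the rest, and since [j] is not
    in [J] the remaining product is measurable for the other variables, so the gain is integrated
    out with the positions frozen. [K] holds the factors already averaged. *)
Let mark_average u v (J K : seq ('I_2 * nat)) : 0 <= u -> 0 <= v -> uniq J ->
  (\int[P]_w ((\prod_(j <- J) expR (- (co u v j w * k j.1 j.2 w))) * \prod_(j <- K) L (co u v j w))%:E =
   \int[P]_w ((\prod_(j <- J) L (co u v j w)) * \prod_(j <- K) L (co u v j w))%:E)%E.
Proof.
move=> u0 v0; elim: J K => [|j J IH] K.
  by move=> _; apply: eq_integral => w _; rewrite !big_nil.
move=> /= /andP[jJ uJ].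
have L0 j' w : 0 < L (co u v j' w) by apply: gamma_laplace_gt0 => //; exact: co_ge0.
pose i0 : option ('I_2 + ('I_2 * nat)) := Some (inr j).
pose A w : R := \prod_(j <- J) expR (- (co u v j w * k j.1 j.2 w)) * \prod_(j <- K) L (co u v j w).
have A0 w : 0 <= A w.
  by rewrite mulr_ge0//; apply: prodr_ge0 => i _; [exact: expR_ge0|exact: ltW].
pose f w (y : R) : \bar R := (expR (- (co u v j w * Num.max y 0)) * A w)%:E.
have mA : measurable_fun setT (A : g_sigma_algebraType (other_sets F i0) -> R).
  apply: measurable_funM; apply: measurable_prod_seq => j' j'J; last first.
    by apply: (measurableT_comp (@measurable_gamma_laplace R mI)); exact: mco.
  apply: measurableT_comp => //; apply: measurableT_comp => //.
  apply: measurable_funM; first exact: mco.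
  apply: measurable_maxr => //; apply: (measurable_others (i := Some (inr j'))); last exact: Fh.
  by apply: contraNneq jJ => -[<-].
have mf : measurable_fun setT (fun p : g_sigma_algebraType (other_sets F i0) * measurableTypeR R => f p.1 p.2).
  apply/measurable_EFinP; apply: measurable_funM; last exact: (measurableT_comp mA).
  apply: measurableT_comp => //; apply: measurableT_comp => //.
  apply: measurable_funM; first by apply: (measurableT_comp (@mco u v j i0 _)).
  exact: measurable_maxr.
transitivity (\int[P]_w f w (h j.1 j.2 w))%E.
  by apply: eq_integral => w _; rewrite big_cons -mulrA.
rewrite (indep_fubini mark_sigma_algebra mark_sigma_measurable indF (mhR j.1 j.2) (Fh j) mf); last first.
  by move=> w y; rewrite lee_fin mulr_ge0// expR_ge0.
transitivity (\int[P]_w (\prod_(j <- J) expR (- (co u v j w * k j.1 j.2 w)) *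
    \prod_(j <- j :: K) L (co u v j w))%:E)%E; last first.
  by rewrite IH//; apply: eq_integral => w _; rewrite !big_cons; congr EFin; ring.
apply: eq_integral => w _; rewrite big_cons mulrCA [in RHS]EFinM.
rewrite -/(gam j.1 j.2).
rewrite (integral_gamma_pos mI0 (@gamE j.1 j.2)); last 2 first.
- rewrite /f; move: (A w) (co u v j w) => a b.
  apply/measurable_EFinP; apply: measurable_funM => //; apply: measurableT_comp => //.
  apply: measurableT_comp => //; apply: measurable_funM => //; exact: measurable_maxr.
- by move=> y; rewrite lee_fin mulr_ge0// expR_ge0.
rewrite -(integral_gamma_exp mI0 (@gamE j.1 j.2)); last exact: co_ge0.
rewrite -integralZr_EFin//.
- by apply: eq_integral => y; rewrite inE /= in_itv /= andbT => y0; rewrite /f (max_idPl (ltW y0)).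
- apply: measurableT_comp => //; apply: measurableT_comp => //; exact: measurable_funM.
- exact: (A0 w).
Qed.

(** The contribution of a point at [p] averaged over its two marks, one for each branch. *)
Let psi u v (p : R * R) : R :=
  L (u * c * norm2 p `^ (- alpha)) * L (v * c * norm2 p `^ (- alpha)).
Let S n N w : R := \sum_(i < N) k n i w * norm2 (x i w) `^ (- alpha).

Let partial_laplace u v N : 0 <= u -> 0 <= v ->
  (\int[P]_w (expR (- (u * c * S ord0 N w + v * c * S ord_max N w)))%:E =
   \int[P]_w (\prod_(i < N) psi u v (x i w))%:E)%E.
Proof.
move=> u0 v0.
pose J : seq ('I_2 * nat) := [seq (ord0, i) | i <- iota 0 N] ++ [seq (ord_max, i) | i <- iota 0 N].
have uJ : uniq J.
  rewrite cat_uniq !map_inj_uniq ?iota_uniq ?andbT//; try by move=> ? ? [].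
  by apply/hasPn => _ /mapP[i _ ->]; apply/negP => /mapP[].
have bigJ (G : 'I_2 * nat -> R) :
    \prod_(j <- J) G j = \prod_(i < N) (G (ord0, nat_of_ord i) * G (ord_max, nat_of_ord i)).
  rewrite big_cat /= !big_map big_split /=.
  rewrite -(big_mkord xpredT (fun i => G (ord0, i))) -(big_mkord xpredT (fun i => G (ord_max, i))).
  by rewrite /index_iota subn0.
have := @mark_average u v J [::] u0 v0 uJ.
under eq_integral do rewrite big_nil mulr1; under [in RHS]eq_integral do rewrite big_nil mulr1.
move=> H; transitivity (\int[P]_w (\prod_(j <- J) expR (- (co u v j w * k j.1 j.2 w)))%:E)%E.
  apply: eq_integral => w _; rewrite bigJ /S !mulr_sumr -big_split -sumrN expR_sum; congr EFin.
  by apply: eq_bigr => i _; rewrite -expRD /co /=; congr expR; ring.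
by rewrite H; apply: eq_integral => w _; rewrite bigJ.
Qed.

Let psi_gt0 u v p : 0 <= u -> 0 <= v -> 0 < psi u v p.
Proof.
by move=> u0 v0; rewrite mulr_gt0// gamma_laplace_gt0// !mulr_ge0 ?powR_ge0// ltW.
Qed.

Let psi_le1 u v p : 0 <= u -> 0 <= v -> psi u v p <= 1.
Proof.
move=> u0 v0; have A r : 0 <= r -> 0 <= r * c * norm2 p `^ (- alpha).
  by move=> r0; rewrite !mulr_ge0 ?powR_ge0// ltW.
by rewrite mulr_ile1 ?gamma_laplace_le1 ?A// ltW// gamma_laplace_gt0// A.
Qed.

Let mpsi u v : measurable_fun setT (psi u v).
Proof.
apply: measurable_funM; apply: (measurableT_comp (@measurable_gamma_laplace R mI));
apply: measurable_funM => //; apply: (measurableT_comp (measurable_powRl _));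
exact: measurable_norm2.
Qed.

Let de : R := 2 / alpha.
Let kap : R := pi * Gammaf (1 - de) * c `^ de.

(** The Laplace functional is applied to -ln psi, nonnegative because 0 < psi <= 1. The moment is a
    parameter [M], as its closed form changes when a weight vanishes; [gam ord0 0] represents all
    marks, whose densities coincide. *)
Let cvg_partial_laplace u v (M : R) : 0 <= u -> 0 <= v -> 0 < u + v ->
  (\int[gam ord0 0 \x gam ord0 0]_(q in pos `*` pos) ((u * q.1 + v * q.2) `^ de)%:E = M%:E)%E ->
  (\int[P]_w (expR (- (u * c * S ord0 N w + v * c * S ord_max N w)))%:E)%E
    @[N --> \oo] --> (expR (- (lam * (kap * M))))%:E.
Proof.
move=> u0 v0 uv ME.
have fC : (\int[leb2]_p (1 - expR (- (- ln (psi u v p))))%:E = (kap * M)%:E)%E.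
  rewrite EFinM -ME -(shot_noise_exponent mI0 (@gamE ord0 0%N) u0 v0 uv c0 alpha2).
  by apply: eq_integral => p _; rewrite opprK lnK// posrE psi_gt0.
have mf : measurable_fun setT (fun p => - ln (psi u v p)).
  by apply: measurableT_comp => //; apply: measurableT_comp.
have f0 p : 0 <= - ln (psi u v p) by rewrite oppr_ge0 ln_le0// psi_le1.
have := laplace_PPP HP mf f0 fC; apply: cvg_trans; apply: near_eq_cvg; apply: nearW => N.
rewrite partial_laplace//; apply: eq_integral => w _; rewrite -sumrN expR_sum; congr EFin.
by apply: eq_bigr => i _; rewrite opprK lnK// posrE psi_gt0.
Qed.

Let de01 : 0 < de < 1.
Proof.
have a0 : 0 < alpha by apply: lt_trans alpha2.
by rewrite divr_gt0//= ltr_pdivrMr// mul1r.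
Qed.
Let de_gt0 : 0 < de. Proof. by case/andP: de01. Qed.

Let kap_gt0 : 0 < kap.
Proof.
apply: mulr_gt0; last exact: powR_gt0.
by apply: mulr_gt0; [exact: pi_gt0|apply: Gammaf_gt0; rewrite subr_gt0; case/andP: de01].
Qed.

(** * Almost sure finiteness and positivity of the interference *)

Let In n w : \bar R := interf dist alpha x (k n) w.

Let mk n i : measurable_fun setT (k n i). Proof. exact: measurable_maxr. Qed.
Let mIn n : measurable_fun setT (In n). Proof. exact: measurable_interf. Qed.

Let nterm_ge0 n i w : (0 <= (k n i w * norm2 (x i w) `^ (- alpha))%:E)%E.
Proof. by rewrite lee_fin mulr_ge0 ?powR_ge0. Qed.

Let In_ge0 n w : (0 <= In n w)%E.
Proof.
by rewrite mule_ge0//; [rewrite lee_fin powR_ge0|apply: nneseries_ge0 => i _ _; exact: nterm_ge0].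
Qed.

Let cvg_S n w : (c * S n N w)%:E @[N --> \oo] --> In n w.
Proof.
have H : (S n N w)%:E @[N --> \oo] --> (\sum_(i <oo) (k n i w * norm2 (x i w) `^ (- alpha))%:E)%E.
  have := @is_cvg_nneseries R (fun i => (k n i w * norm2 (x i w) `^ (- alpha))%:E) xpredT 0
    (fun i _ _ => nterm_ge0 n i w).
  by apply: cvg_trans; apply: near_eq_cvg; apply: nearW => N; rewrite big_mkord sumEFin.
by under eq_fun do rewrite EFinM; exact: cvgeZl.
Qed.

Let fin w := (In ord0 w < +oo)%E && (In ord_max w < +oo)%E.
Let fI n w := fine (In n w).

Let cvg_S_fin n w : (In n w < +oo)%E -> c * S n N w @[N --> \oo] --> fI n w.
Proof.
move=> Inw; have := @cvg_S n w; rewrite -[X in _ --> X]fineK; first exact: fine_cvg.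
by rewrite ge0_fin_numE.
Qed.

Let S_ge0 n N w : 0 <= S n N w.
Proof. by apply: sumr_ge0 => i _; rewrite mulr_ge0 ?powR_ge0. Qed.

Let mS n N : measurable_fun setT (S n N).
Proof.
apply: measurable_sum => i; apply: measurable_funM => //.
by apply: (measurableT_comp (measurable_powRl _)); exact: (measurableT_comp measurable_norm2).
Qed.

Let mexp u v N :
  measurable_fun setT (fun w => expR (- (u * c * S ord0 N w + v * c * S ord_max N w))).
Proof.
apply: measurableT_comp => //; apply: measurableT_comp => //.
by apply: measurable_funD; exact: measurable_funM.
Qed.

Let mfI n : measurable_fun setT (fI n).
Proof. by apply: measurableT_comp => //; exact: fine_measurable. Qed.

Let mexpI u v : measurable_fun setT (fun w => expR (- (u * fI ord0 w + v * fI ord_max w))).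
Proof.
apply: measurableT_comp => //; apply: measurableT_comp => //.
by apply: measurable_funD; exact: measurable_funM.
Qed.

Let cvg_exp_fin u v w : fin w ->
  expR (- (u * c * S ord0 N w + v * c * S ord_max N w)) @[N --> \oo] -->
  expR (- (u * fI ord0 w + v * fI ord_max w)).
Proof.
move=> /andP[h0 h1]; apply: (@continuous_cvg _ _ _ _ _ _ (fun y => expR (- y))).
  by apply: continuous_comp; [exact: opp_continuous|exact: continuous_expR].
apply: cvgD; under eq_fun do rewrite -mulrA; apply: cvgMr; exact: cvg_S_fin.
Qed.

(** Both weights are the same positive [r], so divergence in either branch suffices. *)
Let cvg_exp_oo r w : 0 < r -> ~~ fin w ->
  expR (- (r * c * S ord0 N w + r * c * S ord_max N w)) @[N --> \oo] --> (0 : R).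
Proof.
move=> r0 nf.
have H n : ~~ (In n w < +oo)%E -> c * S n N w @[N --> \oo] --> +oo.
  rewrite ltey negbK => /eqP In_oo; apply/cvgeryP.
  by have := @cvg_S n w; rewrite In_oo.
have {}H : r * c * S ord0 N w + r * c * S ord_max N w @[N --> \oo] --> +oo.
  have H' n : c * S n N w @[N --> \oo] --> +oo ->
      r * c * S n N w @[N --> \oo] --> +oo.
    move/cvgryPge => hn; apply/cvgryPge => A; apply: filterS (hn (A / r)) => N.
    by rewrite ler_pdivrMr// mulrC mulrA.
  have rc N n : 0 <= r * c * S n N w by rewrite !mulr_ge0 ?(ltW r0) ?(ltW c0).
  move: nf; rewrite negb_and => /orP[/H/H'|/H/H']; apply: ger_cvgy; apply: nearW => N.
    by rewrite lerDl.
  by rewrite lerDr.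
exact: (cvg_comp _ _ H (@cvgr_expR R)).
Qed.

Let mfin : measurable [set w | fin w].
Proof.
have -> : [set w | fin w] = (fun w => fin w) @^-1` [set true].
  by apply/seteqP; split => w /=; case: (fin w).
have mb : measurable_fun setT fin by apply: measurable_and; exact: measurable_fun_lte.
by rewrite -[X in measurable X]setTI; exact: mb.
Qed.

Let exp01 (y : R) : 0 <= y -> 0 <= expR (- y) <= 1.
Proof. by move=> y0; rewrite expR_ge0 -expR0 ler_expR oppr_le0. Qed.

Let fI_ge0 n w : 0 <= fI n w. Proof. exact: fine_ge0. Qed.

(** Off the event the exponential tends to 0, so the limit of the transforms is an expectation over
    the event, hence at most its probability. *)
Let fin_lower r M : 0 < r ->
  (\int[gam ord0 0 \x gam ord0 0]_(q in pos `*` pos) ((r * q.1 + r * q.2) `^ de)%:E = M%:E)%E ->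
  ((expR (- (lam * (kap * M))))%:E <= P [set w | fin w])%E.
Proof.
move=> r0 ME; have r0' := ltW r0.
pose Z w : R := \1_[set w | fin w] w * expR (- (r * fI ord0 w + r * fI ord_max w)).
have mZ : measurable_fun setT Z by apply: measurable_funM => //; exact: measurable_indic.
have cvZ : (\int[P]_w (expR (- (r * c * S ord0 N w + r * c * S ord_max N w)))%:E)%E
    @[N --> \oo] --> (\int[P]_w (Z w)%:E)%E.
  apply: (@dominated_convergence_EFin _ _ _ P setT measurableT _ _ (fun=> 1)) => //.
  - move=> w _; rewrite /Z indicE; case: (boolP (fin w)) => fw.
      by rewrite mem_set// mul1r; exact: cvg_exp_fin.
    by rewrite memNset /=; [rewrite mul0r; exact: cvg_exp_oo|exact/negP].
  - move=> N w _; rewrite ger0_norm ?expR_ge0//.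
    have := @exp01 (r * c * S ord0 N w + r * c * S ord_max N w) _.
    by case/(_ _)/andP => //; rewrite addr_ge0// !mulr_ge0// ltW.
  - by rewrite integral_cst//= mul1e probability_setT ltry.
have E : (\int[P]_w (Z w)%:E)%E = (expR (- (lam * (kap * M))))%:E.
  by apply: (cvg_unique _ cvZ (cvg_partial_laplace r0' r0' (addr_gt0 r0 r0) ME)).
rewrite -E; apply: (@le_trans _ _ (\int[P]_w (\1_[set w | fin w] w)%:E)%E).
  apply: le_integral_EFin => // w _; rewrite /Z; have /andP[e0 e1] := @exp01 (r * fI ord0 w + r * fI ord_max w)
    (addr_ge0 (mulr_ge0 r0' (fI_ge0 _ _)) (mulr_ge0 r0' (fI_ge0 _ _))).
  by rewrite mulr_ge0 ?indicE//= ler_piMr.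
by rewrite integral_indic// setIT.
Qed.

(** The argument of the transform tends to 0, in the quantitative form e^-s >= 1 - s. The choice of
    [r] makes r^de = y/(B + 1), so that the exponent is at most [y]; the absolute value in [B]
    avoids discussing the sign of the hypergeometric factor. *)
Let P_fin : P [set w | fin w] = 1%E.
Proof.
pose K2 : R := mI `^ (- de) * Gammaf (2 * mI + de) * hyp2F1reg (- de) mI (2 * mI) 0.
pose B : R := `|lam * (kap * K2)|.
have B0 : 0 < B + 1 by rewrite ltr_wpDl// /B normr_ge0.
have key y : 0 < y -> ((1 - y)%:E <= P [set w | fin w])%E.
  move=> y0; have yB : 0 < y / (B + 1) by rewrite divr_gt0.
  pose r := (y / (B + 1)) `^ de^-1.
  have r0 : 0 < r by rewrite powR_gt0.
  have rE : r `^ de = y / (B + 1) by rewrite -powRrM mulVf ?lt0r_neq0// powRr1// ltW.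
  have := Gamma_pair_powR_moment mI0 de01 (@gamE ord0 0%N) r0 r0.
  rewrite divff ?lt0r_neq0// subrr rE => /(fin_lower r0); apply: le_trans.
  rewrite lee_fin; apply: le_trans (expR_ge1Dx _); rewrite lerD2l lerN2.
  apply: (@le_trans _ _ (B * (y / (B + 1)))).
    rewrite [leLHS](_ : _ = lam * (kap * K2) * (y / (B + 1))); last by rewrite /K2; ring.
    by rewrite ler_wpM2r ?ler_norm// ltW.
  by rewrite mulrCA ler_piMr ?(ltW y0)// ler_pdivrMr// mul1r lerDl.
apply/eqP; rewrite eq_le probability_le1//=.
rewrite -(fineK (fin_num_measure P _ mfin)) lee_fin; apply/ler_addgt0Pr => y y0.
by rewrite -lerBlDr -lee_fin (fineK (fin_num_measure P _ mfin)) key.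
Qed.

Let P_nfin : P (~` [set w | fin w]) = 0%E.
Proof. by rewrite probability_setC// P_fin subee. Qed.

Let integral_fin (f : Omega -> R) : measurable_fun setT f -> (forall w, 0 <= f w) ->
  (\int[P]_w (f w)%:E = \int[P]_(w in [set w | fin w]) (f w)%:E)%E.
Proof.
move=> mf f0; rewrite (ge0_negligible_integral (measurableC mfin))//.
- by rewrite setTD setCK.
- exact/measurable_EFinP.
- by move=> w _; rewrite lee_fin.
Qed.

(** [fI] reads an infinite interference as [0], which would falsify the limit, so it is taken on the
    event of finite interference, of full probability. *)
Let laplace_fI u v M : 0 <= u -> 0 <= v -> 0 < u + v ->
  (\int[gam ord0 0 \x gam ord0 0]_(q in pos `*` pos) ((u * q.1 + v * q.2) `^ de)%:E = M%:E)%E ->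
  (\int[P]_w (expR (- (u * fI ord0 w + v * fI ord_max w)))%:E = (expR (- (lam * (kap * M))))%:E)%E.
Proof.
move=> u0 v0 uv ME; rewrite integral_fin//.
apply: (cvg_unique _ _ (cvg_partial_laplace u0 v0 uv ME)) => //.
rewrite (_ : (fun N => _) = (fun N => \int[P]_(w in [set w | fin w])
  (expR (- (u * c * S ord0 N w + v * c * S ord_max N w)))%:E)%E); last first.
  by apply/funext => N; rewrite integral_fin.
apply: (@dominated_convergence_EFin _ _ _ P [set w | fin w] mfin _ _ (fun=> 1)) => //.
- by move=> w fw; exact: cvg_exp_fin.
- move=> N w _; rewrite ger0_norm ?expR_ge0//.
  have := @exp01 (u * c * S ord0 N w + v * c * S ord_max N w) _.
  by case/(_ _)/andP => //; rewrite addr_ge0// !mulr_ge0// ltW.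
- by rewrite integral_cst//= mul1e P_fin ltry.
Qed.

Let laplace_fI1 n u : 0 < u ->
  (\int[P]_w (expR (- (u * fI n w)))%:E =
   (expR (- (lam * (kap * (u `^ de * mI `^ (- de) * (Gammaf (mI + de) / Gammaf mI))))))%:E)%E.
Proof.
move=> u0; have [->|->] := ord2P n.
- have uv : 0 < u + 0 by rewrite addr0.
  rewrite -(laplace_fI (ltW u0) (lexx 0) uv (Gamma_powR_momentl mI0 de01 (@gamE ord0 0%N) u0)).
  by apply: eq_integral => w _; rewrite mul0r addr0.
- have uv : 0 < 0 + u by rewrite add0r.
  rewrite -(laplace_fI (lexx 0) (ltW u0) uv (Gamma_powR_moment mI0 de01 (@gamE ord0 0%N) u0)).
  by apply: eq_integral => w _; rewrite mul0r add0r.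
Qed.

Let zero n : set Omega := [set w | fI n w <= 0].
Let mzero n : measurable (zero n).
Proof. exact: measurable_le_set. Qed.

(** The probability is at most E e^(-u I) for every positive [u], and the closed form of this
    transform tends to 0 as [u] grows; [u] is chosen to make the exponent equal to [y]. *)
Let P_zero n : P (zero n) = 0%E.
Proof.
pose B : R := lam * (kap * (mI `^ (- de) * (Gammaf (mI + de) / Gammaf mI))).
have B0 : 0 < B.
  apply: mulr_gt0 => //; apply: mulr_gt0 => //; apply: mulr_gt0; first exact: powR_gt0.
  by apply: divr_gt0; apply: Gammaf_gt0 => //; exact: addr_gt0.
have key (y : R) : 0 < y -> (P (zero n) <= (expR (- y))%:E)%E.
  move=> y0; have yB : 0 < y / B by rewrite divr_gt0.
  pose u := (y / B) `^ de^-1.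
  have u0 : 0 < u by rewrite powR_gt0.
  have uE : u `^ de = y / B by rewrite -powRrM mulVf ?lt0r_neq0// powRr1// ltW.
  have := laplace_fI1 n u0; rewrite uE => H.
  have -> : y = lam * (kap * (y / B * mI `^ (- de) * (Gammaf (mI + de) / Gammaf mI))).
    transitivity (B * (y / B)); first by rewrite mulrCA mulfV ?mulr1// lt0r_neq0.
    by rewrite {1}/B; move: (y / B) (Gammaf (mI + de) / Gammaf mI) => *; ring.
  rewrite -H -[zero n]setIT -integral_indic//.
  apply: le_integral_EFin => //.
  - by apply: measurableT_comp => //; apply: measurableT_comp => //; exact: measurable_funM.
  move=> w _; rewrite indicE ler0n /=; case: (boolP (w \in zero n)) => [/set_mem w0|_]; last exact: expR_ge0.
  by rewrite -expR0 ler_expR oppr_ge0 mulr_ge0_le0// ltW.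
have E := fineK (fin_num_measure P _ (mzero n)).
suff p0 : fine (P (zero n)) = 0 by have := E; rewrite p0 => <-.
have {}key y : 0 < y -> fine (P (zero n)) <= expR (- y).
  by move=> y0; rewrite -lee_fin E; exact: key.
move: key (fine_ge0 (measure_ge0 P (zero n))); move: (fine _) => p key.
rewrite le_eqVlt => /predU1P[<-//|p0].
(* For p > 0, taking y = 1/p gives e^(1/p) <= 1/p, against 1 + 1/p <= e^(1/p). *)
have pV : 0 < p^-1 by rewrite invr_gt0.
have := key _ pV; rewrite expRN -ler_pV2 ?inE ?unitfE ?invr_gt0 ?expR_gt0 ?p0 ?gt_eqF ?invr_gt0 ?expR_gt0//.
rewrite invrK => /(le_trans (expR_ge1Dx _)); rewrite -lerBrDr subrr.
by rewrite leNgt ltr01.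
Qed.

Let neg n i : set Omega := [set w | h n i w < 0].

(** [gamma_law] integrates over nonnegative values only, an empty range here. *)
Let P_neg n i : measurable (neg n i) /\ P (neg n i) = 0%E.
Proof.
have E : neg n i = h n i @^-1` `]-oo, 0[ by apply/seteqP; split => w; rewrite /neg /= in_itv.
rewrite E (hlaw n i).2//; split.
  by rewrite -[X in measurable X]setTI; exact: mh.
rewrite (_ : _ `&` _ = set0) ?integral_set0//.
apply/seteqP; split => y //=; rewrite !in_itv /= andbT => -[y1 y2].
by move: (lt_le_trans y1 y2); rewrite ltxx.
Qed.

(** The exceptional set gathers infinite interference, zero interference and a negative fading gain
    at some point, each of probability zero. *)
Lemma interf_shot : exists N, [/\ measurable N, P N = 0%E &
  forall w, ~ N w -> forall n,
    interf dist alpha x (h n) w = (shot dist alpha x (h n) w)%:E].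
Proof.
have NG (A : set Omega) : measurable A -> P A = 0%E -> P.-negligible A by move=> mA A0; exists A; split => //; exact: subset_refl.
have [N [mN N0 sub]] : P.-negligible (~` [set w | fin w] `|` (zero ord0 `|` zero ord_max) `|`
    \bigcup_i (neg ord0 i `|` neg ord_max i)).
  apply: negligibleU; first apply: negligibleU; last 2 first.
  - by apply: negligibleU; apply: NG; [exact: mzero|exact: P_zero|exact: mzero|exact: P_zero].
  - apply: negligible_bigcup => i; apply: negligibleU; apply: NG;
    by [case: (P_neg ord0 i)|case: (P_neg ord_max i)].
  - by apply: NG; [exact: measurableC|exact: P_nfin].
exists N; split => // w Nw n.
have {}Nw : ~ (~` [set w | fin w] `|` (zero ord0 `|` zero ord_max) `|`
    \bigcup_i (neg ord0 i `|` neg ord_max i)) w by move=> /sub.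
have fw : fin w by apply: contrapT => nf; apply: Nw; left; left.
have In_lty : (In n w < +oo)%E by move: fw => /andP[]; case: (ord2P n) => ->.
have nz : 0 < fI n w.
  rewrite ltNge; apply/negP => z; apply: Nw; left; right.
  by case: (ord2P n) z => -> z; [left|right].
have hk i : h n i w = k n i w.
  rewrite /k; symmetry; apply/max_idPl; rewrite leNgt; apply/negP => hn; apply: Nw; right.
  by exists i => //; case: (ord2P n) hn => -> hn; [left|right].
have -> : interf dist alpha x (h n) w = In n w.
  by rewrite /In /interf; congr (_ * _)%E; apply: eq_eseriesr => i _; rewrite hk.
by rewrite /shot -/(In n w) -/(fI n w) nz fineK// ge0_fin_numE.
Qed.

Let shot_laplace u v M : 0 <= u -> 0 <= v -> 0 < u + v ->
  (\int[gam ord0 0 \x gam ord0 0]_(q in pos `*` pos) ((u * q.1 + v * q.2) `^ de)%:E = M%:E)%E ->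
  (\int[P]_w (expR (- (u * shot dist alpha x (h ord0) w + v * shot dist alpha x (h ord_max) w)))%:E
   = (expR (- (lam * (kap * M))))%:E)%E.
Proof.
move=> u0 v0 uv ME; rewrite -(laplace_fI u0 v0 uv ME).
apply: (@integral_eq_off_null _ _ _ _ (zero ord0 `|` zero ord_max)) => //.
- exact: measurableU.
- apply/eqP; rewrite -measure_le0 (le_trans (measureU2 _ (mzero _) (mzero _)))//.
  by rewrite [X in (X + _)%E]P_zero [X in (_ + X)%E]P_zero adde0.
- apply: measurableT_comp => //; apply: measurableT_comp => //.
  by apply: measurable_funD; apply: measurable_funM => //; exact: measurable_shot.
move=> w Nw.
have E n : shot dist alpha x (h n) w = fI n w.
  rewrite /shot -/(In n w) -/(fI n w) ifT// ltNge; apply/negP => z; apply: Nw.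
  by case: (ord2P n) z => -> z; [left|right].
by rewrite !E.
Qed.

(** Origin of the factor d^2 in the formula. *)
Let c_de : c `^ de = dist ^+ 2.
Proof.
rewrite /c /de -powRrM mulrCA mulfV ?mulr1 ?lt0r_neq0//; last exact: lt_trans alpha2.
by rewrite powR_mulrn// ltW.
Qed.

Lemma shot_laplace_pair (u v : R) : 0 < u -> 0 < v ->
  (\int[P]_w (expR (- (u * shot dist alpha x (h ord0) w + v * shot dist alpha x (h ord_max) w)))%:E
   = (expR (- (pi * lam * (u `^ (2 / alpha) * dist ^+ 2 * Gammaf (1 - 2 / alpha) *
        mI `^ (- (2 / alpha)) * Gammaf (2 / alpha + 2 * mI) *
        hyp2F1reg (- (2 / alpha)) mI (2 * mI) (1 - v / u)))))%:E)%E.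
Proof.
move=> u0 v0.
rewrite (shot_laplace (ltW u0) (ltW v0) (addr_gt0 u0 v0)
  (Gamma_pair_powR_moment mI0 de01 (@gamE ord0 0%N) u0 v0)).
congr (expR (- _))%:E; rewrite /kap c_de -/de [2 * mI + de]addrC.
move: (Gammaf (1 - de)) (Gammaf (de + 2 * mI)) (hyp2F1reg _ _ _ _) => *; ring.
Qed.

Lemma shot_laplace_single (v : R) : 0 < v ->
  (\int[P]_w (expR (- (0 * shot dist alpha x (h ord0) w + v * shot dist alpha x (h ord_max) w)))%:E
   = (expR (- (pi * lam * (v `^ (2 / alpha) * dist ^+ 2 * Gammaf (1 - 2 / alpha) *
        mI `^ (- (2 / alpha)) * (Gammaf (2 / alpha + mI) / Gammaf mI)))))%:E)%E.
Proof.
move=> v0; have uv : 0 < 0 + v by rewrite add0r.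
rewrite (shot_laplace (lexx 0) (ltW v0) uv (Gamma_powR_moment mI0 de01 (@gamE ord0 0%N) v0)).
congr (expR (- _))%:E; rewrite /kap c_de -/de [mI + de]addrC.
move: (Gammaf (1 - de)) (Gammaf (de + mI) / Gammaf mI) => *; ring.
Qed.

(** The interference depends on positions and fading marks only, so it stays frozen when the signal
    gain of branch [b] is integrated out. *)
Lemma measurable_shot_others b n :
  measurable_fun setT
    (shot dist alpha x (h n) : g_sigma_algebraType (other_sets F (Some (inl b))) -> R).
Proof.
apply: (@measurable_shot R _ (g_sigma_algebraType (other_sets F (Some (inl b))))) => i.
  by apply: (measurable_others (i := None)) => //; exact: Fx.
by apply: (measurable_others (i := Some (inr (n, i)))) => //; exact: (Fh (n, i)).
Qed.

End model.

(** * Success probability *)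

Section success_probability.
Context {R : realType} {d : measure_display} {Omega : measurableType d}.
Variables (P : probability Omega R) (lam dist alpha T mI : R) (n : nat) (snr : \bar R)
  (x : nat -> Omega -> R * R) (g : 'I_2 -> Omega -> R) (h : 'I_2 -> nat -> Omega -> R).
Hypotheses (lam0 : 0 < lam) (dist0 : 0 < dist) (alpha2 : 2 < alpha) (mI0 : 0 < mI).
Hypothesis snr0 : (0 < snr)%E.
Hypothesis HP : is_PPP P lam x.
Hypothesis glaw : forall b, gamma_law P n.+1%:R (g b).
Hypothesis hlaw : forall b i, gamma_law P mI (h b i).
Local Notation F := (mark_sets x g h).
Hypothesis indF : mutually_indep P F.

Let mD : R := n.+1%:R.
Let mD0 : 0 < mD. Proof. by []. Qed.
Let mx i : measurable_fun setT (x i). Proof. exact: HP.1. Qed.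
Let mh b i : measurable_fun setT (h b i). Proof. exact: (hlaw b i).1. Qed.
Let mg b : measurable_fun setT (g b). Proof. exact: (glaw b).1. Qed.
Let q : R := inv_snr snr.
Let q0 : 0 <= q.
Proof. by rewrite /q; case: snr snr0 => //= r; rewrite lte_fin => r0; rewrite invr_ge0 ltW. Qed.

Let a b w : R := shot dist alpha x (h b) w + q.
Let a0 b w : 0 < a b w. Proof. by rewrite ltr_wpDr// shot_gt0. Qed.
Let ma b : measurable_fun setT (a b).
Proof. by apply: measurable_funD => //; exact: measurable_shot. Qed.

Let X z w : R := mD * Num.max (T - z) 0 * a ord0 w.
Let Y z w : R := mD * z * a ord_max w.
Let X0 z w : 0 <= X z w. Proof. by rewrite !mulr_ge0 ?le_max ?lexx ?orbT// ltW. Qed.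
Let Y0 z w : 0 < z -> 0 <= Y z w. Proof. by move=> z0; rewrite !mulr_ge0// ltW. Qed.
Let mX z : measurable_fun setT (X z). Proof. exact: measurable_funM. Qed.
Let mY z : measurable_fun setT (Y z). Proof. exact: measurable_funM. Qed.

(** The noise is deterministic and factors out as e^(-(u+v)q). For z < T both weights are positive
    with ratio v/u = z t / ((T - z) s); for z >= T the first weight is zero and the single moment
    applies. This is the case split of [Afun]. *)
Let expo_fun_laplace z s t : 0 < z -> 0 < s -> 0 < t ->
  (expo_fun lam T dist alpha mI n.+1 snr z s t)%:E =
  (\int[P]_w (expR (- (s * X z w)) * expR (- (t * Y z w)))%:E)%E.
Proof.
move=> z0 s0 t0.
pose u := mD * Num.max (T - z) 0 * s; pose v := mD * z * t.
have u0 : 0 <= u by rewrite !mulr_ge0 ?le_max ?lexx ?orbT// ltW.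
have v0 : 0 < v by rewrite !mulr_gt0.
transitivity ((expR (- ((u + v) * q)))%:E * \int[P]_w (expR (- (u * shot dist alpha x (h ord0) w +
    v * shot dist alpha x (h ord_max) w)))%:E)%E; last first.
  rewrite -integralZl_EFin//; last first.
    apply: measurableT_comp => //; apply: measurableT_comp => //.
    by apply: measurable_funD; apply: measurable_funM => //; exact: measurable_shot.
  apply: eq_integral => w _; rewrite -!expRD; congr (expR _)%:E.
  by rewrite /u /v /X /Y /a; ring.
have mDI : (n.+1%:R / mI) `^ (2 / alpha) = mD `^ (2 / alpha) * mI `^ (- (2 / alpha)).
  by rewrite powRM ?invr_ge0 ?(ltW mI0)// -[mI^-1](powR_inv1 (ltW mI0)) -powRrM mulN1r.
have -> : (\int[P]_w (expR (- (u * shot dist alpha x (h ord0) w +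
    v * shot dist alpha x (h ord_max) w)))%:E = (expR (- (pi * lam * Afun T dist alpha mI n.+1 z s t)))%:E)%E.
  rewrite /Afun; case: ifPn => [zT|]; last first.
    rewrite -leNgt => Tz.
    have -> : u = 0 by rewrite /u (max_idPr _) ?mulr0 ?mul0r// subr_le0.
    rewrite (shot_laplace_single lam0 dist0 alpha2 mI0 HP mg hlaw indF v0).
    congr (expR (- (_ * _)))%:E.
    have -> : v `^ (2 / alpha) = (z * t) `^ (2 / alpha) * mD `^ (2 / alpha).
      by rewrite -powRM ?mulr_ge0 ?(ltW z0) ?(ltW t0) ?(ltW mD0)// /v; congr (_ `^ _); ring.
    rewrite mDI; move: (Gammaf (1 - 2 / alpha)) (Gammaf _ / Gammaf _) => *; ring.
  have Tz : 0 < T - z by rewrite subr_gt0.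
  have mE : Num.max (T - z) 0 = T - z by apply/max_idPl; exact: ltW.
  have up : 0 < u by rewrite /u mE !mulr_gt0.
  rewrite (shot_laplace_pair lam0 dist0 alpha2 mI0 HP mg hlaw indF up v0).
  congr (expR (- (_ * _)))%:E.
  have -> : v / u = z * t / ((T - z) * s).
    by rewrite /u /v mE; field; rewrite !lt0r_neq0.
  have -> : u `^ (2 / alpha) = s `^ (2 / alpha) * (T - z) `^ (2 / alpha) * mD `^ (2 / alpha).
    rewrite -!powRM ?mulr_ge0 ?(ltW Tz) ?(ltW s0) ?(ltW mD0)//.
    by rewrite /u mE; congr (_ `^ _); ring.
  rewrite mDI; move: (Gammaf (1 - 2 / alpha)) (Gammaf (2 / alpha + 2 * mI)) (hyp2F1reg _ _ _ _) => *; ring.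
rewrite -EFinM -expRD /expo_fun; congr (expR _)%:E.
by rewrite /u /v -/q -/mD; ring.
Qed.

Let exp01 (y : R) : 0 <= y -> 0 <= expR (- y) <= 1.
Proof. by move=> y0; rewrite expR_ge0 -expR0 ler_expR oppr_le0. Qed.

Let mexpX s z : measurable_fun setT (fun w => expR (- (s * X z w))).
Proof. by apply: measurableT_comp => //; apply: measurableT_comp => //; exact: measurable_funM. Qed.

Lemma mixed_derivE k z : 0 < z ->
  mixed_deriv lam T dist alpha mI n.+1 snr k z =
  (-1) ^+ (k + n.+1) * (\int[P]_w (X z w ^+ k * Y z w ^+ n.+1 * expR (- (X z w + Y z w))))%R.
Proof.
move=> z0; rewrite /mixed_deriv.
(* Weight of the outer derivative, bounded by mD! through [pow_expRN_le]. *)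
pose W w := Y z w ^+ n.+1 * expR (- Y z w).
have mW : measurable_fun setT W.
  apply: measurable_funM; first exact: measurable_funX.
  by apply: measurableT_comp => //; exact: measurableT_comp.
have W0 w : 0 <= W w <= n.+1`!%:R.
  have Yw := Y0 w z0; rewrite mulr_ge0 ?expR_ge0 ?exprn_ge0//=.
  by have := @pow_expRN_le R 1 _ n.+1 ltr01 Yw; rewrite mul1r expr1n divr1.
transitivity (derive1n k (fun s => (-1) ^+ n.+1 * \int[P]_w (W w * expR (- (s * X z w))))%R 1); last first.
  have H := derive1n_laplace P mW (mX z) W0 (X0 z) ((-1) ^+ n.+1) k ltr01.
  apply: (etrans H); rewrite addnC exprD.
  apply: (congr1 (fun y => (-1) ^+ n.+1 * (-1) ^+ k * y)).
  by apply: eq_Rintegral => w _; rewrite /W mul1r opprD expRD; ring.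
apply: derive1n_eq_gt0 => // s s0.
have e01 w : 0 <= expR (- (s * X z w)) <= 1 by apply: exp01; rewrite mulr_ge0// ltW.
transitivity (derive1n n.+1 (fun t => 1 * \int[P]_w (expR (- (s * X z w)) * expR (- (t * Y z w))))%R 1).
  apply: derive1n_eq_gt0 => // t t0.
  by rewrite mul1r /Rintegral -expo_fun_laplace.
have H := derive1n_laplace P (mexpX s z) (mY z) e01 (fun w => Y0 w z0) 1 n.+1 ltr01.
apply: (etrans H); rewrite mul1r.
apply: (congr1 (fun y => (-1) ^+ n.+1 * y)).
by apply: eq_Rintegral => w _; rewrite /W mul1r; ring.
Qed.

Let MR := measurableTypeR R.
Let mgR b : measurable_fun setT (g b : Omega -> MR). Proof. exact: mg. Qed.
Let gam b : probability MR R := image_prob P (mgR b).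
Let pos : set R := `]0%R, +oo[%classic.

Let gamE b (f : R -> \bar R) : measurable_fun setT f ->
  (forall x, 0 < x -> (0 <= f x)%E) ->
  (\int[gam b]_(x in pos) f x = \int[lebesgue_measure]_(x in pos) (f x * (gamma_pdf mD x)%:E))%E.
Proof.
apply: (integral_density (measurable_gamma_pdf mD) (gamma_pdf_ge0 mD0)) => B mB.
exact: (glaw b).2.
Qed.

Let Fg b (B : set R) : measurable B -> F (Some (inl b)) (g b @^-1` B).
Proof. by move=> mB; apply: sub_sigma_algebra; exists B. Qed.

Let Fsig := mark_sigma_algebra x g h.
Let Fmeas := mark_sigma_measurable HP mg hlaw.

Let ma_others b c :
  measurable_fun setT (a c : g_sigma_algebraType (other_sets F (Some (inl b))) -> R).
Proof. by apply: measurable_funD => //; exact: measurable_shot_others. Qed.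

Let G (c : R) : R :=
  \sum_(k < n.+1) (mD * Num.max c 0) ^+ k / k`!%:R * expR (- (mD * Num.max c 0)).

Let mG : measurable_fun setT G.
Proof.
have mm : measurable_fun setT (fun c : R => mD * Num.max c 0).
  by apply: measurable_funM => //; exact: measurable_maxr.
apply: measurable_sum => k; apply: measurable_funM.
  by apply: measurable_funM => //; exact: measurable_funX.
by apply: measurableT_comp => //; exact: measurableT_comp.
Qed.

Let G0 c : 0 <= G c.
Proof.
apply: sumr_ge0 => k _; rewrite !mulr_ge0 ?expR_ge0 ?invr_ge0// exprn_ge0//.
by rewrite mulr_ge0 ?le_max ?lexx ?orbT.
Qed.

Let ker z w : R := \sum_(k < n.+1) (k`!%:R * n`!%:R)^-1 * (z^-1 *
  (X z w ^+ k * Y z w ^+ n.+1 * expR (- (X z w + Y z w)))).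

Let mdiv (d' : measure_display) (S : measurableType d') (f1 f2 : S -> R) :
  measurable_fun setT f1 -> measurable_fun setT f2 -> measurable_fun setT (fun w => f1 w / f2 w).
Proof. by move=> m1 m2; apply: measurable_funM => //; exact: (measurableT_comp measurable_invr). Qed.

Let success_kernel :
  (\int[P]_w ((T <= g ord0 w / a ord0 w + g ord_max w / a ord_max w)%R%:R)%:E =
   \int[P]_w \int[lebesgue_measure]_(z in pos) (ker z w)%:E)%E.
Proof.
pose f1 w (y : R) : \bar R := ((T <= y / a ord0 w + g ord_max w / a ord_max w)%R%:R)%:E.
pose f2 w (y : R) : \bar R := (G (a ord0 w * (T - y / a ord_max w)))%:E.
have mf1 : measurable_fun setT (fun p : g_sigma_algebraType (other_sets F (Some (inl ord0))) * MR => f1 p.1 p.2).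
  apply/measurable_EFinP; apply: measurable_boolR; apply: measurable_fun_ler => //.
  apply: measurable_funD.
    by apply: mdiv => //; exact: (measurableT_comp (@ma_others ord0 ord0)).
  apply: mdiv; last exact: (measurableT_comp (@ma_others ord0 ord_max)).
  have mg1 : measurable_fun setT
      (g ord_max : g_sigma_algebraType (other_sets F (Some (inl ord0))) -> R).
    by apply: (measurable_others (i := Some (inl ord_max))) => //; exact: Fg.
  exact: (measurableT_comp mg1).
rewrite [LHS](indep_fubini Fsig Fmeas indF (mgR ord0) (@Fg ord0) mf1); last first.
  by move=> w y; rewrite lee_fin ler0n.
transitivity (\int[P]_w f2 w (g ord_max w))%E.
  apply: eq_integral => w _; rewrite -/(gam ord0).
  rewrite /f2 /G -(gamma_survival (@gamE ord0)); apply: eq_integral => y _.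
  rewrite /f1; congr (_%:R)%:E.
  by rewrite -lerBlDr ler_pdivlMr// mulrC.
have mf2 : measurable_fun setT (fun p : g_sigma_algebraType (other_sets F (Some (inl ord_max))) * MR => f2 p.1 p.2).
  have ma' c : measurable_fun setT
      (fun p : g_sigma_algebraType (other_sets F (Some (inl ord_max))) * MR => a c p.1).
    exact: (measurableT_comp (@ma_others ord_max c)).
  apply/measurable_EFinP; apply: (measurableT_comp mG).
  move: (a ord0) (a ord_max) (ma' ord0) (ma' ord_max) => b1 b2 mb1 mb2.
  apply: measurable_funM => //.
  by apply: measurable_funB => //; exact: mdiv.
rewrite [LHS](indep_fubini Fsig Fmeas indF (mgR ord_max) (@Fg ord_max) mf2); last first.
  by move=> w y; rewrite lee_fin.
apply: eq_integral => w _; rewrite -/(gam ord_max) /f2 /G.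
by rewrite (mrc_kernel (@gamE ord_max) T (a0 ord0 w) (a0 ord_max w)).
Qed.

Let term k z w : R := X z w ^+ k * Y z w ^+ n.+1 * expR (- (X z w + Y z w)).

Let mterm k : measurable_fun setT (fun p : MR * Omega => term k p.1 p.2).
Proof.
have ma' c : measurable_fun setT (fun p : MR * Omega => a c p.2).
  exact: (measurableT_comp (@ma c)).
rewrite /term /X /Y; move: (a ord0) (a ord_max) (ma' ord0) (ma' ord_max) => b1 b2 mb1 mb2.
have mX' : measurable_fun setT (fun p : MR * Omega => mD * Num.max (T - p.1) 0 * b1 p.2).
  apply: measurable_funM => //; apply: measurable_funM => //; apply: measurable_maxr => //.
  exact: measurable_funB.
have mY' : measurable_fun setT (fun p : MR * Omega => mD * p.1 * b2 p.2).
  by apply: measurable_funM => //; exact: measurable_funM.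
apply: measurable_funM; first by apply: measurable_funM; exact: measurable_funX.
apply: measurableT_comp => //; apply: measurableT_comp => //; exact: measurable_funD.
Qed.

Let term01 k z w : 0 < z -> 0 <= term k z w <= k`!%:R * n.+1`!%:R.
Proof.
move=> z0; have x0 := X0 z w; have y0 := Y0 w z0.
have E : term k z w = (X z w ^+ k * expR (- (1 * X z w))) * (Y z w ^+ n.+1 * expR (- (1 * Y z w))).
  by rewrite /term !mul1r opprD expRD; ring.
have hx := @pow_expRN_le R 1 _ k ltr01 x0; have hy := @pow_expRN_le R 1 _ n.+1 ltr01 y0.
rewrite expr1n divr1 in hx; rewrite expr1n divr1 in hy.
have px : 0 <= X z w ^+ k * expR (- (1 * X z w)) by rewrite mulr_ge0 ?expR_ge0// exprn_ge0.
have py : 0 <= Y z w ^+ n.+1 * expR (- (1 * Y z w)) by rewrite mulr_ge0 ?expR_ge0// exprn_ge0.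
by rewrite E mulr_ge0//= ler_pM.
Qed.

(** The absolute value makes the integrand nonnegative for all [z], as measurability of the partial
    integral requires; for positive [z] it changes nothing. *)
Let psi k (z : MR) : \bar R := (\int[P]_w (`|term k z w|)%:E)%E.

Let mpsi k : measurable_fun setT (psi k).
Proof.
apply: (measurable_fun_fubini_tonelli_F (m2 := P) (fun p : MR * Omega => (`|term k p.1 p.2|)%:E)) => //.
by apply/measurable_EFinP; apply: measurableT_comp.
Qed.

Let psiE k (z : R) : 0 < z -> psi k z = (\int[P]_w (term k z w)%:E)%E.
Proof.
move=> z0; apply: eq_integral => w _.
by rewrite ger0_norm//; case/andP: (@term01 k z w z0).
Qed.

Let mtermz k z : measurable_fun setT (term k z).
Proof. exact: (measurableT_comp (mterm k) (measurable_pair1 z)). Qed.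

Let psi_fin k (z : R) : 0 < z -> psi k z \is a fin_num.
Proof.
move=> z0; rewrite ge0_fin_numE; last by apply: integral_ge0 => w _; rewrite lee_fin.
rewrite psiE//; apply: (@le_lt_trans _ _ (\int[P]_w (k`!%:R * n.+1`!%:R)%:E)%E).
  by apply: le_integral_EFin => // w _; exact: term01.
move: (k`!%:R * n.+1`!%:R) => C.
by rewrite (integral_cst P measurableT C%:E) [X in (_ * X)%E](probability_setT P) mule1 ltry.
Qed.

Let hk k (z : R) : R := z^-1 * fine (psi k z).

Let hk_ge0 k z : 0 < z -> 0 <= hk k z.
Proof.
move=> z0; rewrite mulr_ge0 ?invr_ge0 ?(ltW z0)// fine_ge0//.
by apply: integral_ge0 => w _; rewrite lee_fin.
Qed.

Let mhk k : measurable_fun setT (hk k).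
Proof.
apply: measurable_funM; first exact: measurable_invr.
by apply: measurableT_comp (mpsi k); exact: fine_measurable.
Qed.

Let mixed_hk k z : 0 < z ->
  z^-1 * mixed_deriv lam T dist alpha mI n.+1 snr k z = (-1) ^+ (k + n.+1) * hk k z.
Proof. by move=> z0; rewrite mixed_derivE// /hk psiE// mulrCA. Qed.

Let J k : \bar R := (\int[lebesgue_measure]_(z in pos) (hk k z)%:E)%E.
Let cf (k : nat) : R := (k`!%:R * n`!%:R)^-1.
Let cf_gt0 k : 0 < cf k. Proof. by rewrite invr_gt0 mulr_gt0// ltr0n fact_gt0. Qed.
Let mpos : measurable (pos : set MR). Proof. exact: measurable_itv. Qed.
Let posP (z : R) : pos z -> 0 < z. Proof. by rewrite /pos /= in_itv /= andbT. Qed.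

Let success_sum :
  (\int[P]_w \int[lebesgue_measure]_(z in pos) (ker z w)%:E =
   \sum_(k < n.+1) (cf k)%:E * J k)%E.
Proof.
have mker : measurable_fun setT (fun p : Omega * MR => ker p.2 p.1).
  apply: measurable_sum => k; apply: measurable_funM => //; apply: measurable_funM.
    exact: (measurableT_comp measurable_invr).
  exact: (measurableT_comp (mterm k) (@measurable_swap _ _ _ _)).
rewrite (@tonelli_in _ _ _ _ _ P lebesgue_measure setT pos (fun w z => (ker z w)%:E))//; last 2 first.
- exact/measurable_EFinP.
- move=> w z _ /posP z0; rewrite lee_fin; apply: sumr_ge0 => k _.
  rewrite mulr_ge0 ?(ltW (cf_gt0 k))// mulr_ge0 ?invr_ge0 ?(ltW z0)//.
  by case/andP: (@term01 k z w z0).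
transitivity (\int[lebesgue_measure]_(z in pos) \sum_(k < n.+1) (cf k * hk k z)%:E)%E.
  apply: eq_integral => z /set_mem/posP z0.
  transitivity (\int[P]_w \sum_(k < n.+1) (cf k * z^-1 * term k z w)%:E)%E.
    by apply: eq_integral => w _; rewrite sumEFin; congr EFin; apply: eq_bigr => k _; rewrite -[RHS]mulrA.
  have cz k : 0 <= cf k * z^-1 by rewrite mulr_ge0 ?invr_ge0 ?(ltW z0) ?(ltW (cf_gt0 k)).
  rewrite ge0_integral_sum//; last 2 first.
  - by move=> k; apply/measurable_EFinP; exact: measurable_funM.
  - by move=> k w _; rewrite lee_fin mulr_ge0//; case/andP: (@term01 k z w z0).
  apply: eq_bigr => k _; rewrite integralZl_EFin//; last first.
    by move=> w _; case/andP: (@term01 k z w z0).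
  by rewrite -psiE// -[psi k z]fineK ?psi_fin// -EFinM mulrA.
rewrite ge0_integral_sum//; last 2 first.
- by move=> k; apply/measurable_EFinP; apply: measurable_funTS; apply: measurable_funM; [exact: measurable_cst|exact: mhk].
- by move=> k z /posP z0; rewrite lee_fin mulr_ge0 ?hk_ge0 ?(ltW (cf_gt0 k)).
apply: eq_bigr => k _; rewrite integralZl_EFin//; last exact: (ltW (cf_gt0 k)).
- exact: mhk.
- by move=> z /posP; exact: hk_ge0.
Qed.

Let msinr : measurable_fun setT (sinr_mrc2 dist alpha snr x g h).
Proof.
apply: measurable_sum => b; apply: mdiv => //; apply: measurableT_comp; first exact: fine_measurable.
by apply: emeasurable_funD => //; exact: measurable_interf.
Qed.

Let event : set Omega := [set w | T <= sinr_mrc2 dist alpha snr x g h w].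
Let mevent : measurable event. Proof. exact: measurable_le_set. Qed.

(** Off the null set of [interf_shot], [fine] acts on a genuine real and the SINR is the sum of
    ratios treated in [success_kernel]. *)
Let success_series : P event = (\sum_(k < n.+1) (cf k)%:E * J k)%E.
Proof.
rewrite -success_sum -success_kernel -[event]setIT -integral_indic//.
have [N [mN N0 NE]] := interf_shot lam0 dist0 alpha2 mI0 HP mg hlaw indF.
apply: (integral_eq_off_null mN N0) => //.
- apply: measurable_boolR; apply: measurable_fun_ler => //.
  by apply: measurable_funD; exact: mdiv.
move=> w Nw; rewrite indicE.
have -> : (w \in event) = (T <= sinr_mrc2 dist alpha snr x g h w).
  by apply/idP/idP => [/set_mem//|H]; exact/mem_set.
rewrite /sinr_mrc2 big_ord_recl big_ord1.
have -> : lift ord0 ord0 = ord_max :> 'I_2 by exact: val_inj.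
by rewrite !NE.
Qed.

Let J_ge0 k : (0 <= J k)%E.
Proof. by apply: integral_ge0 => z /posP z0; rewrite lee_fin hk_ge0. Qed.

(** Nonnegative integrals with positive coefficients add up to a probability, so none is
    infinite. *)
Let J_fin (k : 'I_n.+1) : J k \is a fin_num.
Proof.
rewrite ge0_fin_numE//.
have : ((cf k)%:E * J k <= 1)%E.
  apply: (@le_trans _ _ (P event)); last exact: probability_le1.
  rewrite success_series (bigD1 k)//= leeDl// sume_ge0// => i _.
  by rewrite mule_ge0// lee_fin ltW.
move=> /le_lt_trans/(_ (ltry 1)).
have [->|//] := eqVneq (J k) +oo%E.
  by rewrite gt0_muley ?lte_fin// ltxx.
by rewrite -ltey.
Qed.

Lemma success_probabilityE :
  P [set w | T <= sinr_mrc2 dist alpha snr x g h w] =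
  (P_mrc2_formula lam T dist alpha mI n.+1 snr)%:E.
Proof.
rewrite success_series /P_mrc2_formula -sumEFin; apply: eq_bigr => k _.
rewrite -[J k]fineK// -EFinM; congr EFin.
(* Finiteness of [J k] is what allows the sign to be taken out of the real-valued integral. *)
have -> : (\int[lebesgue_measure]_(z in `]0%R, +oo[)
    (z^-1 * mixed_deriv lam T dist alpha mI n.+1 snr k z))%R = (-1) ^+ (k + n.+1) * fine (J k).
  transitivity (\int[lebesgue_measure]_(z in pos) ((-1) ^+ (k + n.+1) * hk k z))%R.
    by apply: eq_Rintegral => z /set_mem/posP z0; exact: mixed_hk.
  have ih : (@lebesgue_measure R).-integrable pos (EFin \o hk k).
    apply: (@dominated_integrable_EFin _ _ _ (@lebesgue_measure R) pos mpos (hk k) (hk k)).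
    - exact: mhk.
    - exact: mhk.
    - by move=> z /posP z0; rewrite ger0_norm// hk_ge0.
    - by have := J_fin k; rewrite ge0_fin_numE.
  exact: (RintegralZl ((-1) ^+ (k + n.+1)) mpos ih).
(* The two signs (-1)^(k + mD) cancel, and Gamma(mD) is n! for mD = n + 1. *)
rewrite Gammaf_nat mulrA /cf [_ / _ * _]mulrAC -exprD -signr_odd oddD addbb expr0 mul1r.
by [].
Qed.
End success_probability.

Theorem theorem1 (R : realType) (d : measure_display) (Omega : measurableType d)
  (P : probability Omega R)
  (lam dist alpha T mI : R) (mD : nat) (snr : \bar R)
  (x : nat -> Omega -> R * R)
  (g : 'I_2 -> Omega -> R) (h : 'I_2 -> nat -> Omega -> R) :
  0 < lam -> 0 < dist -> 2 < alpha -> 0 < T -> 0 < mI -> (0 < mD)%N ->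
  (0 < snr)%E ->
  is_PPP P lam x ->
  (forall n, gamma_law P mD%:R (g n)) ->
  (forall n i, gamma_law P mI (h n i)) ->
  mutually_indep P
    (fun o : option ('I_2 + ('I_2 * nat)) =>
       match o with
       | None => sigma_pp x
       | Some (inl n) => sigma_rv (g n)
       | Some (inr (n, i)) => sigma_rv (h n i)
       end) ->
  P [set w | T <= sinr_mrc2 dist alpha snr x g h w] =
  (P_mrc2_formula lam T dist alpha mI mD snr)%:E.
Proof.
move=> lam0 dist0 alpha2 _ mI0; case: mD => // n _ snr0 HP glaw hlaw indF.
exact: (success_probabilityE T lam0 dist0 alpha2 mI0 snr0 HP glaw hlaw indF).
Qed.
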